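(* Let $\mathcal{W}$ be the collection of all compact convex sets in $\mathbb{R}^2$ that are centrally symmetric (about the origin) and have nonempty interior, equipped with the Hausdorff distance. Then each of the two collections $$\{S_a : a\in C^\infty(\mathbb{T}^2,(0,\infty)),\ a\text{ non-constant}\}\quad\text{and}\quad\{\overline B_1^a : a\in C^\infty(\mathbb{T}^2,(0,\infty)),\ a\text{ non-constant}\}$$ is a proper dense subset of $\mathcal{W}$; that is, each is contained in $\mathcal W$, is not equal to $\mathcal{W}$, and is dense in $\mathcal{W}$.
   Context: $\mathbb{T}^2=\mathbb{R}^2/\mathbb{Z}^2$ is the flat torus; functions on $\mathbb{T}^2$ are identified with $\mathbb{Z}^2$-periodic functions on $\mathbb{R}^2$. For a continuous function $a:\mathbb{T}^2\to(0,\infty)$ and $p\in\mathbb{R}^2$, the effective Hamiltonian $\overline H_a(p)$ is the unique real number such that the cell problem $a(y)|p+Dv(y)|=\overline H_a(p)$ in $\mathbb{T}^2$ admits a continuous ($\mathbb{Z}^2$-periodic) viscosity solution $v$. Equivalently (a known fact), $$\overline H_a(p)=\inf_{\phi\in C^\infty(\mathbb{T}^2)}\max_{y\in\mathbb{T}^2}a(y)|p+D\phi(y)|.$$ The function $\overline H_a$ is convex, even and positively homogeneous of degree $1$. Set $S_a=\{p\in\mathbb{R}^2:\overline H_a(p)\le 1\}$. Let $d_a$ be the distance on $\mathbb{R}^2$ given by $d_a(x,y)=\inf_\xi\int_0^1\frac{|\dot\xi(t)|}{a(\xi(t))}\,dt$, the infimum being over (piecewise) $C^1$ curves $\xi:[0,1]\to\mathbb{R}^2$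 from $x$ to $y$ (the Riemannian distance of the periodic metric $a(x)^{-2}(dx_1^2+dx_2^2)$). The stable norm associated with $a$ is $$\|v\|_a=\lim_{\lambda\to\infty}\frac{d_a(0,\lambda v)}{\lambda},\qquad v\in\mathbb{R}^2,$$ and $\overline B_1^a=\{v\in\mathbb{R}^2:\|v\|_a\le 1\}$ is its closed unit ball. Equivalently (a known fact), $\overline B_1^a$ is the dual (polar) convex set $\{v\in\mathbb{R}^2: v\cdot p\le 1\ \text{for all }p\in S_a\}$ of $S_a$. *)

(* Defs.v *)
From HB Require Import structures.
From mathcomp Require Import all_boot all_order all_algebra.
From mathcomp Require Import all_classical all_reals all_analysis.

Set Implicit Arguments.
Unset Strict Implicit.
Unset Printing Implicit Defensive.

Import Order.TTheory GRing.Theory Num.Theory.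
Import numFieldNormedType.Exports.

Local Open Scope classical_set_scope.
Local Open Scope ring_scope.

Section Plane.
Context {R : realType}.
Local Notation plane := 'rV[R]_2.

(* The library norm `|x| on 'rV[R]_2 is the sup norm (it induces the same
   topology); all metric notions below use the Euclidean norm. *)
Definition dotp (x y : plane) : R := \sum_(i < 2) x 0 i * y 0 i.
Definition enorm (x : plane) : R := Num.sqrt (dotp x x).

(* Functions on the torus R^2/Z^2 are Z^2-periodic functions on R^2. *)
Definition periodic (f : plane -> R) : Prop :=
  forall (k : 'rV[int]_2) (x : plane), f (x + map_mx intr k) = f x.

Definition partial (i : 'I_2) (f : plane -> R) : plane -> R :=
  'D_(delta_mx 0 i) f.

Definition gradient (f : plane -> R) (x : plane) : plane :=
  \row_(i < 2) partial i f x.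

Fixpoint Ck (k : nat) (f : plane -> R) : Prop :=
  continuous f /\
  if k is k'.+1 then
    forall i : 'I_2,
      (forall x, derivable f x (delta_mx 0 i)) /\ Ck k' (partial i f)
  else True.

Definition smooth (f : plane -> R) : Prop := forall k, Ck k f.

Definition nonconstant (f : plane -> R) : Prop := exists x y, f x <> f y.

Definition coefficient (a : plane -> R) : Prop :=
  [/\ periodic a, smooth a, (forall x, 0 < a x) & nonconstant a].

Definition viscosity_subsolution (a : plane -> R) (p : plane) (c : R)
    (v : plane -> R) : Prop :=
  forall (phi : plane -> R) (y : plane), Ck 1 phi ->
    (\forall z \near y, v z - phi z <= v y - phi y) ->
    a y * enorm (p + gradient phi y) <= c.

Definition viscosity_supersolution (a : plane -> R) (p : plane) (c : R)
    (v : plane -> R) : Prop :=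
  forall (phi : plane -> R) (y : plane), Ck 1 phi ->
    (\forall z \near y, v y - phi y <= v z - phi z) ->
    c <= a y * enorm (p + gradient phi y).

Definition cell_problem_solvable (a : plane -> R) (p : plane) (c : R) : Prop :=
  exists v : plane -> R,
    [/\ continuous v, periodic v,
        viscosity_subsolution a p c v & viscosity_supersolution a p c v].

(* [get] selects the number c, which is unique when a is continuous, periodic
   and positive. *)
Definition effective_hamiltonian (a : plane -> R) (p : plane) : R :=
  get [set c : R | cell_problem_solvable a p c].

Definition Sset (a : plane -> R) : set plane :=
  [set p | effective_hamiltonian a p <= 1].

Definition C1_curve (xi : R -> plane) : Prop :=
  (forall t, derivable xi t 1) /\ continuous (derive1 xi).

(* C^1 on a closed subinterval means being the restriction of a C^1 curve
   defined on the whole line; the values of xi outside [0, 1] are irrelevant. *)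
Definition piecewise_C1 (xi : R -> plane) : Prop :=
  exists (n : nat) (t : nat -> R),
    [/\ t 0%N = 0, t n = 1 &
      forall i, (i < n)%N -> t i < t i.+1 /\
        exists2 eta : R -> plane, C1_curve eta &
          {in `[t i, t i.+1], xi =1 eta}].

(* The derivative of xi may be meaningless at the finitely many breakpoints and
   at 0 and 1, which does not affect the Lebesgue integral. *)
Definition weighted_length (a : plane -> R) (xi : R -> plane) : R :=
  \int[lebesgue_measure]_(t in `[0, 1]) (enorm (derive1 xi t) / a (xi t)).

Definition metric_dist (a : plane -> R) (x y : plane) : R :=
  inf [set weighted_length a xi | xi in
        [set xi | [/\ piecewise_C1 xi, xi 0 = x & xi 1 = y]]].

Definition stable_norm (a : plane -> R) (v : plane) : R :=
  lim ((metric_dist a 0 (l *: v) / l) @[l --> +oo]).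

Definition stable_ball (a : plane -> R) : set plane :=
  [set v | stable_norm a v <= 1].

Definition centrally_symmetric (K : set plane) : Prop :=
  forall x, K x -> K (- x).

Definition Wbodies : set (set plane) :=
  [set K : set plane | [/\ compact K, convex_set K, centrally_symmetric K & K° !=set0]].

Definition dist_to_set (x : plane) (A : set plane) : \bar R :=
  ereal_inf [set (enorm (x - y))%:E | y in A].

(* Extended real valued, so that it is meaningful for arbitrary sets. *)
Definition hausdorff_dist (A B : set plane) : \bar R :=
  maxe (ereal_sup [set dist_to_set x B | x in A])
       (ereal_sup [set dist_to_set y A | y in B]).

Definition hausdorff_dense (C W : set (set plane)) : Prop :=
  forall K, W K -> forall eps : R, 0 < eps ->
    exists2 K', C K' & (hausdorff_dist K K' < eps%:E)%E.

End Plane.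

(* Main.v *)
(** Both families are families of unit balls of norms. The stable norm is a norm
    equivalent to the Euclidean one, and the effective Hamiltonian is its dual
    norm: at the level [c = sup {p . v : |v|_a <= 1}] a Busemann function of the
    distance, minus [p . x], solves the cell problem, and comparison of sub- and
    supersolutions excludes every other level.

    Neither family is everything, by an entropy count. Coefficients whose
    derivatives up to order 6 and inverse are bounded by M fall into few classes
    of almost proportional distances, hence of almost equal unit balls, whereas m
    small cuts tangent to a parabola can be made or omitted independently in a
    convex body. For m large some pattern of cuts is realised by no coefficient
    bounded by M, and a body containing one such pattern for every M is missed.

    For density, let h be the support function of L and take finitely many
    lattice vectors [u_i] in almost all directions, no two of them parallel. Let
    1/a be close to [h(u_i) / |u_i|] on the lines directed by [u_i] through the
    lattice points, and larger away from them. The segment from 0 to [u_i] shows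
    that the stable norm of [u_i] is at most about [h(u_i)]. Conversely each p in
    L has a calibration [p . x + bounded] with gradient of norm at most 1/a,
    obtained by subtracting, near each line, the component of p normal to it; so
    the stable norm is at least h. *)

From mathcomp Require Import all_boot all_order all_algebra.
From mathcomp Require Import zify ring lra.
From mathcomp Require Import all_classical all_reals all_analysis.
From mathcomp Require Import measurable_realfun.
Require Import Defs.

Set Implicit Arguments.
Unset Strict Implicit.
Unset Printing Implicit Defensive.

Import Order.TTheory GRing.Theory Num.Theory.
Import numFieldNormedType.Exports.

Local Open Scope classical_set_scope.
Local Open Scope ring_scope.

(** * Euclidean geometry of the plane *)

(** The order 6 comes from comparing dimensions. At scale 1/n a coefficient on the torus has about
    n^2 degrees of freedom, and control of k derivatives fixes it up to n^-k. A planar convex body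
    offers m free cuts, of depth m^-2 only; with m slightly above n^2 the depth is about n^-4. Any k
    > 4 tips the balance, and k = 6 leaves room for logarithms. The count sees a norm only through
    homogeneity and its monotonicity in the coefficient, hence treats both families at once.

    For density the obstacle is that the lines cross: near a crossing several normal components are
    subtracted at once and the corrected gradient may be long. There 1/a gets a crude large value,
    which must not spoil the cost of the segments. Powers of the cosine serve as cut-offs because
    their mean is explicit and small, and a primitive of the power minus its mean is bounded: the
    correctors stay bounded and the crossings cost little on average.

    Derivatives of the admissible curves may be meaningless at breakpoints; the distance is
    therefore replaced early by an infimum over chains of C^1 arcs. *)

Section Euclidean.
Context {R : realType}.
Local Notation plane := 'rV[R]_2.
Implicit Types (x y z v w : plane) (k : 'rV[int]_2).

Lemma dotpE x y : dotp x y = x 0 0 * y 0 0 + x 0 1 * y 0 1.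
Proof.
rewrite /dotp !big_ord_recl big_ord0 addr0.
by have -> : lift ord0 ord0 = 1 :> 'I_2 by apply/val_inj.
Qed.

Lemma ord2_ind (P : 'I_2 -> Prop) : P 0 -> P 1 -> forall i, P i.
Proof.
move=> P0 P1 [[|[|//]] hi]; [have -> : Ordinal hi = 0 by apply/val_inj|
  have -> : Ordinal hi = 1 by apply/val_inj]; by [].
Qed.

Lemma plane_eq x y : x 0 0 = y 0 0 -> x 0 1 = y 0 1 -> x = y.
Proof. by move=> h0 h1; apply/rowP; apply: ord2_ind. Qed.

Lemma dotpC x y : dotp x y = dotp y x.
Proof. by rewrite !dotpE; ring. Qed.

Lemma dotpDl x y z : dotp (x + y) z = dotp x z + dotp y z.
Proof. by rewrite !dotpE !mxE; ring. Qed.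

Lemma dotpDr x y z : dotp z (x + y) = dotp z x + dotp z y.
Proof. by rewrite !(dotpC z) dotpDl. Qed.

Lemma dotpZl (c : R) x y : dotp (c *: x) y = c * dotp x y.
Proof. by rewrite !dotpE !mxE; ring. Qed.

Lemma dotpZr (c : R) x y : dotp x (c *: y) = c * dotp x y.
Proof. by rewrite !(dotpC x) dotpZl. Qed.

Lemma dotpNl x y : dotp (- x) y = - dotp x y.
Proof. by rewrite -scaleN1r dotpZl mulN1r. Qed.

Lemma dotpNr x y : dotp x (- y) = - dotp x y.
Proof. by rewrite !(dotpC x) dotpNl. Qed.

Lemma dotpBr x y z : dotp z (x - y) = dotp z x - dotp z y.
Proof. by rewrite dotpDr dotpNr. Qed.

Lemma dotp0l x : dotp 0 x = 0.
Proof. by rewrite dotpE !mxE !mul0r addr0. Qed.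

Lemma dotp0r x : dotp x 0 = 0.
Proof. by rewrite dotpC dotp0l. Qed.

Lemma dotpp_ge0 x : 0 <= dotp x x.
Proof. by rewrite dotpE addr_ge0// -expr2 sqr_ge0. Qed.

Lemma enorm_ge0 x : 0 <= enorm x.
Proof. exact: sqrtr_ge0. Qed.

Lemma sqr_enorm x : enorm x ^+ 2 = dotp x x.
Proof. by rewrite sqr_sqrtr// dotpp_ge0. Qed.

Lemma enormZ (c : R) x : enorm (c *: x) = `|c| * enorm x.
Proof.
rewrite /enorm dotpZl dotpZr mulrA -expr2 sqrtrM ?sqr_ge0//.
by rewrite sqrtr_sqr.
Qed.

Lemma enormN x : enorm (- x) = enorm x.
Proof. by rewrite -scaleN1r enormZ normrN normr1 mul1r. Qed.

Lemma enormB x y : enorm (x - y) = enorm (y - x).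
Proof. by rewrite -enormN opprB. Qed.

Lemma enorm0 : enorm (0 : plane) = 0.
Proof. by rewrite /enorm dotp0l sqrtr0. Qed.

Lemma enorm0_eq0 x : enorm x = 0 -> x = 0.
Proof.
move=> e0; have : dotp x x = 0 by rewrite -sqr_enorm e0 expr0n.
rewrite dotpE => /eqP; rewrite paddr_eq0 -?expr2 ?sqr_ge0// !sqrf_eq0.
by move=> /andP[/eqP h0 /eqP h1]; apply: plane_eq; rewrite mxE.
Qed.

Lemma enorm_gt0 x : x != 0 -> 0 < enorm x.
Proof.
move=> x0; rewrite lt_neqAle enorm_ge0 andbT eq_sym.
by apply: contra x0 => /eqP/enorm0_eq0 ->.
Qed.

Lemma normr_dotp x y : `|dotp x y| <= enorm x * enorm y.
Proof.
rewrite -(ler_pXn2r (n := 2)) ?nnegrE ?mulr_ge0 ?enorm_ge0//.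
rewrite exprMn !sqr_enorm real_normK ?num_real// !dotpE -subr_ge0.
have -> : (x 0 0 * x 0 0 + x 0 1 * x 0 1) * (y 0 0 * y 0 0 + y 0 1 * y 0 1) -
  (x 0 0 * y 0 0 + x 0 1 * y 0 1) ^+ 2 = (x 0 0 * y 0 1 - x 0 1 * y 0 0) ^+ 2.
  by ring.
exact: sqr_ge0.
Qed.

Lemma dotp_le x y : dotp x y <= enorm x * enorm y.
Proof. exact: le_trans (ler_norm _) (normr_dotp _ _). Qed.

Lemma enormD x y : enorm (x + y) <= enorm x + enorm y.
Proof.
rewrite -(ler_pXn2r (n := 2)) ?nnegrE ?addr_ge0 ?enorm_ge0//.
rewrite sqrrD !sqr_enorm dotpDl !dotpDr (dotpC y x).
have := dotp_le x y; lra.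
Qed.

Lemma enorm_triangle z x y : enorm (x - y) <= enorm (x - z) + enorm (z - y).
Proof. by rewrite -[x - y](_ : (x - z) + (z - y) = _) ?enormD// addrA subrK. Qed.

Lemma coord_le_enorm x i : `|x 0 i| <= enorm x.
Proof.
rewrite -(ler_pXn2r (n := 2)) ?nnegrE ?enorm_ge0// sqr_enorm real_normK ?num_real//.
rewrite dotpE; move: i; apply: ord2_ind; rewrite expr2;
  [have := sqr_ge0 (x 0 1) | have := sqr_ge0 (x 0 0)]; rewrite expr2; lra.
Qed.

Lemma enorm_le_coord x : enorm x <= `|x 0 0| + `|x 0 1|.
Proof.
rewrite -(ler_pXn2r (n := 2)) ?nnegrE ?enorm_ge0 ?addr_ge0// sqr_enorm dotpE.
rewrite sqrrD !real_normK ?num_real// -!expr2.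
have : 0 <= `|x 0 0| * `|x 0 1| by rewrite mulr_ge0.
lra.
Qed.

Lemma coord_le_norm x i : `|x 0 i| <= `|x|.
Proof.
rewrite [leRHS]/Num.Def.normr/= mx_normrE.
exact: le_trans (le_bigmax _ _ (ord0, i)).
Qed.

Lemma norm_le_coord x (c : R) : `|x 0 0| <= c -> `|x 0 1| <= c -> `|x| <= c.
Proof.
move=> h0 h1; have c0 : 0 <= c by rewrite (le_trans _ h0).
rewrite /Num.Def.normr/= mx_normrE bigmax_le// => -[i j] _ /=.
by rewrite (ord1 i); move: j; apply: ord2_ind.
Qed.

Lemma enorm_le_norm x : enorm x <= 2 * `|x|.
Proof.
apply: le_trans (enorm_le_coord x) _.
by have := coord_le_norm x 0; have := coord_le_norm x 1; lra.
Qed.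

Lemma norm_le_enorm x : `|x| <= enorm x.
Proof. by apply: norm_le_coord; exact: coord_le_enorm. Qed.

Lemma ler_dist_enorm x y : `|enorm x - enorm y| <= enorm (x - y).
Proof.
rewrite ler_norml; apply/andP; split.
  have := enormD (y - x) x; rewrite subrK enormB; lra.
by have := enormD (x - y) y; rewrite subrK; lra.
Qed.

Lemma near_enorm x (P : plane -> Prop) :
  (\forall y \near x, P y) <-> exists2 d, 0 < d & forall y, enorm (y - x) < d -> P y.
Proof.
split.
  move/nbhs_ballP => [d /= d0 dP]; exists d => // y yx; apply: dP.
  rewrite -ball_normE /ball_ /= distrC.
  exact: le_lt_trans (norm_le_enorm _) yx.
move=> [d d0 dP]; apply/nbhs_ballP; exists (d / 2); first by rewrite /= divr_gt0.
move=> y; rewrite -ball_normE /ball_ /= distrC => yx; apply: dP.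
by have := enorm_le_norm (y - x); lra.
Qed.

Lemma continuous_enormP (f : plane -> R) x : {for x, continuous f} <->
  forall e : R, 0 < e -> exists2 d, 0 < d &
    forall y, enorm (y - x) < d -> `|f y - f x| < e.
Proof.
have FF : Filter (nbhs x) by exact: nbhs_filter.
split=> [fx e e0|h].
  apply/near_enorm.
  have := (@cvgrPdist_lt R R _ (nbhs x) FF f (f x)).1 fx _ e0.
  by apply: filterS => y; rewrite distrC.
apply/(@cvgrPdist_lt R R _ (nbhs x) FF f (f x)) => e e0.
have /near_enorm := h e e0.
by apply: filterS => y; rewrite distrC.
Qed.

Lemma lipschitz_continuous (f : plane -> R) (c : R) :
  (forall x y, `|f x - f y| <= c * enorm (x - y)) -> continuous f.
Proof.
move=> fc x; apply/continuous_enormP => e e0; exists (e / (`|c| + 1)).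
  by rewrite divr_gt0// ltr_wpDl.
move=> y; rewrite ltr_pdivlMr ?ltr_wpDl// => yx; apply: le_lt_trans (fc y x) _.
have := enorm_ge0 (y - x); have := ler_norm c; nra.
Qed.

Lemma continuous_enorm : continuous (@enorm R).
Proof.
by apply: (@lipschitz_continuous _ 1) => x y; rewrite mul1r ler_dist_enorm.
Qed.

Lemma continuous_dotp p : continuous (@dotp R p).
Proof.
apply: (@lipschitz_continuous _ (enorm p)) => x y.
by rewrite -dotpBr normr_dotp.
Qed.

End Euclidean.

(** * Calculus in the plane *)

Section Calculus.
Context {R : realType}.
Local Notation plane := 'rV[R]_2.
Implicit Types (x y z v w : plane).

(** Multiplying the difference quotient by h removes the exception h = 0, so that chain rules become
    plain estimates. *)
Lemma is_derive_epsP (f : R -> R) (t l : R) : is_derive t 1 f l <->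
  forall e : R, 0 < e -> exists2 d, 0 < d &
    forall h, `|h| < d -> `|f (t + h) - f t - l * h| <= e * `|h|.
Proof.
split=> [[df dl] e e0|H].
  have /cvgrPdist_le/(_ e e0) : (h^-1 *: ((f \o shift t) (h *: 1) - f t)) @[h --> 0^'] --> l.
    by rewrite -dl.
  move/nbhs_ballP => [d /= d0 dP]; exists d => // h hd.
  have [->|h0] := eqVneq h 0; first by rewrite addr0 subrr mulr0 subrr normr0 mulr0.
  have /(_ _ h0) := dP h; rewrite -ball_normE /ball_ /= sub0r normrN => /(_ hd).
  rewrite /= /GRing.scale /= mulr1 (addrC h) => le.
  have hp : 0 < `|h| by rewrite normr_gt0.
  rewrite -(ler_pM2r hp) -normrM in le; apply: le_trans le.
  rewrite mulrBl -mulrA (mulrCA _ _ h) mulVf// mulr1.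
  by rewrite -[leLHS]normrN opprB.
have lim : (h^-1 *: ((f \o shift t) (h *: 1) - f t)) @[h --> 0^'] --> l.
  apply/cvgrPdist_le => e e0; have [d d0 dP] := H e e0.
  apply/nbhs_ballP; exists d => // h; rewrite -ball_normE /ball_ /= sub0r normrN => hd h0.
  rewrite /GRing.scale /= mulr1 (addrC h).
  have hp : 0 < `|h| by rewrite normr_gt0.
  rewrite -(ler_pM2r hp) -normrM mulrBl -mulrA (mulrCA _ _ h) mulVf// mulr1.
  by rewrite -[leLHS]normrN opprB; apply: dP.
split; first by apply/cvg_ex; exists l.
exact/cvg_lim.
Qed.

Lemma is_derive_line (f : plane -> R) x v (t : R) :
  derivable f (t *: v + x) v ->
  is_derive t 1 (fun s : R => f (s *: v + x)) ('D_v f (t *: v + x)).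
Proof.
move=> df.
have E : (fun h : R => h^-1 *: (((fun s : R => f (s *: v + x)) \o shift t) (h *: 1) - f (t *: v + x)))
   = (fun h : R => h^-1 *: ((f \o shift (t *: v + x)) (h *: v) - f (t *: v + x))).
  apply/funext => h /=; congr (_ *: (f _ - _)).
  rewrite /shift /= scalerDl -addrA; congr (_ *: _ + _).
  exact: mulr1.
by split; rewrite /derivable /derive /= E.
Qed.

Lemma Ck_continuous k (f : plane -> R) : Ck k f -> continuous f.
Proof. by case: k => [|k] [? _]. Qed.

Lemma Ck_partial k (f : plane -> R) i : Ck k.+1 f -> Ck k (partial i f).
Proof. by case=> _ /(_ i)[]. Qed.

Lemma Ck_derivable k (f : plane -> R) i x : Ck k.+1 f -> derivable f x (delta_mx 0 i).
Proof. by case=> _ /(_ i)[]. Qed.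

Lemma Ck_le k l (f : plane -> R) : (k <= l)%N -> Ck l f -> Ck k f.
Proof.
elim: l k f => [|l IH] [|k] f //= kl [fc h]; split=> // i.
by have [hd hk] := h i; split=> //; exact: IH hk.
Qed.

Lemma is_derive_continuous (f df : R -> R) :
  (forall t : R, is_derive t 1 f (df t)) -> continuous f.
Proof.
by move=> h t; apply: differentiable_continuous; apply/derivable1_diffP; have [] := h t.
Qed.

Lemma mean_value (f df : R -> R) (a b : R) :
  (forall t : R, is_derive t 1 f (df t)) ->
  exists2 c, `|c - a| <= `|b - a| & f b - f a = df c * (b - a).
Proof.
move=> h; have cf := is_derive_continuous h.
case: (leP a b) => ab.
  have [c] := MVT_segment ab (fun t _ => h t) (continuous_subspaceT cf).
  rewrite in_itv /= => /andP[ac cb] E; exists c => //.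
  by rewrite !ger0_norm ?subr_ge0// lerB.
have [c] := MVT_segment (ltW ab) (fun t _ => h t) (continuous_subspaceT cf).
rewrite in_itv /= => /andP[ac cb] E; exists c.
  by rewrite (distrC c) (distrC b) !ger0_norm ?subr_ge0 ?lerB// ltW.
by rewrite -opprB E -mulrN opprB.
Qed.

(** The increment is taken along one axis after the other, since [Ck] speaks of partial derivatives
    only. The two intermediate points differ, but both stay in the coordinate box around x that
    reaches y, which is enough for continuity and for uniform bounds. *)
Lemma mean_value_plane (f : plane -> R) x y : Ck 1 f ->
  exists z1 z2, [/\ forall i, `|z1 0 i - x 0 i| <= `|y 0 i - x 0 i|,
    forall i, `|z2 0 i - x 0 i| <= `|y 0 i - x 0 i| &
    f y - f x = partial 0 f z1 * (y 0 0 - x 0 0) + partial 1 f z2 * (y 0 1 - x 0 1)].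
Proof.
move=> Cf; pose e i : plane := delta_mx 0 i.
have D i z (t : R) := is_derive_line (@Ck_derivable 0 f i (t *: e i + z) Cf).
have [c1 c1x E1] := @mean_value (fun t => f (t *: e 0 + x))
  (fun t => 'D_(e 0) f (t *: e 0 + x)) 0 (y 0 0 - x 0 0) (D 0 x).
pose x' := (y 0 0 - x 0 0) *: e 0 + x.
have [c2 c2x E2] := @mean_value (fun t => f (t *: e 1 + x'))
  (fun t => 'D_(e 1) f (t *: e 1 + x')) 0 (y 0 1 - x 0 1) (D 1 x').
have Ey : (y 0 1 - x 0 1) *: e 1 + x' = y.
  by apply: plane_eq; rewrite !mxE /=; ring.
exists (c1 *: e 0 + x), (c2 *: e 1 + x'); rewrite !subr0 in c1x E1 c2x E2.
rewrite scale0r add0r in E1; rewrite scale0r add0r Ey in E2; split.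
- by apply: ord2_ind; rewrite !mxE /= ?mulr1 ?mulr0 ?add0r ?subrr ?normr0 ?addrK.
- apply: ord2_ind; rewrite !mxE /= ?mulr1 ?mulr0 ?add0r ?addr0 ?subrK//.
  by rewrite addrK.
- by rewrite -E1 -E2; ring.
Qed.

Lemma C1_differentiable (f : plane -> R) x : Ck 1 f ->
  forall e : R, 0 < e -> exists2 d, 0 < d & forall y, enorm (y - x) < d ->
    `|f y - f x - dotp (gradient f x) (y - x)| <= e * enorm (y - x).
Proof.
move=> Cf e e0.
have C i : {for x, continuous (partial i f)}.
  by apply: (@Ck_continuous 0); apply: Ck_partial.
have e2 : 0 < e / 2 by rewrite divr_gt0.
have [d0 d00 h0] := (continuous_enormP _ _).1 (C 0) _ e2.
have [d1 d10 h1] := (continuous_enormP _ _).1 (C 1) _ e2.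
exists (Num.min d0 d1); first by rewrite lt_min d00.
move=> y; rewrite lt_min => /andP[y0 y1].
have [z1 [z2 [hz1 hz2 E]]] := mean_value_plane x y Cf.
have hz z : (forall i, `|z 0 i - x 0 i| <= `|y 0 i - x 0 i|) -> enorm (z - x) <= enorm (y - x).
  move=> hz; rewrite -(ler_pXn2r (n := 2)) ?nnegrE ?enorm_ge0// !sqr_enorm !dotpE !mxE.
  by rewrite -!expr2 lerD// -real_normK ?num_real// -[leRHS]real_normK ?num_real//
   ler_pXn2r ?nnegrE.
have k1 := h0 _ (le_lt_trans (hz _ hz1) y0).
have k2 := h1 _ (le_lt_trans (hz _ hz2) y1).
rewrite E dotpE !mxE.
have -> : forall a b c d u v : R, a * u + b * v - (c * u + d * v) = (a - c) * u + (b - d) * v.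
  by move=> *; ring.
apply: le_trans (ler_normD _ _) _; rewrite !normrM.
have n0 := coord_le_enorm (y - x) 0; have n1 := coord_le_enorm (y - x) 1.
rewrite !mxE in n0 n1.
move: (enorm _) (y 0 0 - x 0 0) (y 0 1 - x 0 1) n0 n1 k1 k2 {y0 y1 hz hz1 hz2 E} => N u v n0 n1.
move: (partial 0 f z1 - _) (partial 1 f z2 - _) => r s k1 k2.
have -> : e * N = e / 2 * N + e / 2 * N by rewrite -mulrDl -splitr.
by apply: lerD; apply: ler_pM; rewrite ?normr_ge0// ltW.
Qed.

Lemma curve_coord (eta : R -> plane) t i : derivable eta t 1 ->
  is_derive t 1 (fun s : R => eta s 0 i) (derive1 eta t 0 i).
Proof.
move=> d; have hd := (derivable_mxP eta t 1).1 d ord0 i.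
by split=> //; rewrite derive1E (derive_mx d) !mxE.
Qed.

Lemma curve_differentiable (eta : R -> plane) t : derivable eta t 1 ->
  forall e : R, 0 < e -> exists2 d, 0 < d & forall h, `|h| < d ->
    enorm (eta (t + h) - eta t - h *: derive1 eta t) <= e * `|h|.
Proof.
move=> de e e0; have e2 : 0 < e / 2 by rewrite divr_gt0.
have [d0 d00 h0] := (is_derive_epsP _ _ _).1 (curve_coord 0 de) _ e2.
have [d1 d10 h1] := (is_derive_epsP _ _ _).1 (curve_coord 1 de) _ e2.
exists (Num.min d0 d1); first by rewrite lt_min d00.
move=> h; rewrite lt_min => /andP[hd0 hd1].
have := h0 _ hd0; have := h1 _ hd1; have := enorm_le_coord (eta (t + h) - eta t - h *: derive1 eta t).
rewrite !mxE !(mulrC h); lra.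
Qed.

Lemma curve_derivableP (eta : R -> plane) (deta : plane) (t : R) :
  (forall i, is_derive t 1 (fun s : R => eta s 0 i) (deta 0 i)) ->
  derivable eta t 1 /\ derive1 eta t = deta.
Proof.
move=> h; have d : derivable eta t 1.
  by apply/derivable_mxP => i j; rewrite (ord1 i); have [] := h j.
split=> //; rewrite derive1E (derive_mx d).
by apply/rowP => j; rewrite !mxE; have [_ ->] := h j.
Qed.

Lemma C1_chain (f : plane -> R) (eta : R -> plane) t : Ck 1 f -> derivable eta t 1 ->
  is_derive t 1 (f \o eta) (dotp (gradient f (eta t)) (derive1 eta t)).
Proof.
move=> Cf de; apply/is_derive_epsP => e e0.
set g := gradient f (eta t); set v := derive1 eta t.
pose e1 := e / 2 / (enorm v + 1).
have v1 : 0 < enorm v + 1 by rewrite ltr_wpDl// enorm_ge0.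
have e10 : 0 < e1 by rewrite !divr_gt0.
(* The bound 1 keeps the speed of [eta] near t below [enorm v + 1]; the other bound makes the error
   of the curve cost at most half of e. *)
pose e2 := Num.min 1 (e / 2 / (enorm g + 1)).
have g1 : 0 < enorm g + 1 by rewrite ltr_wpDl// enorm_ge0.
have e20 : 0 < e2 by rewrite lt_min ltr01 !divr_gt0.
have [d1 d10 h1] := C1_differentiable (eta t) Cf e10.
have [d2 d20 h2] := curve_differentiable de e20.
exists (Num.min d2 (d1 / (enorm v + 1))); first by rewrite lt_min d20 divr_gt0.
move=> h; rewrite lt_min ltr_pdivlMr// => /andP[hd2 hd1].
have k2 := h2 _ hd2.
have kw : enorm (eta (t + h) - eta t) <= (enorm v + 1) * `|h|.
  have -> : eta (t + h) - eta t = (eta (t + h) - eta t - h *: v) + h *: v by rewrite subrK.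
  apply: le_trans (enormD _ _) _; rewrite enormZ.
  have : e2 <= 1 by rewrite ge_min lexx.
  have := normr_ge0 h; nra.
have k1 := h1 _ (le_lt_trans kw (le_lt_trans (_ : _ <= `|h| * (enorm v + 1)) hd1)).
rewrite mulrC in k1; have {}k1 := k1 (lexx _).
have -> : (f \o eta) (t + h) - (f \o eta) t - dotp g v * h =
   (f (eta (t + h)) - f (eta t) - dotp g (eta (t + h) - eta t)) +
   dotp g (eta (t + h) - eta t - h *: v).
  by rewrite [dotp g (_ - _ - _)]dotpBr dotpZr /=; ring.
apply: le_trans (ler_normD _ _) _.
have -> : e * `|h| = e / 2 * `|h| + e / 2 * `|h| by field.
apply: lerD.
  apply: le_trans k1 _; apply: le_trans (_ : e1 * ((enorm v + 1) * `|h|) <= _).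
    by rewrite ler_pM2l.
  by rewrite mulrA divfK// lt0r_neq0.
apply: le_trans (normr_dotp _ _) _.
have e2g : e2 * (enorm g + 1) <= e / 2.
  by rewrite -ler_pdivlMr// ge_min lexx orbT.
have := enorm_ge0 g; have := normr_ge0 h; have := enorm_ge0 (eta (t + h) - eta t - h *: v).
nra.
Qed.

End Calculus.

(** * Integrals of continuous functions through primitives *)

Section Integrals.
Context {R : realType}.
Notation mu := (@lebesgue_measure R).
Implicit Types (f g F : R -> R).

Lemma continuous_integrable f (a b : R) : continuous f ->
  mu.-integrable `[a, b] (EFin \o f).
Proof.
move=> cf; apply: continuous_compact_integrable; first exact: segment_compact.
exact: continuous_subspaceT.
Qed.

Lemma Rintegral_FTC f F (a b : R) : a <= b -> continuous f ->
  (forall t : R, a <= t <= b -> is_derive t 1 F (f t)) ->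
  \int[mu]_(t in `[a, b]) f t = F b - F a.
Proof.
move=> ab cf dF; have [aeb|ab'] := eqVneq a b.
  by rewrite -aeb set_itv1 Rintegral_set1 subrr.
have {}ab : a < b by rewrite lt_neqAle ab'.
have cF t : a <= t <= b -> {for t, continuous F}.
  move=> tab; apply: differentiable_continuous; apply/derivable1_diffP.
  by have [] := dF t tab.
rewrite /Rintegral (@continuous_FTC2 _ f F)//.
- exact: continuous_subspaceT.
- split.
  + move=> t; rewrite in_itv /= => /andP[/ltW ta /ltW tb].
    have tab : a <= t <= b by rewrite ta.
    by have [] := dF t tab.
  + by apply: cvg_at_right_filter; apply: cF; rewrite lexx ltW.
  + by apply: cvg_at_left_filter; apply: cF; rewrite lexx ltW.
- move=> t; rewrite in_itv /= => /andP[/ltW ta /ltW tb].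
  have tab : a <= t <= b by rewrite ta.
  by rewrite derive1E; have [_ ->] := dF t tab.
Qed.

(** The lower limit A is taken strictly below the interval of interest, so that the primitive has
    two-sided derivatives at both ends of it. *)
Lemma antiderivative f (A : R) : continuous f ->
  exists F, forall t : R, A < t -> is_derive t 1 F (f t).
Proof.
move=> cf; exists (fun x => \int[mu]_(t in `[A, x]) f t) => t At.
have t1 : t < t + 1 by rewrite ltrDl.
have [d E] := continuous_FTC1_closed t1 (continuous_integrable A _ cf) At (cf t).
by split; [exact: d|rewrite -derive1E E].
Qed.

(** Both sides are increments of the same primitive, which reduces the change of variables to the
    chain rule. *)
Lemma Rintegral_affine f (a b : R) : a <= b -> continuous f ->
  \int[mu]_(t in `[0, 1]) ((b - a) * f (a + (b - a) * t)) = \int[mu]_(t in `[a, b]) f t.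
Proof.
move=> ab cf; have [F dF] := antiderivative (a - 1) cf.
have dF' (t : R) : a <= t <= b -> is_derive t 1 F (f t).
  by move=> /andP[at_ _]; apply: dF; lra.
have -> := Rintegral_FTC ab cf dF'.
have dG (t : R) : 0 <= t <= 1 ->
    is_derive t 1 (fun t : R => F (a + (b - a) * t)) ((b - a) * f (a + (b - a) * t)).
  move=> /andP[t0 t1]; have d1 : is_derive t 1 (fun t : R => a + (b - a) * t) (b - a).
    apply/is_derive_epsP => e e0; exists 1 => // h _.
    have -> : a + (b - a) * (t + h) - (a + (b - a) * t) - (b - a) * h = 0 by ring.
    by rewrite normr0 mulr_ge0// ltW.
  have d2 : is_derive (a + (b - a) * t) 1 F (f (a + (b - a) * t)).
    by apply: dF; nra.
  have := is_derive1_comp (f := F) (g := fun t => a + (b - a) * t) (x := t).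
  by move=> /(_ _ _ d2 d1); rewrite /GRing.scale /= mulrC.
have cG : continuous (fun t : R => (b - a) * f (a + (b - a) * t)).
  move=> t; apply: cvgM; first exact: cvg_cst.
  apply: continuous_comp; last exact: cf.
  by apply: cvgD; [exact: cvg_cst|apply: cvgM; [exact: cvg_cst|exact: cvg_id]].
have -> := Rintegral_FTC ler01 cG dG.
by rewrite mulr1 mulr0 addr0 (addrC a) subrK.
Qed.

Lemma Rintegral_reverse f : continuous f ->
  \int[mu]_(t in `[0, 1]) f (1 - t) = \int[mu]_(t in `[0, 1]) f t.
Proof.
move=> cf; have [F dF] := antiderivative (- 1) cf.
have dF' (t : R) : 0 <= t <= 1 -> is_derive t 1 F (f t).
  by move=> /andP[at_ _]; apply: dF; lra.
have -> := Rintegral_FTC ler01 cf dF'.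
have dG (t : R) : 0 <= t <= 1 -> is_derive t 1 (fun t : R => - F (1 - t)) (f (1 - t)).
  move=> /andP[t0 t1]; have d1 : is_derive t 1 (fun t : R => 1 - t) (- 1 : R).
    apply/is_derive_epsP => e e0; exists 1 => // h _.
    have -> : 1 - (t + h) - (1 - t) - (- 1) * h = 0 by ring.
    by rewrite normr0 mulr_ge0// ltW.
  have d2 : is_derive (1 - t) 1 F (f (1 - t)) by apply: dF; lra.
  have := is_derive1_comp (f := F) (g := fun t => 1 - t) (x := t).
  move=> /(_ _ _ d2 d1) d3; have := is_deriveN d3; rewrite mulrN1 opprK.
  exact.
have cG : continuous (fun t : R => f (1 - t)).
  move=> t; apply: continuous_comp; last exact: cf.
  by apply: cvgB; [exact: cvg_cst|exact: cvg_id].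
have -> := Rintegral_FTC ler01 cG dG.
by rewrite subrr subr0 opprK addrC.
Qed.

Lemma Rintegral_glue f (a b c : R) : a <= b -> b <= c ->
  mu.-integrable `[a, b] (EFin \o f) -> mu.-integrable `[b, c] (EFin \o f) ->
  mu.-integrable `[a, c] (EFin \o f) /\
  \int[mu]_(t in `[a, c]) f t = \int[mu]_(t in `[a, b]) f t + \int[mu]_(t in `[b, c]) f t.
Proof.
move=> ab bc i1 i2.
have E : `[a, c]%classic = `[a, b]%classic `|` `]b, c]%classic.
  by rewrite -(@itv_bndbnd_setU _ _ (BLeft a) (BRight b) (BRight c)) ?bnd_simp.
have D : [disjoint `[a, b]%classic & `]b, c]%classic].
  apply/disj_setPS => t /= []; rewrite !in_itv /= => /andP[_ tb] /andP[bt _].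
  by move: (lt_le_trans bt tb); rewrite ltxx.
have i2' : mu.-integrable `]b, c] (EFin \o f).
  by apply: integrableS i2 => //; exact: subset_itv_oc_cc.
have i3 : mu.-integrable `[a, c] (EFin \o f).
  rewrite E; have /integrableP[m1 l1] := i1; have /integrableP[m2 l2] := i2'.
  apply/integrableP; split; first by apply/measurable_funU.
  rewrite ge0_integral_setU//.
  - exact: lte_add_pinfty.
  - by apply/measurable_funU => //; split; apply: measurableT_comp.
split=> //; rewrite E Rintegral_setU// -?E//.
by congr (_ + _); rewrite Rintegral_itv_obnd_cbnd.
Qed.

End Integrals.

(** * Closure properties of the classes [Ck] *)

Section Smooth.
Context {R : realType}.
Local Notation plane := 'rV[R]_2.
Implicit Types (x y z v w q : plane) (f g : plane -> R).

Lemma is_derive_from_line f x v (l : R) :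
  is_derive (0 : R) 1 (fun s : R => f (s *: v + x)) l -> is_derive x v f l.
Proof.
have E : (fun h : R => h^-1 *: (((fun s : R => f (s *: v + x)) \o shift (0 : R)) (h *: 1)
      - f ((0 : R) *: v + x)))
   = (fun h : R => h^-1 *: ((f \o shift x) (h *: v) - f x)).
  apply/funext => h /=; rewrite /shift /= addr0 scale0r add0r.
  by congr (_ *: (f (_ *: _ + _) - _)); exact: mulr1.
by case; rewrite /derivable /derive /= E.
Qed.

Lemma Ck_ext k f g : f =1 g -> Ck k f -> Ck k g.
Proof. by move=> /funext ->. Qed.

Lemma continuous_add f g : continuous f -> continuous g ->
  continuous (fun x => f x + g x).
Proof.
move=> cf cg x; have FF : Filter (nbhs x) by exact: nbhs_filter.
by have := @cvgD _ R plane (nbhs x) FF f g _ _ (cf x) (cg x).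
Qed.

Lemma continuous_mul f g : continuous f -> continuous g ->
  continuous (fun x => f x * g x).
Proof.
move=> cf cg x; have FF : Filter (nbhs x) by exact: nbhs_filter.
by have := @cvgM _ plane (nbhs x) FF f g _ _ (cf x) (cg x).
Qed.

Lemma continuous_inv f : (forall x, f x != 0) -> continuous f ->
  continuous (fun x => (f x)^-1).
Proof.
move=> f0 cf x; have FF : Filter (nbhs x) by exact: nbhs_filter.
by have := @cvgV _ plane (nbhs x) FF f _ (f0 x) (cf x).
Qed.

Lemma CkS k f (df : 'I_2 -> plane -> R) : continuous f ->
  (forall i x, is_derive x (delta_mx 0 i) f (df i x)) ->
  (forall i, Ck k (df i)) -> Ck k.+1 f.
Proof.
move=> cf hd hk; split=> // i; split; first by move=> x; have [] := hd i x.
by apply: Ck_ext (hk i) => x; have [_] := hd i x.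
Qed.

Lemma Ck_is_derive k f i x : Ck k.+1 f -> is_derive x (delta_mx 0 i) f (partial i f x).
Proof. by move=> Cf; split; [exact: Ck_derivable Cf|]. Qed.

Lemma Ck_cst k (c : R) : Ck k (fun=> c : R).
Proof.
elim: k c => [|k IH] c; first by split => //; exact: cst_continuous.
by apply: (@CkS _ _ (fun _ _ => 0)) => //; exact: cst_continuous.
Qed.

Lemma Ck_add k f g : Ck k f -> Ck k g -> Ck k (fun x => f x + g x).
Proof.
elim: k f g => [|k IH] f g Cf Cg.
  by split=> //; apply: continuous_add; exact: (@Ck_continuous _ 0).
apply: (@CkS _ _ (fun i x => partial i f x + partial i g x)).
- by apply: continuous_add; [exact: (Ck_continuous Cf)|exact: (Ck_continuous Cg)].
- by move=> i x; exact: (is_deriveD (Ck_is_derive i x Cf) (Ck_is_derive i x Cg)).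
- by move=> i; apply: IH; exact: Ck_partial.
Qed.

Lemma Ck_mul k f g : Ck k f -> Ck k g -> Ck k (fun x => f x * g x).
Proof.
elim: k f g => [|k IH] f g Cf Cg.
  by split=> //; apply: continuous_mul; exact: (@Ck_continuous _ 0).
apply: (@CkS _ _ (fun i x => f x * partial i g x + g x * partial i f x)).
- by apply: continuous_mul; [exact: (Ck_continuous Cf)|exact: (Ck_continuous Cg)].
- by move=> i x; exact: (is_deriveM (Ck_is_derive i x Cf) (Ck_is_derive i x Cg)).
- move=> i; apply: Ck_add; apply: IH; try exact: Ck_partial.
    by apply: Ck_le Cf; exact: leqnSn.
  by apply: Ck_le Cg; exact: leqnSn.
Qed.

Lemma Ck_opp k f : Ck k f -> Ck k (fun x => - f x).
Proof.
by move=> Cf; apply: Ck_ext (Ck_mul (Ck_cst k (- 1)) Cf) => x; rewrite mulN1r.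
Qed.

Lemma Ck_sub k f g : Ck k f -> Ck k g -> Ck k (fun x => f x - g x).
Proof. by move=> Cf Cg; apply: Ck_add => //; exact: Ck_opp. Qed.

Lemma Ck_exp k f n : Ck k f -> Ck k (fun x => f x ^+ n).
Proof.
move=> Cf; elim: n => [|n IH]; first exact: Ck_cst.
by apply: Ck_ext (Ck_mul Cf IH) => x; rewrite exprS.
Qed.

Lemma Ck_sum k (I : Type) (r : seq I) (P : pred I) (F : I -> plane -> R) :
  (forall i, Ck k (F i)) -> Ck k (fun x => \sum_(i <- r | P i) F i x).
Proof.
move=> CF; elim: r => [|i r IH].
  by apply: Ck_ext (Ck_cst k 0) => x; rewrite big_nil.
case Pi: (P i); last by apply: Ck_ext IH => x; rewrite big_cons Pi.
by apply: Ck_ext (Ck_add (CF i) IH) => x; rewrite big_cons Pi.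
Qed.

Lemma Ck_prod k (I : Type) (r : seq I) (P : pred I) (F : I -> plane -> R) :
  (forall i, Ck k (F i)) -> Ck k (fun x => \prod_(i <- r | P i) F i x).
Proof.
move=> CF; elim: r => [|i r IH].
  by apply: Ck_ext (Ck_cst k 1) => x; rewrite big_nil.
case Pi: (P i); last by apply: Ck_ext IH => x; rewrite big_cons Pi.
by apply: Ck_ext (Ck_mul (CF i) IH) => x; rewrite big_cons Pi.
Qed.

Lemma Ck_inv k f : (forall x, f x != 0) -> Ck k f -> Ck k (fun x => (f x)^-1).
Proof.
elim: k f => [|k IH] f f0 Cf.
  by split=> //; apply: continuous_inv => //; exact: (Ck_continuous Cf).
apply: (@CkS _ _ (fun i x => - ((f x)^-1 * (f x)^-1) * partial i f x)).
- by apply: continuous_inv => //; exact: (Ck_continuous Cf).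
- move=> i x; have d := @Ck_derivable _ k f i x Cf; split; first exact: derivableV.
  by rewrite deriveV// -exprVn expr2.
- have Cf' := Ck_le (leqnSn k) Cf; have CV := IH _ f0 Cf'.
  move=> i; apply: Ck_mul; last exact: Ck_partial.
  by apply: Ck_opp; apply: Ck_mul.
Qed.

Lemma is_derive_dotp q x v : is_derive x v (dotp q) (dotp q v).
Proof.
apply: is_derive_from_line; apply/is_derive_epsP => e e0; exists 1 => // h _.
rewrite !dotpDr !dotpZr.
have -> : (0 + h) * dotp q v + dotp q x - (0 * dotp q v + dotp q x) - dotp q v * h = 0 by ring.
by rewrite normr0 mulr_ge0// ltW.
Qed.

Lemma dotp_delta q (i : 'I_2) : dotp q (delta_mx 0 i) = q 0 i.
Proof.
by rewrite dotpE !mxE /=; move: i; apply: ord2_ind; rewrite /= ?mulr1 ?mulr0 ?addr0 ?add0r.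
Qed.

Lemma Ck_dotp k q : Ck k (dotp q).
Proof.
case: k => [|k]; first by split => //; exact: continuous_dotp.
apply: (@CkS _ _ (fun i _ => q 0 i)); first exact: continuous_dotp.
  by move=> i x; rewrite -dotp_delta; exact: is_derive_dotp.
by move=> i; exact: Ck_cst.
Qed.

Lemma gradient_derive f x (g : plane) :
  (forall i, is_derive x (delta_mx 0 i) f (g 0 i)) -> gradient f x = g.
Proof. by move=> h; apply/rowP => i; rewrite mxE; have [_ <-] := h i. Qed.

Lemma gradient_dotp q x : gradient (dotp q) x = q.
Proof.
by apply: gradient_derive => i; rewrite -dotp_delta; exact: is_derive_dotp.
Qed.

Lemma gradientD f g x : Ck 1 f -> Ck 1 g ->
  gradient (fun x => f x + g x) x = gradient f x + gradient g x.
Proof.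
move=> Cf Cg; apply: gradient_derive => i; rewrite !mxE.
exact: (is_deriveD (Ck_is_derive i x Cf) (Ck_is_derive i x Cg)).
Qed.

Lemma is_derive_dotp_comp (F : R -> R) q (dF : R) x v :
  is_derive (dotp q x : R) 1 F dF -> is_derive x v (fun x => F (dotp q x)) (dotp q v * dF).
Proof.
move=> hF; apply: is_derive_from_line.
have hl : is_derive (0 : R) 1 (fun s : R => dotp q (s *: v + x)) (dotp q v).
  apply/is_derive_epsP => e e0; exists 1 => // h _.
  rewrite !dotpDr !dotpZr.
  have -> : (0 + h) * dotp q v + dotp q x - (0 * dotp q v + dotp q x) - dotp q v * h = 0 by ring.
  by rewrite normr0 mulr_ge0// ltW.
have := @is_derive1_comp R F (fun s : R => dotp q (s *: v + x)) 0 dF (dotp q v).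
by rewrite scale0r add0r mulrC; exact.
Qed.

(** Both are treated in one induction because each is, up to a factor, the partial derivative of the
    other. *)
Lemma Ck_sin_cos k q : Ck k (fun x => sin (dotp q x)) /\ Ck k (fun x => cos (dotp q x)).
Proof.
have cs : continuous (fun x => sin (dotp q x)).
  by move=> x; apply: continuous_comp; [exact: continuous_dotp|exact: continuous_sin].
have cc : continuous (fun x => cos (dotp q x)).
  by move=> x; apply: continuous_comp; [exact: continuous_dotp|exact: continuous_cos].
elim: k => [|k [IHs IHc]]; first by split; split.
split.
  apply: (@CkS _ _ (fun i x => q 0 i * cos (dotp q x))) => //.
    by move=> i x; rewrite -dotp_delta; exact: (is_derive_dotp_comp _ (is_derive_sin _)).
  by move=> i; apply: Ck_mul => //; exact: Ck_cst.
apply: (@CkS _ _ (fun i x => q 0 i * - sin (dotp q x))) => //.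
  by move=> i x; rewrite -dotp_delta; exact: (is_derive_dotp_comp _ (is_derive_cos _)).
by move=> i; apply: Ck_mul; [exact: Ck_cst|exact: Ck_opp].
Qed.

End Smooth.

(** * Paths and the distance *)

Section Paths.
Context {R : realType}.
Local Notation plane := 'rV[R]_2.
Notation mu := (@lebesgue_measure R).
Implicit Types (a : plane -> R) (x y z v w q : plane) (B : set plane).

Definition speed a (eta : R -> plane) (t : R) : R := enorm (derive1 eta t) / a (eta t).

Definition arc_cost a (eta : R -> plane) : R := \int[mu]_(t in `[0, 1]) speed a eta t.

(* [path a B x y c]: a chain of C^1 arcs from x to y inside B, of total
   weighted length c. *)
Inductive path a B : plane -> plane -> R -> Prop :=
| path_nil x : path a B x x 0
| path_cons eta x z y c : C1_curve eta ->
    (forall t, 0 <= t <= 1 -> B (eta t)) -> eta 0 = x -> eta 1 = z ->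
    path a B z y c -> path a B x y (arc_cost a eta + c).

Lemma path_trans a B x y z c d : path a B x y c -> path a B y z d -> path a B x z (c + d).
Proof.
move=> p; elim: p z d => {x y c} [x|eta x w y c Ce Be e0 e1 p IH] z d pz; first by rewrite add0r.
by rewrite -addrA; apply: path_cons e0 e1 (IH _ _ pz).
Qed.

Lemma path_arc a B eta : C1_curve eta -> (forall t, 0 <= t <= 1 -> B (eta t)) ->
  path a B (eta 0) (eta 1) (arc_cost a eta).
Proof.
by move=> Ce Be; rewrite -[arc_cost _ _]addr0; apply: path_cons Ce Be _ _ (path_nil _ _ _).
Qed.

Lemma path_mono a B B' x y c : B `<=` B' -> path a B x y c -> path a B' x y c.
Proof.
move=> BB; elim=> {x y c} [x|eta x z y c Ce Be e0 e1 _ IH]; first exact: path_nil.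
by apply: path_cons IH => // t /Be /BB.
Qed.

Lemma C1_curve_continuous (eta : R -> plane) i : C1_curve eta -> continuous (fun t => eta t 0 i).
Proof.
move=> [de _] t; apply: differentiable_continuous; apply/derivable1_diffP.
by have [] := curve_coord i (de t).
Qed.

Lemma continuous_curve (eta : R -> plane) :
  (forall i, continuous (fun t => eta t 0 i)) -> continuous eta.
Proof.
move=> ce t; have FF : Filter (nbhs t) by exact: nbhs_filter.
apply/(@cvgrPdist_le R _ _ (nbhs t) FF eta (eta t)) => e e0.
have h i := (@cvgrPdist_le R R _ (nbhs t) FF _ _).1 (ce i t) e e0.
apply: (@filterS _ (nbhs t) FF _ _ _ (@filterI _ (nbhs t) FF _ _ (h 0) (h 1))) => s [h0 h1].
by apply: norm_le_coord; rewrite !mxE.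
Qed.

Lemma C1_curve_cts (eta : R -> plane) : C1_curve eta -> continuous eta.
Proof. by move=> Ce; apply: continuous_curve => i; exact: C1_curve_continuous. Qed.

Lemma C1_curveP (eta deta : R -> plane) :
  (forall (t : R) i, is_derive t 1 (fun s : R => eta s 0 i) (deta t 0 i)) ->
  (forall i, continuous (fun t => deta t 0 i)) ->
  C1_curve eta /\ derive1 eta = deta.
Proof.
move=> de cd; have E : derive1 eta = deta.
  by apply/funext => t; have [] := curve_derivableP (de t).
split=> //; split; first by move=> t; have [] := curve_derivableP (de t).
by rewrite E; exact: continuous_curve.
Qed.

Lemma is_derive_affine (al be t : R) : is_derive t 1 (fun s : R => al + be * s) be.
Proof.
apply/is_derive_epsP => e e0; exists 1 => // h _.
have -> : al + be * (t + h) - (al + be * t) - be * h = 0 by ring.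
by rewrite normr0 mulr_ge0// ltW.
Qed.

Lemma continuous_affine (al be : R) : continuous (fun s : R => al + be * s).
Proof. by apply: is_derive_continuous => t; exact: is_derive_affine. Qed.

Lemma C1_curve_affine (eta : R -> plane) (al be : R) : C1_curve eta ->
  C1_curve (fun s => eta (al + be * s)) /\
  derive1 (fun s => eta (al + be * s)) = (fun s => be *: derive1 eta (al + be * s)).
Proof.
move=> Ce; have [de ce] := Ce; apply: C1_curveP => [t i|i].
  have := @is_derive1_comp R (fun s => eta s 0 i) (fun s => al + be * s) t _ _
    (curve_coord i (de (al + be * t))) (is_derive_affine al be t).
  by rewrite mxE mulrC.
have E : (fun t => (be *: derive1 eta (al + be * t)) 0 i) =
   (fun t => be * derive1 eta (al + be * t) 0 i) by apply/funext => t; rewrite mxE.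
rewrite E => t; apply: cvgM; first exact: cvg_cst.
apply: (continuous_comp (f := fun s => al + be * s) (g := fun s => derive1 eta s 0 i)).
  exact: continuous_affine.
apply: (continuous_comp (f := derive1 eta) (g := fun y : plane => y 0 i)); first exact: ce.
exact: coord_continuous.
Qed.

Section positive_coefficient.
Variable a : plane -> R.
Hypotheses (ca : continuous a) (a0 : forall x, 0 < a x).

Lemma continuous_speed eta : C1_curve eta -> continuous (speed a eta).
Proof.
move=> Ce t; have [_ ce] := Ce; apply: cvgM.
  apply: (continuous_comp (f := derive1 eta) (g := @enorm R)); first exact: ce.
  exact: continuous_enorm.
apply: cvgV; first by rewrite gt_eqF.
by apply: (continuous_comp (f := eta) (g := a)); [exact: C1_curve_cts|exact: ca].
Qed.

Lemma arc_cost_affine eta (al be : R) : al <= be -> C1_curve eta ->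
  arc_cost a (fun s => eta (al + (be - al) * s)) = \int[mu]_(t in `[al, be]) speed a eta t.
Proof.
move=> ab Ce; rewrite -(Rintegral_affine ab (continuous_speed Ce)).
apply: eq_Rintegral => t _; rewrite /speed; have [_ ->] := C1_curve_affine al (be - al) Ce.
by rewrite enormZ ger0_norm ?subr_ge0// mulrA.
Qed.

Lemma path_subarc B eta (al be : R) : al <= be -> C1_curve eta ->
  (forall t, al <= t <= be -> B (eta t)) ->
  path a B (eta al) (eta be) (\int[mu]_(t in `[al, be]) speed a eta t).
Proof.
move=> ab Ce Be; rewrite -arc_cost_affine//.
have [C' _] := C1_curve_affine al (be - al) Ce.
have := path_arc a (B := B) C'; rewrite mulr0 addr0 mulr1 (addrC al) subrK; apply.
by move=> t /andP[t0 t1]; apply: Be; nra.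
Qed.

Lemma path_sym B x y c : path a B x y c -> path a B y x c.
Proof.
elim=> {x y c} [x|eta x z y c Ce Be e0 e1 _ IH]; first exact: path_nil.
rewrite addrC; apply: path_trans IH _.
have [C' E'] := C1_curve_affine 1 (-1) Ce.
have -> : arc_cost a eta = arc_cost a (fun s => eta (1 + (-1) * s)).
  rewrite /arc_cost -(Rintegral_reverse (continuous_speed Ce)).
  apply: eq_Rintegral => t _; rewrite /speed E' enormZ normrN normr1 mul1r.
  by rewrite mulN1r.
have := path_arc a (B := B) C'.
rewrite mulr0 addr0 mulr1 subrr e0 e1; apply.
by move=> t t01; apply: Be; lra.
Qed.

Lemma path_shift x y c w : (forall z, a (z + w) = a z) ->
  path a setT x y c -> path a setT (x + w) (y + w) c.
Proof.
move=> aw; elim=> {x y c} [x|eta x z y c Ce Be e0 e1 _ IH]; first exact: path_nil.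
have [C' E'] : C1_curve (fun t => eta t + w) /\ derive1 (fun t => eta t + w) = derive1 eta.
  apply: C1_curveP => [t i|i]; last first.
    move=> t; apply: (continuous_comp (f := derive1 eta) (g := fun y : plane => y 0 i)).
      by have [_ ce] := Ce; exact: ce.
    exact: coord_continuous.
  have E : (fun s => (eta s + w) 0 i) = (fun s => eta s 0 i + w 0 i).
    by apply/funext => s; rewrite mxE.
  rewrite E; have [de _] := Ce.
  have := is_deriveD (curve_coord i (de t)) (is_derive_cst (w 0 i) t 1).
  by rewrite addr0.
have -> : arc_cost a eta = arc_cost a (fun t => eta t + w).
  by apply: eq_Rintegral => t _; rewrite /speed E' aw.
by apply: path_cons IH => //; [rewrite e0|rewrite e1].
Qed.

(** Calibration: by Cauchy-Schwarz the derivative of f along the curve never exceeds the speed. The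
    lower bounds for the distance all rest on this. *)
Lemma arc_cost_ge (B : set plane) (f : plane -> R) eta : Ck 1 f -> C1_curve eta ->
  (forall t, 0 <= t <= 1 -> B (eta t)) ->
  (forall x, B x -> a x * enorm (gradient f x) <= 1) ->
  f (eta 1) - f (eta 0) <= arc_cost a eta.
Proof.
move=> Cf Ce Be hf; have cs := continuous_speed Ce; have [de _] := Ce.
have [F dF] := antiderivative (- 1) cs.
have dF' (t : R) : 0 <= t <= 1 -> is_derive t 1 F (speed a eta t).
  by move=> /andP[t0 _]; apply: dF; lra.
rewrite /arc_cost (Rintegral_FTC ler01 cs dF').
have dG (t : R) : 0 <= t <= 1 -> is_derive t 1 (fun t : R => F t - f (eta t))
    (speed a eta t - dotp (gradient f (eta t)) (derive1 eta t)).
  by move=> t01; exact: (is_deriveB (dF' t t01) (C1_chain Cf (de t))).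
have [||c c01] := @MVT_segment R (fun t : R => F t - f (eta t))
  (fun t => speed a eta t - dotp (gradient f (eta t)) (derive1 eta t)) 0 1 ler01.
- by move=> t; rewrite in_itv /= => /andP[/ltW t0 /ltW t1]; apply: dG; rewrite t0.
- apply: continuous_in_subspaceT => t; rewrite inE /= in_itv /= => t01.
  by apply: differentiable_continuous; apply/derivable1_diffP; have [] := dG t t01.
rewrite in_itv /= in c01; rewrite subr0 mulr1 => E.
have : 0 <= speed a eta c - dotp (gradient f (eta c)) (derive1 eta c); last by lra.
rewrite subr_ge0; apply: le_trans (dotp_le _ _) _.
rewrite ler_pdivlMr//; have := hf _ (Be _ c01).
have := enorm_ge0 (derive1 eta c); nra.
Qed.

Lemma path_ge (B : set plane) (f : plane -> R) x y c : Ck 1 f ->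
  (forall x, B x -> a x * enorm (gradient f x) <= 1) ->
  path a B x y c -> f y - f x <= c.
Proof.
move=> Cf hf; elim=> {x y c} [x|eta x z y c Ce Be e0 e1 _ IH]; first by rewrite subrr.
have := arc_cost_ge Cf Ce Be hf; rewrite e0 e1; lra.
Qed.

(** Calibration by the linear function of slope 1/A in the direction [y - x]. *)
Lemma path_ge_dist (B : set plane) x y c (A : R) : 0 < A ->
  (forall x, B x -> a x <= A) -> path a B x y c -> enorm (y - x) / A <= c.
Proof.
move=> A0 hA p; have [->|yx] := eqVneq y x.
  have := @path_ge B (dotp 0) x y c (Ck_dotp 1 0) _ p; rewrite !dotp0l !subrr enorm0 mul0r; apply.
  by move=> z _; rewrite gradient_dotp enorm0 mulr0.
have n0 : 0 < enorm (y - x) by rewrite enorm_gt0// subr_eq0.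
pose q := (enorm (y - x) * A)^-1 *: (y - x).
have nq : enorm q = A^-1.
  rewrite /q enormZ normrV ?unitfE ?mulf_neq0 ?gt_eqF// normrM !gtr0_norm//.
  by rewrite invfM mulrC mulrA divff ?gt_eqF// mul1r.
have := @path_ge B (dotp q) x y c (Ck_dotp 1 q) _ p.
have -> : dotp q y - dotp q x = enorm (y - x) / A.
  rewrite -dotpBr /q dotpZl -sqr_enorm invfM expr2 mulrAC mulrA mulVf ?gt_eqF//.
  by rewrite mul1r.
by apply => z Bz; rewrite gradient_dotp nq ler_pdivrMr// mul1r hA.
Qed.

(** A constant majorant g of 1/a suffices for crude bounds; the density part needs an oscillating
    one whose primitive is explicit. *)
Lemma path_segment_primitive x y (g G : R -> R) : continuous g ->
  (forall t : R, is_derive t 1 G (g t)) ->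
  (forall t, 0 <= t <= 1 -> (a (x + t *: (y - x)))^-1 <= g t) ->
  exists2 c, path a setT x y c & c <= enorm (y - x) * (G 1 - G 0).
Proof.
move=> cg dG hg; pose eta (t : R) := x + t *: (y - x).
have [Ce E] : C1_curve eta /\ derive1 eta = (fun _ => y - x).
  apply: C1_curveP => [t i|i]; last exact: cst_continuous.
  have -> : (fun s => eta s 0 i) = (fun s => x 0 i + (y - x) 0 i * s).
    by apply/funext => s; rewrite /eta !mxE [X in _ + X]mulrC.
  exact: is_derive_affine.
exists (arc_cost a eta).
  have := path_arc a (B := setT) Ce (fun _ _ => I).
  by rewrite /eta scale0r addr0 scale1r (addrC x) subrK.
have cEg : continuous (fun t => enorm (y - x) * g t).
  by move=> t; apply: cvgM; [exact: cvg_cst|exact: cg].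
have -> : enorm (y - x) * (G 1 - G 0) = \int[mu]_(t in `[0, 1]) (enorm (y - x) * g t).
  have dF (t : R) : 0 <= t <= 1 -> is_derive t 1 (enorm (y - x) \*: G) (enorm (y - x) * g t).
    by move=> _; exact: (is_deriveZ (enorm (y - x)) (dG t)).
  by rewrite (Rintegral_FTC ler01 cEg dF) mulrBr.
apply: le_Rintegral => //.
- by apply: continuous_integrable; exact: continuous_speed.
- exact: continuous_integrable.
- move=> t /=; rewrite in_itv /= => t01; rewrite /speed E.
  by apply: ler_wpM2l; [exact: enorm_ge0|exact: hg].
Qed.

Lemma path_segment x y (m : R) :
  (forall t, 0 <= t <= 1 -> (a (x + t *: (y - x)))^-1 <= m) ->
  exists2 c, path a setT x y c & c <= enorm (y - x) * m.
Proof.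
have h (t : R) := is_derive_affine 0 m t.
by move=> /(path_segment_primitive (@cst_continuous _ _ m) h); rewrite !add0r mulr1 mulr0 subr0.
Qed.

Lemma first_exit (f : R -> R) (r : R) : continuous f -> f 0 < r ->
  (exists2 t, 0 <= t <= 1 & r <= f t) ->
  exists s, [/\ 0 <= s <= 1, f s = r & forall t, 0 <= t <= s -> f t <= r].
Proof.
move=> cf f0 [t1 /andP[t10 t11] ft1].
pose S := [set t | 0 <= t <= 1 /\ r <= f t].
have S1 : S t1 by split; rewrite ?t10.
have lbS : lbound S 0 by move=> t [/andP[]].
have hS : has_inf S by split; [exists t1|exists 0].
pose s := inf S.
have s0 : 0 <= s by apply: lb_le_inf => //; exists t1.
have st1 : s <= t1 by apply: ge_inf => //; exists 0.
have lt_s t : 0 <= t < s -> f t < r.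
  move=> /andP[t0 ts]; rewrite ltNge; apply/negP => rt.
  have : s <= t by apply: ge_inf; [exists 0|split=> //; rewrite t0 /=; lra].
  by rewrite leNgt ts.
have fs_ge : r <= f s.
  rewrite leNgt; apply/negP => fsr.
  have e0 : 0 < r - f s by rewrite subr_gt0.
  have := (@cvgrPdist_lt R R _ (nbhs s) (nbhs_filter s) f (f s)).1 (cf s) _ e0.
  move=> /nbhs_ballP[d /= d0 dP].
  have [u [u01 ru] us] := inf_adherent d0 hS.
  have su : s <= u by apply: ge_inf; [exists 0|split].
  have : ball s d u.
    by rewrite -ball_normE /ball_ /= distrC ger0_norm ?subr_ge0//; rewrite -/s in us; lra.
  by move=> /dP /=; rewrite ltr_norml => /andP[+ _]; lra.
have fs_le : f s <= r.
  rewrite leNgt; apply/negP => fsr.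
  have e0 : 0 < f s - r by rewrite subr_gt0.
  have := (@cvgrPdist_lt R R _ (nbhs s) (nbhs_filter s) f (f s)).1 (cf s) _ e0.
  move=> /nbhs_ballP[d /= d0 dP].
  have s0' : 0 < s.
    rewrite lt_neqAle s0 andbT; apply/eqP => s0'.
    by move: fsr; rewrite -s0' ltNge (ltW f0).
  pose u := Num.max 0 (s - d / 2).
  have us : u < s by rewrite gt_max s0' /=; lra.
  have u0 : 0 <= u by rewrite le_max lexx.
  have ud : s - d / 2 <= u by rewrite le_max lexx orbT.
  have : ball s d u by rewrite -ball_normE /ball_ /= ger0_norm ?subr_ge0 ?ltW//; lra.
  have fu : f u < r by apply: lt_s; rewrite u0.
  by move=> /dP /=; rewrite ltr_norml => /andP[_]; lra.
have fs : f s = r by apply/eqP; rewrite eq_le fs_le fs_ge.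
exists s; split=> //; first by rewrite s0 (le_trans st1).
move=> t /andP[t0]; rewrite le_eqVlt => /predU1P[->|ts]; first by rewrite fs.
by apply: ltW; apply: lt_s; rewrite t0.
Qed.

(** The path is cut at its first hit of the sphere, so that the first piece stays in the closed
    ball, where local bounds on a apply. *)
Lemma path_exit x y w c (r : R) : enorm (y - x) < r -> r <= enorm (w - x) ->
  path a setT y w c ->
  exists z c1 c2, [/\ enorm (z - x) = r,
    path a [set z | enorm (z - x) <= r] y z c1, path a setT z w c2 & c1 + c2 = c].
Proof.
move=> yr wr p; elim: p yr wr => {y w c} [y|eta y z w c Ce _ e0 e1 p IH] yr wr.
  by move: (lt_le_trans yr wr); rewrite ltxx.
pose f t := enorm (eta t - x).
have cf : continuous f.
  move=> t; apply: (continuous_comp (f := eta) (g := fun z => enorm (z - x))).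
    exact: C1_curve_cts.
  apply: (@lipschitz_continuous _ _ 1) => u v; rewrite mul1r.
  by rewrite (le_trans (ler_dist_enorm _ _))// opprB addrA subrK.
have f0 : f 0 < r by rewrite /f e0.
have [ex|nex] := pselect (exists2 t, 0 <= t <= 1 & r <= f t).
  have [s [/andP[s0 s1] fs sr]] := first_exit cf f0 ex.
  have p1 := path_subarc (B := [set z | enorm (z - x) <= r]) s0 Ce sr.
  have p2 := path_subarc (B := setT) s1 Ce (fun _ _ => I).
  rewrite e0 in p1; rewrite e1 in p2.
  exists (eta s), (\int[mu]_(t in `[0, s]) speed a eta t),
    ((\int[mu]_(t in `[s, 1]) speed a eta t) + c); split=> //.
    exact: path_trans p2 p.
  have [_ E] := Rintegral_glue s0 s1 (continuous_integrable _ _ (continuous_speed Ce))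
    (continuous_integrable _ _ (continuous_speed Ce)).
  by rewrite addrA -E.
have hlt t : 0 <= t <= 1 -> f t < r.
  by move=> t01; rewrite ltNge; apply/negP => rt; apply: nex; exists t.
have [|z' [c1 [c2 [hz p1 p2 E]]]] := IH _ wr.
  by rewrite -e1; apply: hlt; rewrite ler01 lexx.
exists z', (arc_cost a eta + c1), c2; split=> //; last by rewrite -addrA E.
by apply: path_cons Ce _ e0 e1 p1 => t /hlt /ltW.
Qed.

End positive_coefficient.
End Paths.

(** * Piecewise C^1 curves and chains of arcs *)

Section PiecewisePaths.
Context {R : realType}.
Local Notation plane := 'rV[R]_2.
Notation mu := (@lebesgue_measure R).
Variable a : plane -> R.
Hypotheses (ca : continuous a) (a0 : forall x, 0 < a x).

(** Leaves f arbitrary at the two end points, where the derivative of a piecewise C^1 curve carries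
    no information. *)
Lemma Rintegral_eq_open (f g : R -> R) (u v : R) : u < v -> continuous g ->
  (forall t, u < t < v -> f t = g t) ->
  mu.-integrable `[u, v] (EFin \o f) /\
  \int[mu]_(t in `[u, v]) f t = \int[mu]_(t in `[u, v]) g t.
Proof.
move=> uv cg fg.
have ig : mu.-integrable `]u, v[ (EFin \o g).
  by apply: integrableS (continuous_integrable u v cg) => //; exact: subset_itv_oo_cc.
have fgo : {in `]u, v[%classic, f =1 g}.
  by move=> t; rewrite inE /= in_itv /=; exact: fg.
have ifo : mu.-integrable `]u, v[ (EFin \o f).
  by apply: eq_integrable ig => // t /fgo /= ->.
have /integrableP[mf lf] := ifo.
have mff := emeasurable_fun_itv_cc mf.
split.
  apply/integrableP; split=> //.
  rewrite (@integral_itv_bndoo R u v (fun t => `|(EFin \o f) t|%E) true false)//.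
  by apply: measurableT_comp => //.
rewrite /Rintegral (@integral_itv_bndoo R u v _ true false)//.
rewrite (@integral_itv_bndoo R u v (fun t => (g t)%:E) true false); last by case/integrableP: ig.
by congr fine; apply: eq_integral => t /fgo ->.
Qed.

Lemma piecewise_length (n : nat) (t : nat -> R) (xi : R -> plane) (eta : nat -> R -> plane) :
  (forall i, (i < n)%N -> t i < t i.+1 /\ C1_curve (eta i) /\
     {in `[t i, t i.+1], xi =1 eta i}) ->
  forall i, (i <= n)%N -> [/\ t 0%N <= t i,
    mu.-integrable `[t 0%N, t i] (EFin \o speed a xi) &
    \int[mu]_(s in `[t 0%N, t i]) speed a xi s =
      \sum_(j < i) \int[mu]_(s in `[t j, t j.+1]) speed a (eta j) s].
Proof.
move=> H; elim=> [|i IH] iln.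
  rewrite set_itv1 big_ord0 Rintegral_set1; split=> //.
  apply/integrableP; split; first exact: measurable_fun_set1.
  by rewrite integral_set1 ltry.
have [t0i ii Ei] := IH (ltnW iln); have [tii [Ci xe]] := H i iln.
have hs s : t i < s < t i.+1 -> speed a xi s = speed a (eta i) s.
  move=> /andP[s1 s2]; have sn : s \in `]t i, t i.+1[ by rewrite in_itv /= s1.
  have xeta : \forall u \near s, xi u = eta i u.
    have := near_in_itvoo sn; apply: filterS => u; rewrite in_itv /= => /andP[u1 u2].
    by apply: xe; rewrite in_itv /= !ltW.
  by rewrite /speed !derive1E (near_eq_derive _ xeta) xe// in_itv /= !ltW.
have [i2 E2] := Rintegral_eq_open tii (continuous_speed ca a0 Ci) hs.
have [i3 E3] := Rintegral_glue t0i (ltW tii) ii i2.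
by split; [exact: le_trans t0i (ltW tii)|exact: i3|rewrite E3 Ei E2 big_ord_recr].
Qed.

Lemma piecewise_path (xi : R -> plane) : piecewise_C1 xi ->
  path a setT (xi 0) (xi 1) (weighted_length a xi).
Proof.
move=> [n [t [t0 tn H]]].
have [eta eP] : {eta : nat -> R -> plane & forall i, (i < n)%N ->
    t i < t i.+1 /\ C1_curve (eta i) /\ {in `[t i, t i.+1], xi =1 eta i}}.
  apply: (@choice nat (R -> plane) (fun i e => (i < n)%N ->
    t i < t i.+1 /\ C1_curve e /\ {in `[t i, t i.+1], xi =1 e})) => i.
  have [iln|] := boolP (i < n)%N; last by exists (fun=> 0).
  by have [ti [e Ce xe]] := H i iln; exists e.
have [_ _ E] := piecewise_length eP (leqnn n).
rewrite /weighted_length -[X in path _ _ X]/(xi 0) -t0 -tn.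
rewrite -/(speed a xi) in E *.
have -> : \int[mu]_(s in `[t 0%N, t n]) (enorm (derive1 xi s) / a (xi s)) =
  \int[mu]_(s in `[t 0%N, t n]) speed a xi s by [].
rewrite E; elim: {-2}n (leqnn n) {E} => [|i IH] iln.
  by rewrite big_ord0; exact: path_nil.
rewrite big_ord_recr /=; apply: path_trans (IH (ltnW iln)) _.
have [tii [Ci xe]] := eP i iln.
rewrite !xe ?in_itv /= ?lexx ?ltW//.
by apply: path_subarc => //; exact: ltW.
Qed.

Lemma path_chain x y c : path a setT x y c ->
  exists n (eta : nat -> R -> plane), [/\ eta 0%N 0 = x, eta n.+1 0 = y,
    (forall i, (i <= n)%N -> C1_curve (eta i) /\ eta i 1 = eta i.+1 0) &
    c = \sum_(i < n.+1) arc_cost a (eta i)].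
Proof.
elim=> {x y c} [x|e x z y c Ce _ e0 e1 _ [n [eta [h0 h1 hC hc]]]].
  (* The empty path becomes one constant arc, so that the number of arcs is never zero and [0, 1]
     can be divided by it. *)
  have [Cx Ex] : C1_curve (fun=> x) /\ derive1 (fun=> x : plane) = (fun _ : R => 0).
    apply: C1_curveP => [t i|i]; last exact: cst_continuous.
    by rewrite mxE; exact: is_derive_cst.
  exists 0%N, (fun _ _ => x); split; [by []|by []|by move=> i _; split|].
  rewrite big_ord1 /arc_cost /speed Ex.
  by rewrite enorm0 mul0r /Rintegral integral0.
exists n.+1, (fun i => if i is j.+1 then eta j else e); split.
- exact: e0.
- exact: h1.
- by case=> [|i] iln; [rewrite e1 h0|exact: hC].
- by rewrite big_ord_recl hc.
Qed.

Lemma path_piecewise x y c : path a setT x y c ->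
  exists xi, [/\ piecewise_C1 xi, xi 0 = x, xi 1 = y & weighted_length a xi = c].
Proof.
move=> /path_chain[n [eta [h0 h1 hC hc]]].
pose N : R := n.+1%:R; have N0 : 0 < N by rewrite ltr0n.
(* The integer part of [N * t] selects the arc, the fractional part the time on it. At t = 1 the
   index is [n.+1], of which only the starting point y is used. *)
pose xi (t : R) := eta (Num.truncn (N * t)) (N * t - (Num.truncn (N * t))%:R).
pose tt (i : nat) : R := i%:R / N.
pose et (i : nat) (t : R) := eta i (- i%:R + N * t).
have xe i : (i < n.+1)%N -> {in `[tt i, tt i.+1], xi =1 et i}.
  move=> iln t; rewrite in_itv /= /tt ler_pdivrMr// ler_pdivlMr// mulrC => /andP[t1].
  rewrite le_eqVlt => /predU1P[t2|t2]; rewrite /xi /et.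
    rewrite t2 natrK subrr; have [_ <-] := hC i iln.
    by congr (eta i _); rewrite -natr1; ring.
  have -> : Num.truncn (N * t) = i by apply: truncn_def; rewrite t1.
  by rewrite addrC.
have Cet i : (i < n.+1)%N -> C1_curve (et i).
  by move=> iln; have [C _] := hC i iln; have [] := C1_curve_affine (- i%:R) N C.
have ttS i : tt i < tt i.+1 by rewrite /tt ltr_pM2r ?invr_gt0// ltr_nat.
have H i : (i < n.+1)%N -> tt i < tt i.+1 /\ C1_curve (et i) /\ {in `[tt i, tt i.+1], xi =1 et i}.
  by move=> iln; split=> //; split; [exact: Cet|exact: xe].
have tt0 : tt 0%N = 0 by rewrite /tt mul0r.
have ttn : tt n.+1 = 1 by rewrite /tt divff ?gt_eqF.
exists xi; split.
- exists n.+1, tt; split=> // i iln; split=> //; exists (et i); [exact: Cet|exact: xe].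
- by rewrite /xi mulr0 truncn0 subr0.
- by rewrite /xi mulr1 natrK subrr.
have [_ _] := piecewise_length H (leqnn _).
rewrite tt0 ttn => E; rewrite /weighted_length -/(speed a xi).
rewrite -[LHS]/(\int[mu]_(s in `[0, 1]) speed a xi s) E hc.
apply: eq_bigr => -[i iln] _ /=.
rewrite -(arc_cost_affine ca a0 (ltW (ttS i)) (Cet i iln)); congr (arc_cost a _).
apply/funext => s; rewrite /et /tt; congr (eta i _).
by rewrite -natr1; field; rewrite gt_eqF.
Qed.

(** From here on distances are handled through [path] alone, which concatenates, reverses and cuts
    without a partition of [0, 1]. *)
Lemma metric_distE x y : metric_dist a x y = inf [set c | path a setT x y c].
Proof.
congr (inf _); apply/seteqP; split=> [c [xi [pxi <- <-] <-]|c /path_piecewise[xi [p x0 x1 <-]]].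
  exact: piecewise_path.
by exists xi.
Qed.

End PiecewisePaths.

(** * The stable norm *)

Section Periodic.
Context {R : realType}.
Local Notation plane := 'rV[R]_2.
Implicit Types (f : plane -> R) (x y z v w p : plane) (k : 'rV[int]_2).

Definition lattice k : plane := map_mx intr k.

Lemma latticeN k : lattice (- k) = - lattice k.
Proof. by apply/rowP => i; rewrite !mxE mulrNz. Qed.

Lemma floor_lattice x : exists k, forall i, 0 <= (x - lattice k) 0 i < 1.
Proof.
exists (\row_i Num.floor (x 0 i)) => i; rewrite !mxE subr_ge0 ltrBlDr.
by rewrite floor_le_tmp addrC -intrD1 floorD1_gt.
Qed.

Lemma enorm_unit_box x : (forall i, 0 <= x 0 i < 1) -> enorm x <= 2.
Proof.
move=> h; apply: le_trans (enorm_le_coord _) _.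
have := h 0; have := h 1 => /andP[p1 q1] /andP[p0 q0].
by rewrite !ger0_norm//; lra.
Qed.

Lemma compact_ball (r : R) : compact [set x : plane | enorm x <= r].
Proof.
apply: bounded_closed_compact.
  exists r; split; first exact: num_real.
  by move=> s rs x /= xr; apply: le_trans (norm_le_enorm _) _; apply: le_trans xr (ltW rs).
have -> : [set x : plane | enorm x <= r] = @enorm R @^-1` [set s | s <= r] by [].
apply: closed_comp; last exact: closed_le.
by move=> x _; exact: continuous_enorm.
Qed.

Lemma periodic_bounded f : continuous f -> periodic f -> exists x0 x1, forall x, f x0 <= f x <= f x1.
Proof.
move=> cf pf; pose B := [set x : plane | enorm x <= 2].
have B0 : B !=set0 by exists 0; rewrite /B /= enorm0.
have cfB : {within B, continuous f} by exact: continuous_subspaceT.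
have [x1 _ h1] := EVT_max_rV B0 (@compact_ball 2) cfB.
have [x0 _ h0] := EVT_min_rV B0 (@compact_ball 2) cfB.
exists x0, x1 => x; have [k hk] := floor_lattice x.
have E : f x = f (x - lattice k) by rewrite -[in LHS](subrK (lattice k) x) pf.
have xB : x - lattice k \in B by rewrite inE; exact: enorm_unit_box.
by rewrite E h0 ?h1.
Qed.

Definition periodic_bounds f (m M : R) :=
  [/\ continuous f, periodic f, 0 < m & forall x, m <= f x <= M].

End Periodic.

Section PeriodicMetric.
Context {R : realType}.
Local Notation plane := 'rV[R]_2.
Implicit Types (x y z v w p : plane) (k : 'rV[int]_2).
Variables (a : plane -> R) (m M : R).
Hypothesis Ha : periodic_bounds a m M.

Let ca : continuous a. Proof. by case: Ha. Qed.
Let pa : periodic a. Proof. by case: Ha. Qed.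
Let m0 : 0 < m. Proof. by case: Ha. Qed.
Let ma x : m <= a x. Proof. by case: Ha => _ _ _ /(_ x)/andP[]. Qed.
Let aM x : a x <= M. Proof. by case: Ha => _ _ _ /(_ x)/andP[]. Qed.
Let a0 x : 0 < a x. Proof. exact: lt_le_trans m0 (ma x). Qed.
Let M0 : 0 < M. Proof. exact: lt_le_trans (a0 0) (aM 0). Qed.
Local Notation D := (metric_dist a).

Lemma path_dist_le x y c : path a setT x y c -> enorm (y - x) / M <= c.
Proof. by apply: path_ge_dist => // z _; exact: aM. Qed.

Lemma metric_dist_has_inf x y : has_inf [set c | path a setT x y c].
Proof.
split.
  have [|c p _] := path_segment ca a0 (x := x) (y := y) (m := m^-1).
    by move=> t _; rewrite lef_pV2 ?posrE.
  by exists c.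
exists 0 => c /path_dist_le; apply: le_trans.
by rewrite divr_ge0 ?enorm_ge0// ltW.
Qed.

Lemma metric_dist_le_path x y c : path a setT x y c -> D x y <= c.
Proof.
by move=> p; rewrite metric_distE//; apply: ge_inf => //; have [] := metric_dist_has_inf x y.
Qed.

Lemma metric_dist_approx x y (e : R) : 0 < e ->
  exists2 c, path a setT x y c & c < D x y + e.
Proof.
move=> e0; have [c p ce] := inf_adherent e0 (metric_dist_has_inf x y).
by exists c => //; rewrite metric_distE.
Qed.

Lemma metric_dist_ge_path x y (r : R) :
  (forall c, path a setT x y c -> r <= c) -> r <= D x y.
Proof.
move=> h; rewrite metric_distE//; apply: lb_le_inf; last exact: h.
by have [] := metric_dist_has_inf x y.
Qed.

Lemma metric_dist_ge x y : enorm (y - x) / M <= D x y.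
Proof. by apply: metric_dist_ge_path => c; exact: path_dist_le. Qed.

Lemma metric_dist_ge0 x y : 0 <= D x y.
Proof. by apply: le_trans (metric_dist_ge x y); rewrite divr_ge0 ?enorm_ge0// ltW. Qed.

Lemma metric_dist_le_segment x y (b : R) :
  (forall t, 0 <= t <= 1 -> (a (x + t *: (y - x)))^-1 <= b) -> D x y <= enorm (y - x) * b.
Proof.
by move=> h; have [c p cb] := path_segment ca a0 h; apply: le_trans (metric_dist_le_path p) cb.
Qed.

Lemma metric_dist_le x y : D x y <= enorm (y - x) / m.
Proof. by apply: metric_dist_le_segment => t _; rewrite lef_pV2 ?posrE. Qed.

Lemma metric_dist_triangle y x z : D x z <= D x y + D y z.
Proof.
apply/ler_addgt0Pr => e e0; have e2 : 0 < e / 2 by rewrite divr_gt0.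
have [c p cl] := metric_dist_approx x y e2.
have [d q dl] := metric_dist_approx y z e2.
have := metric_dist_le_path (path_trans p q); lra.
Qed.

Lemma metric_dist_sym x y : D x y = D y x.
Proof.
rewrite !metric_distE//; congr inf; apply/seteqP; split=> c /=; exact: path_sym.
Qed.

Lemma metric_dist_shift x y k : D (x + lattice k) (y + lattice k) = D x y.
Proof.
rewrite !metric_distE//; congr inf; apply/seteqP; split=> c /=; last first.
  by apply: path_shift => // z; exact: pa.
move=> p; have := path_shift (w := lattice (- k)) _ p.
by rewrite !latticeN !addrK; apply => z; rewrite -latticeN; exact: pa.
Qed.

(** The distance is invariant under lattice translations only. Any other translation is a lattice
    one up to a vector of length at most 2, whose cost 2/m is paid at both ends. *)
Definition translation_defect := 4 / m.
Local Notation C := translation_defect.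

Lemma translation_defect_ge0 : 0 <= C. Proof. by rewrite divr_ge0// ltW. Qed.

Lemma metric_dist_translate x w : D x (x + w) <= D 0 w + C.
Proof.
have [k hk] := floor_lattice x; have xk := enorm_unit_box hk.
have h1 := metric_dist_triangle (lattice k) x (x + w).
have h2 := metric_dist_triangle (lattice k + w) (lattice k) (x + w).
have h3 := metric_dist_le x (lattice k); rewrite enormB in h3.
have h4 := metric_dist_le (lattice k + w) (x + w).
rewrite opprD addrACA subrr addr0 in h4.
have h5 : D (lattice k) (lattice k + w) = D 0 w.
  by rewrite -(metric_dist_shift 0 w k) add0r addrC.
have : enorm (x - lattice k) / m <= 2 / m by rewrite ler_pM2r ?invr_gt0.
rewrite /translation_defect; lra.
Qed.

Lemma metric_dist_translate_rev x w : D 0 w <= D x (x + w) + C.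
Proof.
have [k hk] := floor_lattice x; have xk := enorm_unit_box hk.
have t1 := metric_dist_triangle (x - lattice k) 0 w.
have t2 := metric_dist_triangle (x + w - lattice k) (x - lattice k) w.
have s := metric_dist_shift x (x + w) (- k); rewrite latticeN in s.
have b1 := metric_dist_le 0 (x - lattice k); rewrite subr0 in b1.
have b2 := metric_dist_le (x + w - lattice k) w.
have E : w - (x + w - lattice k) = - (x - lattice k).
  by apply: plane_eq; rewrite !mxE; ring.
rewrite E enormN in b2.
have : enorm (x - lattice k) / m <= 2 / m by rewrite ler_pM2r ?invr_gt0.
rewrite /translation_defect; rewrite s in t2; lra.
Qed.

(** An almost optimal path is cut at the sphere. The cost c of its first part is kept instead of the
    distance from x to z, because the bound by [r / A] uses that this part stays in the ball. *)
Lemma metric_dist_exit x w (r e : R) : 0 < r -> r <= enorm (w - x) -> 0 < e ->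
  exists z c, [/\ enorm (z - x) = r, D x z <= c, c + D z w <= D x w + e &
    forall A, 0 < A -> (forall y, enorm (y - x) <= r -> a y <= A) -> r / A <= c].
Proof.
move=> r0 rw e0; have [c p ce] := metric_dist_approx x w e0.
have xr : enorm (x - x) < r by rewrite subrr enorm0.
have [z [c1 [c2 [zr p1 p2 E]]]] := path_exit ca a0 xr rw p.
exists z, c1; split=> //.
- by apply: metric_dist_le_path; apply: path_mono p1.
- by have := metric_dist_le_path p2; lra.
- by move=> A A0 hA; rewrite -zr; exact: path_ge_dist p1.
Qed.

Lemma metric_dist_multiple (n : nat) v w :
  D 0 (n%:R *: v + w) <= n%:R * (D 0 v + C) + D 0 w.
Proof.
elim: n => [|n IH]; first by rewrite scale0r add0r mul0r add0r.
rewrite -natr1 scalerDl scale1r mulrDl mul1r.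
have h1 := metric_dist_triangle v 0 (n%:R *: v + v + w).
have h2 := metric_dist_translate v (n%:R *: v + w).
have E : v + (n%:R *: v + w) = n%:R *: v + v + w by rewrite addrCA addrA.
rewrite E in h2; lra.
Qed.

(** Fekete's argument: [D 0 (l *: v) + C] is subadditive in l, so its quotient by l tends to its
    infimum s. The last inequality is the instance l = 1. *)
Lemma stable_norm_cvg v :
  exists2 s, stable_norm a v = s & (forall e : R, 0 < e ->
   exists2 L : R, 0 < L & forall l : R, L <= l -> `|D 0 (l *: v) - l * s| <= e * l) /\
   s <= D 0 v + C.
Proof.
pose S := [set r | exists2 l : R, 0 < l & r = (D 0 (l *: v) + C) / l].
have hS : has_inf S.
  split; first by exists ((D 0 (1 *: v) + C) / 1), 1.
  exists 0 => _ [l l0 ->]; rewrite divr_ge0 ?(ltW l0)//.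
  by rewrite addr_ge0 ?metric_dist_ge0 ?translation_defect_ge0.
pose s := inf S.
have s_le l : 0 < l -> l * s <= D 0 (l *: v) + C.
  move=> l0; rewrite mulrC -ler_pdivlMr//; apply: ge_inf; first by have [] := hS.
  by exists l.
have key (e : R) : 0 < e ->
   exists2 L : R, 0 < L & forall l : R, L <= l -> `|D 0 (l *: v) - l * s| <= e * l.
  move=> e0; have e2 : 0 < e / 2 by rewrite divr_gt0.
  have [_ [l0 l00 ->] hl0] := inf_adherent e2 hS; rewrite -/s in hl0.
  pose K := l0 * enorm v / m.
  have K0 : 0 <= K by rewrite divr_ge0 ?mulr_ge0 ?enorm_ge0// ltW.
  have C0 := translation_defect_ge0.
  (* K bounds the cost of the remainder [(l - q * l0) *: v]; beyond this threshold K and C together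
     weigh less than half of [e * l]. *)
  exists ((K + C + 1) / (e / 2)); first by rewrite divr_gt0//; lra.
  move=> l; rewrite ler_pdivrMr// => hl.
  have lp : 0 < l by rewrite -(pmulr_lgt0 _ e2); apply: lt_le_trans hl; lra.
  have l1 := s_le l lp.
  pose q := Num.truncn (l / l0).
  have /andP[q1 q2] : q%:R <= l / l0 < q.+1%:R by apply: truncn_itv; rewrite divr_ge0// ltW.
  rewrite ler_pdivlMr// in q1; rewrite ltr_pdivrMr// -natr1 mulrDl mul1r in q2.
  have h1 := metric_dist_multiple q (l0 *: v) ((l - q%:R * l0) *: v).
  rewrite scalerA -scalerDl addrC subrK in h1.
  have h2 : D 0 ((l - q%:R * l0) *: v) <= K.
    apply: le_trans (metric_dist_le _ _) _.
    rewrite subr0 enormZ ger0_norm; last by lra.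
    by rewrite ler_pM2r ?invr_gt0// ler_wpM2r ?enorm_ge0//; lra.
  have h3 : q%:R * (D 0 (l0 *: v) + C) <= l * (s + e / 2).
    have E0 : 0 <= (D 0 (l0 *: v) + C) / l0.
      by rewrite divr_ge0 ?(ltW l00)// addr_ge0 ?metric_dist_ge0 ?translation_defect_ge0.
    have -> : q%:R * (D 0 (l0 *: v) + C) = (q%:R * l0) * ((D 0 (l0 *: v) + C) / l0).
      by rewrite -mulrA; congr (_ * _); rewrite mulrC divfK// gt_eqF.
    apply: ler_pM => //; last exact: ltW.
    by rewrite mulr_ge0// ltW.
  rewrite ler_norml; apply/andP; split; nra.
exists s; last first.
  split=> //; have := s_le 1 ltr01; by rewrite mul1r scale1r.
apply: cvg_lim => //; apply/cvgrPdist_le => e e0.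
have [L L0 HL] := key e e0.
near=> l.
have Ll : L <= l by near: l; apply: nbhs_pinfty_ge; exact: num_real.
have lp : 0 < l by exact: lt_le_trans L0 Ll.
rewrite -(ler_pM2r lp) -[X in `|_| * X](gtr0_norm lp) -normrM.
by rewrite mulrBl divfK ?gt_eqF// distrC (mulrC s); exact: HL.
Unshelve. all: by end_near. Qed.

Local Notation N := (stable_norm a).

Lemma stable_normP v (e : R) : 0 < e ->
  exists2 L : R, 0 < L & forall l : R, L <= l -> `|D 0 (l *: v) - l * N v| <= e * l.
Proof. by move=> e0; have [s -> [h _]] := stable_norm_cvg v; exact: h. Qed.

Lemma stable_norm_le_dist v : N v <= D 0 v + C.
Proof. by have [s -> []] := stable_norm_cvg v. Qed.

(** An additive error uniform in l disappears after division by l. *)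
Lemma le_stable_norm v (r c : R) :
  (forall l : R, 0 < l -> l * r - c <= D 0 (l *: v)) -> r <= N v.
Proof.
move=> h; apply/ler_addgt0Pr => e e0; have e2 : 0 < e / 2 by rewrite divr_gt0.
have [L L0 HL] := stable_normP v e2.
pose l := Num.max L (`|c| / (e / 2)).
have lL : L <= l by rewrite le_max lexx.
have lp : 0 < l := lt_le_trans L0 lL.
have lc : c <= l * (e / 2).
  rewrite -ler_pdivrMr//; apply: (@le_trans _ _ (`|c| / (e / 2))).
    by rewrite ler_pM2r ?invr_gt0// ler_norm.
  by rewrite le_max lexx orbT.
have := HL l lL; rewrite ler_norml => /andP[_ h1].
by rewrite -(ler_pM2l lp); have := h l lp; lra.
Qed.

Lemma stable_norm_le v (r c : R) :
  (forall l : R, 0 < l -> D 0 (l *: v) <= l * r + c) -> N v <= r.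
Proof.
move=> h; apply/ler_addgt0Pr => e e0; have e2 : 0 < e / 2 by rewrite divr_gt0.
have [L L0 HL] := stable_normP v e2.
pose l := Num.max L (`|c| / (e / 2)).
have lL : L <= l by rewrite le_max lexx.
have lp : 0 < l := lt_le_trans L0 lL.
have lc : c <= l * (e / 2).
  rewrite -ler_pdivrMr//; apply: (@le_trans _ _ (`|c| / (e / 2))).
    by rewrite ler_pM2r ?invr_gt0// ler_norm.
  by rewrite le_max lexx orbT.
have := HL l lL; rewrite ler_norml => /andP[h1 _].
by rewrite -(ler_pM2l lp); have := h l lp; lra.
Qed.

Lemma stable_norm_ge_enorm v : M^-1 * enorm v <= N v.
Proof.
apply: (@le_stable_norm _ _ 0) => l l0; rewrite subr0; apply: le_trans (metric_dist_ge _ _).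
by rewrite subr0 enormZ gtr0_norm// mulrA mulrAC.
Qed.

Lemma stable_norm_le_enorm v : N v <= m^-1 * enorm v.
Proof.
apply: (@stable_norm_le _ _ 0) => l l0; rewrite addr0; apply: le_trans (metric_dist_le _ _) _.
by rewrite subr0 enormZ gtr0_norm// [X in _ <= _ * X]mulrC mulrA.
Qed.

Lemma stable_normD v w : N (v + w) <= N v + N w.
Proof.
apply/ler_addgt0Pr => e e0; have e2 : 0 < e / 2 by rewrite divr_gt0.
have [L1 L10 H1] := stable_normP v e2; have [L2 L20 H2] := stable_normP w e2.
pose K := Num.max L1 L2.
have K1 : L1 <= K by rewrite le_max lexx.
have K2 : L2 <= K by rewrite le_max lexx orbT.
(* For l below K the limits say nothing; the additive constant absorbs the crude bound on that
   range. *)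
apply: (@stable_norm_le _ _ (C + K * enorm (v + w) / m)) => l l0.
have n0 := enorm_ge0 (v + w); have C0 := translation_defect_ge0.
have s0 : 0 <= N v + N w.
  by rewrite addr_ge0//; apply: le_trans (stable_norm_ge_enorm _); rewrite mulr_ge0 ?enorm_ge0// invr_ge0 ltW.
have [lK|Kl] := leP l K.
  apply: le_trans (metric_dist_le _ _) _.
  rewrite subr0 enormZ gtr0_norm//.
  have : l * enorm (v + w) / m <= K * enorm (v + w) / m.
    by rewrite ler_pM2r ?invr_gt0// ler_wpM2r.
  have : 0 <= l * (N v + N w + e) by rewrite mulr_ge0 ?(ltW l0)// addr_ge0// ltW.
  lra.
have K0 : 0 <= K * enorm (v + w) / m.
  by rewrite divr_ge0 ?mulr_ge0// ?(ltW m0)// (le_trans (ltW L10)).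
have := H1 l (le_trans K1 (ltW Kl)); have := H2 l (le_trans K2 (ltW Kl)).
rewrite !ler_norml => /andP[_ h2] /andP[_ h1].
have h3 := metric_dist_triangle (l *: v) 0 (l *: v + l *: w).
have h4 := metric_dist_translate (l *: v) (l *: w).
rewrite scalerDr; lra.
Qed.

Lemma stable_normZ (c : R) v : 0 <= c -> N (c *: v) = c * N v.
Proof.
rewrite le_eqVlt => /predU1P[<-|c0].
  rewrite scale0r mul0r; apply/eqP; rewrite eq_le.
  have := stable_norm_le_enorm 0; have := stable_norm_ge_enorm 0.
  by rewrite enorm0 !mulr0 => -> ->.
have key (e : R) : 0 < e -> `|N (c *: v) - c * N v| <= e * (1 + c).
  move=> e0; have [L1 L10 H1] := stable_normP (c *: v) e0; have [L2 L20 H2] := stable_normP v e0.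
  pose l := Num.max L1 (L2 / c).
  have l1 : L1 <= l by rewrite le_max lexx.
  have l2 : L2 <= l * c by rewrite -ler_pdivrMr// le_max lexx orbT.
  have lp : 0 < l := lt_le_trans L10 l1.
  have := H1 l l1; have := H2 _ l2; rewrite scalerA => h2 h1.
  rewrite -(ler_pM2l lp) -[X in X * `|_|](gtr0_norm lp) -normrM.
  have -> : l * (N (c *: v) - c * N v) = (D 0 ((l * c) *: v) - l * c * N v)
     - (D 0 ((l * c) *: v) - l * N (c *: v)) by ring.
  apply: le_trans (ler_normB _ _) _; lra.
apply/eqP; rewrite -subr_eq0 -normr_eq0 eq_le normr_ge0 andbT.
apply/ler_addgt0Pr => e e0; rewrite add0r.
have c1 : 0 < 1 + c by lra.
have := key (e / (1 + c)); rewrite divfK ?gt_eqF//; apply.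
by rewrite divr_gt0.
Qed.

Lemma stable_normN v : N (- v) = N v.
Proof.
have key w : N (- w) <= N w; last by apply/eqP; rewrite eq_le key -{1}(opprK v) key.
apply/ler_addgt0Pr => e e0.
have [L L0 H] := stable_normP w e0.
apply: (@stable_norm_le _ _ (C + L * enorm w / m)) => l l0.
have C0 := translation_defect_ge0; have n0 := enorm_ge0 w.
have s0 : 0 <= N w.
  by apply: le_trans (stable_norm_ge_enorm _); rewrite mulr_ge0 ?enorm_ge0// invr_ge0 ltW.
have [lK|Kl] := leP l L.
  apply: le_trans (metric_dist_le _ _) _.
  rewrite subr0 enormZ enormN gtr0_norm//.
  have : l * enorm w / m <= L * enorm w / m.
    by rewrite ler_pM2r ?invr_gt0// ler_wpM2r.
  have : 0 <= l * (N w + e) by rewrite mulr_ge0 ?(ltW l0)// addr_ge0// ltW.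
  lra.
have K0 : 0 <= L * enorm w / m by rewrite divr_ge0 ?mulr_ge0// ltW.
have := H l (ltW Kl); rewrite ler_norml => /andP[_ h1].
have := metric_dist_translate (- (l *: w)) (l *: w); rewrite addNr metric_dist_sym.
rewrite scalerN; lra.
Qed.

(** Translating a path by a lattice vector is free, so along multiples of k the distance is
    subadditive without defect. The upper bounds of the density part cannot afford the constant
    C. *)
Lemma stable_norm_lattice k : N (lattice k) <= D 0 (lattice k).
Proof.
have H (n : nat) : D 0 (n%:R *: lattice k) <= n%:R * D 0 (lattice k).
  elim: n => [|n IH].
    have := metric_dist_le 0 0; rewrite scale0r mul0r subrr enorm0 mul0r.
    exact.
  have h := metric_dist_triangle (lattice k) 0 (n.+1%:R *: lattice k).
  have E : D (lattice k) (n.+1%:R *: lattice k) = D 0 (n%:R *: lattice k).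
    rewrite -(metric_dist_shift 0 _ k) add0r; congr metric_dist.
    by rewrite -natr1 scalerDl scale1r.
  rewrite E in h; apply: le_trans h _; rewrite -natr1 mulrDl mul1r; lra.
apply/ler_addgt0Pr => e e0.
have [L L0 HL] := stable_normP (lattice k) e0.
pose n := (Num.truncn L).+1.
have nL : L <= n%:R by apply: ltW; apply: truncnS_gt.
have := HL _ nL; rewrite ler_norml => /andP[h _].
have n0 : 0 < n%:R :> R by rewrite ltr0n.
by rewrite -(ler_pM2l n0); have := H n; lra.
Qed.

End PeriodicMetric.

(** * The effective Hamiltonian *)

Section DualNorm.
Context {R : realType}.
Local Notation plane := 'rV[R]_2.
Implicit Types (x y z v w p : plane) (k : 'rV[int]_2).
Variables (a : plane -> R) (m M : R).
Hypothesis Ha : periodic_bounds a m M.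

Let m0 : 0 < m. Proof. by case: Ha. Qed.
Let ma x : m <= a x. Proof. by case: Ha => _ _ _ /(_ x)/andP[]. Qed.
Let aM x : a x <= M. Proof. by case: Ha => _ _ _ /(_ x)/andP[]. Qed.
Let a0 x : 0 < a x. Proof. exact: lt_le_trans m0 (ma x). Qed.
Let M0 : 0 < M. Proof. exact: lt_le_trans (a0 0) (aM 0). Qed.
Local Notation D := (metric_dist a).
Local Notation N := (stable_norm a).
Local Notation C := (translation_defect m).
Let C0 : 0 <= C. Proof. exact: (translation_defect_ge0 Ha). Qed.
Let N0 v : 0 <= N v.
Proof.
apply: le_trans (stable_norm_ge_enorm Ha v).
by rewrite mulr_ge0 ?enorm_ge0// invr_ge0 ltW.
Qed.

Definition dual_norm (p : plane) : R := sup [set dotp p v | v in [set v | N v <= 1]].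

Lemma dual_norm_has_sup p : has_sup [set dotp p v | v in [set v | N v <= 1]].
Proof.
split.
  exists (dotp p 0), 0 => //=; apply: le_trans (stable_norm_le_enorm Ha _) _.
  by rewrite enorm0 mulr0 ler01.
exists (enorm p * M) => _ [v /= Nv <-]; apply: le_trans (dotp_le _ _) _.
rewrite ler_wpM2l ?enorm_ge0//.
have := le_trans (stable_norm_ge_enorm Ha v) Nv.
by rewrite ler_pdivrMl// mulr1.
Qed.

Lemma dotp_le_dual_norm p v : dotp p v <= dual_norm p * N v.
Proof.
have [Nv|Nv] := eqVneq (N v) 0.
  have : M^-1 * enorm v <= 0.
    by rewrite -Nv; exact: stable_norm_ge_enorm Ha v.
  rewrite pmulr_rle0 ?invr_gt0// => ev.
  have -> : v = 0 by apply: enorm0_eq0; apply/eqP; rewrite eq_le ev enorm_ge0.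
  rewrite dotp0r -[X in N X](scale0r v) (stable_normZ Ha)// mul0r.
  by rewrite mulr0.
have Np : 0 < N v by rewrite lt_neqAle eq_sym Nv N0.
rewrite -ler_pdivrMr//; apply: ub_le_sup; first by have [] := dual_norm_has_sup p.
exists ((N v)^-1 *: v); last by rewrite dotpZr mulrC.
by rewrite /= (stable_normZ Ha) ?invr_ge0// mulVf.
Qed.

Lemma dual_norm_le p (b : R) : (forall v, dotp p v <= b * N v) -> dual_norm p <= b.
Proof.
move=> h; have b0 : 0 <= b.
  pose e : plane := delta_mx 0 0.
  have Ne : 0 < N e.
    apply: lt_le_trans (stable_norm_ge_enorm Ha e).
    by rewrite mulr_gt0 ?invr_gt0// enorm_gt0//; apply/eqP => /rowP/(_ 0)/eqP; rewrite !mxE /= oner_eq0.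
  have := h e; have := h (- e); rewrite dotpNr (stable_normN Ha).
  by move=> h1 h2; rewrite -(pmulr_lge0 _ Ne); lra.
apply: ge_sup; first by have [] := dual_norm_has_sup p.
move=> _ [v /= Nv <-]; apply: le_trans (h v) _.
by rewrite -[leRHS]mulr1 ler_wpM2l.
Qed.

Lemma dual_norm_ge0 p : 0 <= dual_norm p.
Proof.
apply: ub_le_sup; first by have [] := dual_norm_has_sup p.
exists 0; last by rewrite dotp0r.
apply: le_trans (stable_norm_le_enorm Ha _) _.
by rewrite enorm0 mulr0 ler01.
Qed.

Section fixed_p.
Variable p : plane.
Let c := dual_norm p.
Let c0 : 0 <= c. Proof. exact: dual_norm_ge0. Qed.

(** One defect for passing from the stable norm to the distance from 0, another for moving the base
    point to x. *)
Lemma dotp_le_metric x y : dotp p (y - x) <= c * D x y + 2 * c * C.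
Proof.
have h1 := dotp_le_dual_norm p (y - x); rewrite -/c in h1.
have h2 := stable_norm_le_dist Ha (y - x).
have h3 := metric_dist_translate_rev Ha x (y - x); rewrite (addrC x) subrK in h3.
have : c * N (y - x) <= c * (D x y + 2 * C) by rewrite ler_wpM2l//; lra.
lra.
Qed.

(** A variant of [le_stable_norm] for a factor c that may be 0 and so cannot be divided out. *)
Lemma stable_norm_scaled_ge v (s k : R) :
  (forall l : R, 0 < l -> l * s - k <= c * D 0 (l *: v)) -> s <= c * N v.
Proof.
move=> h; apply/ler_addgt0Pr => e e0.
pose e2 := e / 2 / (c + 1).
have c1 : 0 < c + 1 by rewrite ltr_wpDl.
have e20 : 0 < e2 by rewrite !divr_gt0.
have [L L0 HL] := stable_normP Ha v e20.
pose l := Num.max L (`|k| / (e / 2)).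
have lL : L <= l by rewrite le_max lexx.
have lp : 0 < l := lt_le_trans L0 lL.
have lc : k <= l * (e / 2).
  rewrite -ler_pdivrMr ?divr_gt0//; apply: (@le_trans _ _ (`|k| / (e / 2))).
    by rewrite ler_pM2r ?invr_gt0 ?divr_gt0// ler_norm.
  by rewrite le_max lexx orbT.
have := HL l lL; rewrite ler_norml => /andP[_ h1].
have h2 : c * e2 <= e / 2.
  by rewrite mulrC /e2 mulrAC ler_pdivrMr// ler_pM2l ?divr_gt0//; lra.
rewrite -(ler_pM2l lp); have := h l lp.
have : c * D 0 (l *: v) <= c * (l * N v + e2 * l) by rewrite ler_wpM2l//; lra.
nra.
Qed.

(* Cutting a long path at successive spheres of radius r would otherwise give
   [c D - p] at least linear growth, and c could be decreased. *)
Lemma almost_calibrated (r : R) : 0 < r ->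
  exists2 w, r <= enorm w & c * D 0 w - dotp p w <= c * C + 2.
Proof.
move=> r0; apply: contrapT => Hn.
have hK w : r <= enorm w -> c * C + 2 < c * D 0 w - dotp p w.
  by move=> rw; rewrite ltNge; apply/negP => h; apply: Hn; exists w.
(* Each sphere gains 1: of the margin [c * C + 2] in [hK], the first term pays for translating the
   piece to the origin, and 1 for the path being only almost optimal. *)
have S (j : nat) x w : j%:R * r <= enorm (w - x) ->
    j%:R - 2 * c * C <= c * D x w - dotp p (w - x).
  elim: j x w => [|j IH] x w hj.
    by have := dotp_le_metric x w; lra.
  have c1 : 0 < c + 1 by rewrite ltr_wpDl.
  rewrite -natr1 mulrDl mul1r in hj.
  have rw : r <= enorm (w - x).
    by apply: le_trans hj; rewrite lerDr mulr_ge0// ltW.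
  have e0 : 0 < (c + 1)^-1 by rewrite invr_gt0.
  have [z [k [zr xz kz _]]] := metric_dist_exit Ha r0 rw e0.
  have hz : j%:R * r <= enorm (w - z).
    by have := enorm_triangle z w x; rewrite zr; lra.
  have h1 := IH _ _ hz.
  have zr' : r <= enorm (z - x) by rewrite zr.
  have h2 := hK _ zr'.
  have h4 := metric_dist_translate_rev Ha x (z - x); rewrite (addrC x) subrK in h4.
  have h5 : c * D 0 (z - x) <= c * (D x z + C) by rewrite ler_wpM2l.
  have h6 : c * (D x z + D z w) <= c * (D x w + (c + 1)^-1).
    by rewrite ler_wpM2l//; lra.
  have h7 : c * (c + 1)^-1 <= 1 by rewrite ler_pdivrMr// mul1r lerDl.
  have -> : dotp p (w - x) = dotp p (w - z) + dotp p (z - x) by rewrite -dotpDr subrKA.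
  rewrite -natr1; lra.
have S2 v : dotp p v + enorm v / r <= c * N v.
  apply: (@stable_norm_scaled_ge _ _ (1 + 2 * c * C)) => l l0.
  pose j := Num.truncn (enorm (l *: v) / r).
  have /andP[j1 j2] : j%:R <= enorm (l *: v) / r < j.+1%:R.
    by apply: truncn_itv; rewrite divr_ge0 ?enorm_ge0// ltW.
  have := S j 0 (l *: v); rewrite subr0 -ler_pdivlMr// => /(_ j1).
  rewrite -natr1 in j2; rewrite dotpZr mulrDr.
  have -> : l * (enorm v / r) = enorm (l *: v) / r by rewrite enormZ gtr0_norm// mulrA.
  lra.
(* As [enorm v] is at least [m * N v], the linear gain lets c be decreased, against its choice as a
   dual norm. *)
have : c <= c - m / r.
  apply: dual_norm_le => v; apply: le_trans (_ : c * N v - enorm v / r <= _).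
    by have := S2 v; lra.
  have := stable_norm_le_enorm Ha v; rewrite ler_pdivlMl// => h.
  rewrite mulrBl lerD2l lerN2 [m / r * _]mulrAC ler_pM2r ?invr_gt0//.
have : 0 < m / r by rewrite divr_gt0.
lra.
Qed.

(* A Busemann function: distance from infinity, tilted by p. *)
Definition busemann_n (n : nat) (x : plane) : R :=
  inf [set c * D y x + dotp p y | y in [set y | n%:R <= enorm y]].

Definition busemann (x : plane) : R := sup [set busemann_n n x | n in [set: nat]].

Lemma busemann_n_has_inf n x :
  has_inf [set c * D y x + dotp p y | y in [set y | n%:R <= enorm y]].
Proof.
split.
  have [|w] := almost_calibrated (r := n%:R + 1); first by rewrite ltr_wpDl.
  move=> wn _; exists (c * D w x + dotp p w), w => //=; lra.
exists (dotp p x - 2 * c * C) => _ [y _ <-].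
by have := dotp_le_metric y x; rewrite dotpBr; lra.
Qed.

Lemma busemann_n_le n x y : n%:R <= enorm y -> busemann_n n x <= c * D y x + dotp p y.
Proof.
by move=> ny; apply: ge_inf; [have [] := busemann_n_has_inf n x|exists y].
Qed.

Lemma busemann_n_ge n x (r : R) :
  (forall y, n%:R <= enorm y -> r <= c * D y x + dotp p y) -> r <= busemann_n n x.
Proof.
move=> h; apply: lb_le_inf; first by have [] := busemann_n_has_inf n x.
by move=> _ [y ny <-]; exact: h.
Qed.

Lemma busemann_n_mono n n' x : (n <= n')%N -> busemann_n n x <= busemann_n n' x.
Proof.
move=> nn; apply: busemann_n_ge => y yn; apply: busemann_n_le.
by apply: le_trans yn; rewrite ler_nat.
Qed.

Lemma busemann_n_lipschitz n x z : busemann_n n x <= busemann_n n z + c * D z x.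
Proof.
rewrite -lerBlDr; apply: busemann_n_ge => y yn.
have := busemann_n_le x yn.
have : c * D y x <= c * (D y z + D z x) by apply: ler_wpM2l => //; exact: (metric_dist_triangle Ha).
lra.
Qed.

(** Almost calibrated vectors w of arbitrary length give far base points [x - w] whose value is
    bounded independently of n; otherwise the infima might tend to infinity with n. *)
Lemma busemann_has_sup x : has_sup [set busemann_n n x | n in [set: nat]].
Proof.
split; first by exists (busemann_n 0 x), 0%N.
exists (dotp p x + 2 * (c * C) + 2) => _ [n _ <-].
have [|w wn hw] := almost_calibrated (r := n%:R + enorm x + 1).
  by rewrite ltr_wpDl// addr_ge0 ?enorm_ge0.
have xw : n%:R <= enorm (x - w).
  by have := enormD (w - x) x; rewrite subrK enormB; lra.
apply: le_trans (busemann_n_le x xw) _.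
have h := metric_dist_translate Ha (x - w) w; rewrite subrK in h.
have : c * D (x - w) x <= c * (D 0 w + C) by rewrite ler_wpM2l.
rewrite dotpBr; lra.
Qed.

Lemma le_busemann n x : busemann_n n x <= busemann x.
Proof.
by apply: ub_le_sup; [have [] := busemann_has_sup x|exists n].
Qed.

Lemma busemann_le x (r : R) : (forall n, busemann_n n x <= r) -> busemann x <= r.
Proof.
move=> h; apply: ge_sup; first by have [] := busemann_has_sup x.
by move=> _ [n _ <-].
Qed.

Lemma busemann_lipschitz x z : busemann x <= busemann z + c * D z x.
Proof.
apply: busemann_le => n; apply: le_trans (busemann_n_lipschitz n x z) _.
by rewrite lerD2r le_busemann.
Qed.

(** Moving the base points by a lattice vector changes their norms by a bounded amount, which is
    harmless in the limit n to infinity. This is what makes the tilted function periodic. *)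
Lemma busemann_shift x k : busemann (x + lattice k) = busemann x + dotp p (lattice k).
Proof.
have key y l : busemann y + dotp p (lattice l) <= busemann (y + lattice l).
  rewrite -lerBrDr; apply: busemann_le => n; rewrite lerBrDr.
  pose n' := (Num.truncn (n%:R + enorm (lattice l : plane))).+1.
  have hn' : n%:R + enorm (lattice l : plane) <= n'%:R by apply/ltW/truncnS_gt.
  apply: le_trans (le_busemann n' _); apply: busemann_n_ge => z zn.
  have zn' : n%:R <= enorm (z - lattice l).
    by have := enormD (z - lattice l) (lattice l); rewrite subrK; lra.
  have := busemann_n_le y zn'.
  rewrite -(metric_dist_shift Ha (z - lattice l) y l) subrK dotpBr; lra.
apply/eqP; rewrite eq_le key andbT.
have := key (x + lattice k) (- k); rewrite latticeN addrK dotpNr; lra.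
Qed.

(** The converse of the Lipschitz bound, needed for supersolutions. An almost optimal path between x
    and a far base point crosses the sphere at a point z where the function is lower by c times the
    cost inside the ball. As z depends on n, a cluster point on the sphere is taken. Two thirds of e
    are spent on each crossing, one on the passage to the cluster point. *)
Lemma busemann_calibrated x (r A e : R) : 0 < r -> 0 < A -> 0 < e ->
  (forall y, enorm (y - x) <= r -> a y <= A) ->
  exists2 z, enorm (z - x) = r & busemann z + c * (r / A) <= busemann x + e.
Proof.
move=> r0 A0 e0 hA; pose e1 := e / 3; have e10 : 0 < e1 by rewrite divr_gt0.
have c1 : 0 < c + 1 by rewrite ltr_wpDl.
have step (n : nat) : exists z, enorm (z - x) = r /\
    busemann_n n z + c * (r / A) <= busemann x + 2 * e1.
  pose n' := (n + (Num.truncn (r + enorm x)).+1)%N.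
  have hn' : n%:R + (r + enorm x) <= n'%:R by rewrite natrD lerD2l; apply/ltW/truncnS_gt.
  have [_ [y /= yn <-] hy] := inf_adherent e10 (busemann_n_has_inf n' x).
  have yx : r <= enorm (y - x).
    have := enormD (y - x) x; rewrite subrK.
    have : 0 <= n%:R :> R by []. lra.
  have e2 : 0 < e1 / (c + 1) by rewrite divr_gt0.
  have [z [k [zr xz kz hk]]] := metric_dist_exit Ha r0 yx e2.
  exists z; split=> //.
  have yn' : n%:R <= enorm y by have := enorm_ge0 x; lra.
  have h1 := busemann_n_le z yn'.
  have h2 : c * (r / A + D y z) <= c * (D y x + e1 / (c + 1)).
    rewrite ler_wpM2l//; have := hk _ A0 hA.
    rewrite (metric_dist_sym Ha y z) (metric_dist_sym Ha y x); lra.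
  have h3 : c * (e1 / (c + 1)) <= e1.
    by rewrite mulrA ler_pdivrMr// mulrC ler_pM2l// lerDl.
  have h4 := le_busemann n' x; rewrite -/(busemann_n n' x) in hy; lra.
have [zs hz] := choice step.
pose K := [set z : plane | enorm (z - x) = r].
have cK : compact K.
  apply: (@subclosed_compact _ _ [set z : plane | enorm z <= r + enorm x]).
  - have -> : K = (fun z : plane => enorm (z - x)) @^-1` [set r] by [].
    apply: closed_comp; last exact: closed_eq.
    move=> z _; apply: (@lipschitz_continuous _ _ 1) => u v.
    by rewrite mul1r (le_trans (ler_dist_enorm _ _))// opprB addrA subrK.
  - exact: compact_ball.
  - by move=> z; rewrite /K /= => zr; have := enormD (z - x) x; rewrite subrK zr.
have [|z [Kz clz]] := cK (zs @ \oo) _ _.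
  by exists 0%N => // n _ /=; have [] := hz n.
exists z => //; rewrite -lerBrDr; apply: busemann_le => n; rewrite lerBrDr.
pose d := e1 * m / (c + 1).
have d0 : 0 < d by rewrite divr_gt0 ?mulr_gt0.
have fA : (zs @ \oo) [set w | exists2 n', (n <= n')%N & zs n' = w].
  by exists n => // n' /= nn'; exists n'.
have fB : nbhs z [set w : plane | enorm (w - z) < d] by apply/near_enorm; exists d.
have [_ [[n' nn' <-] zz]] := clz _ _ fA fB.
have [zr' hz'] := hz n'.
have h1 := busemann_n_lipschitz n z (zs n').
have h2 := busemann_n_mono (zs n') nn'.
have h3 : c * D (zs n') z <= e1.
  apply: le_trans (_ : c * (d / m) <= _).
    rewrite ler_wpM2l//; apply: le_trans (metric_dist_le Ha _ _) _.
    by rewrite enormB ler_pM2r ?invr_gt0//; apply: ltW.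
  have -> : d / m = e1 / (c + 1) by rewrite /d mulrAC mulfK// gt_eqF.
  by rewrite mulrA ler_pdivrMr// mulrC ler_pM2l// lerDl.
have : 3 * e1 = e by rewrite /e1; field.
lra.
Qed.

End fixed_p.
End DualNorm.

(** * Viscosity solutions of the cell problem *)

Section Viscosity.
Context {R : realType}.
Local Notation plane := 'rV[R]_2.
Implicit Types (x y z v w p : plane) (k : 'rV[int]_2) (f : plane -> R).

Lemma periodic_partial f i : periodic f -> periodic (partial i f).
Proof.
move=> pf k x; rewrite /partial /derive.
have -> : (fun h : R => h^-1 *: ((f \o shift (x + map_mx intr k)) (h *: 'e_i) - f (x + map_mx intr k)))
  = (fun h : R => h^-1 *: ((f \o shift x) (h *: 'e_i) - f x)).
  by apply/funext => h /=; rewrite /shift /= addrA !pf.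
by [].
Qed.

Lemma periodic_C1_lipschitz f : periodic f -> Ck 1 f ->
  exists2 L : R, 0 < L & forall x y, `|f y - f x| <= L * enorm (y - x).
Proof.
move=> pf Cf.
have b i : exists B : R, forall x, `|partial i f x| <= B.
  have [x0 [x1 h]] := periodic_bounded (Ck_continuous (Ck_partial i Cf)) (periodic_partial i pf).
  exists (`|partial i f x0| + `|partial i f x1|) => x; have /andP[h0 h1] := h x.
  have := ler_norm (partial i f x1); have := ler_norm (- partial i f x0); rewrite normrN.
  have := normr_ge0 (partial i f x0); have := normr_ge0 (partial i f x1).
  by rewrite ler_norml => *; apply/andP; split; lra.
have [B0 h0] := b 0; have [B1 h1] := b 1.
exists (B0 + B1 + 1).
  have := le_trans (normr_ge0 _) (h0 0); have := le_trans (normr_ge0 _) (h1 0); lra.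
move=> x y; have [z1 [z2 [_ _ ->]]] := mean_value_plane x y Cf.
apply: le_trans (ler_normD _ _) _; rewrite !normrM.
have := coord_le_enorm (y - x) 0; have := coord_le_enorm (y - x) 1; rewrite !mxE.
have := h0 z1; have := h1 z2; have := enorm_ge0 (y - x).
move: (partial 0 f z1) (partial 1 f z2) (y 0 0 - x 0 0) (y 0 1 - x 0 1) (enorm (y - x)).
move=> r s t u E; have := normr_ge0 r; have := normr_ge0 s; have := normr_ge0 t; have := normr_ge0 u.
nra.
Qed.

Lemma gradient_sqdist (K : R) w x :
  gradient (fun z => K * dotp (z - w) (z - w)) x = (2 * K) *: (x - w).
Proof.
apply: gradient_derive => i; apply: is_derive_from_line; apply/is_derive_epsP => e e0.
exists (e / (`|K| + 1)); first by rewrite divr_gt0// ltr_wpDl.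
move=> h; rewrite ltr_pdivlMr ?ltr_wpDl// add0r scale0r add0r => he.
have -> : K * dotp (h *: delta_mx 0 i + x - w) (h *: delta_mx 0 i + x - w) - K * dotp (x - w) (x - w)
   - ((2 * K) *: (x - w)) 0 i * h = K * h ^+ 2.
  rewrite -[h *: _ + x - w]addrA; move: (x - w) => d.
  rewrite dotpDl !dotpDr !dotpZl !dotpZr (dotpC (delta_mx 0 i) d) !dotp_delta !mxE.
  by rewrite !eqxx /=; ring.
rewrite normrM normrX expr2 mulrA ler_wpM2r//.
have := normr_ge0 h; nra.
Qed.

Lemma Ck_sqdist n (K : R) w : Ck n (fun z => K * dotp (z - w) (z - w)).
Proof.
pose e0 : plane := delta_mx 0 0; pose e1 : plane := delta_mx 0 1.
pose s (e : plane) z := (dotp e z - dotp e w) * (dotp e z - dotp e w).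
have Cs e : Ck n (s e).
  by apply: Ck_mul; apply: Ck_sub; [exact: Ck_dotp|exact: Ck_cst|exact: Ck_dotp|exact: Ck_cst].
apply: Ck_ext (Ck_mul (Ck_cst n K) (Ck_add (Cs e0) (Cs e1))) => z.
by rewrite /s !dotpE !mxE /=; ring.
Qed.

Lemma gradient_linear_add p f x : Ck 1 f ->
  gradient (fun z => dotp p z + f z) x = p + gradient f x.
Proof. by move=> Cf; rewrite gradientD ?gradient_dotp//; exact: Ck_dotp. Qed.

Section comparison.
Variables (a : plane -> R) (m M : R).
Hypotheses (Ha : periodic_bounds a m M) (Ca : Ck 1 a).

(* Doubling of variables: at a minimum of v2 x - v1 y + K |x - y|^2 both test
   functions have the same gradient. *)
Lemma viscosity_comparison p (c1 c2 : R) (v1 v2 : plane -> R) :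
  continuous v1 -> periodic v1 -> viscosity_subsolution a p c1 v1 ->
  continuous v2 -> periodic v2 -> viscosity_supersolution a p c2 v2 -> c2 <= c1.
Proof.
move=> cv1 pv1 sub1 cv2 pv2 sup2.
have [ca pa m0 ma] := Ha.
have [L L0 HL] := periodic_C1_lipschitz pa Ca.
have [x0 [x1 hv]] := periodic_bounded cv1 pv1.
pose B := v1 x1 - v1 x0.
have B0 : 0 <= B by have /andP[] := hv x1; rewrite /B; lra.
have osc x y : v1 y - v1 x <= B.
  by have /andP[_ h1] := hv y; have /andP[h2 _] := hv x; rewrite /B; lra.
(* Here g is the common slope weighted by a at the point where v1 is tested; weighting it at the
   other point costs a factor of at most 1 + e. *)
suff key (e : R) : 0 < e -> exists2 g, c2 <= (1 + e) * g & 0 <= g <= c1.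
  apply/ler_addgt0Pr => e e0.
  have c10 : 0 <= c1 by have [g _ /andP[]] := key 1 ltr01; exact: le_trans.
  have d0 : 0 < c1 + 1 by lra.
  have [|g h1 /andP[g0 g1]] := key (e / (c1 + 1)); first by rewrite divr_gt0.
  apply: le_trans h1 _; have E : 0 < e / (c1 + 1) by rewrite divr_gt0.
  have : e / (c1 + 1) * g <= e / (c1 + 1) * (c1 + 1) by rewrite ler_wpM2l ?ltW//; lra.
  rewrite divfK ?gt_eqF//; lra.
move=> e0'; move: e0' => e0.
(* Within distance d the Lipschitz function a, which is at least m, varies by a factor of at most 1
   + e. K has two tasks: [B + 1 <= K] confines the minimum to increments of length at most 1, and
   [B < K * d ^+ 2] then brings the two points within d. *)
pose d := e * m / L; have d0 : 0 < d by rewrite divr_gt0 ?mulr_gt0.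
pose K := B + 1 + (B + 1) / d ^+ 2.
have dd : 0 < d ^+ 2 by rewrite exprn_gt0.
have K0 : 0 < (B + 1) / d ^+ 2 by rewrite divr_gt0//; lra.
have KB : B + 1 <= K by rewrite /K lerDl ltW.
have Kd : B < K * d ^+ 2.
  have : (B + 1) / d ^+ 2 * d ^+ 2 <= K * d ^+ 2 by rewrite ler_pM2r// /K; lra.
  by rewrite divfK ?gt_eqF//; lra.
pose Psi (q : plane * plane) := v2 q.1 - v1 (q.1 + q.2) + K * dotp q.2 q.2.
pose A := [set x : plane | enorm x <= 2] `*` [set h : plane | enorm h <= 1].
have cA : compact A by apply: compact_setX; exact: compact_ball.
have A0 : A !=set0 by exists (0, 0); split; rewrite /= enorm0.
have cPsi : continuous Psi.
  move=> q; have FF : Filter (nbhs q) by exact: nbhs_filter.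
  have c1' : {for q, continuous (fun q : plane * plane => v2 q.1)}.
    by apply: (continuous_comp (f := fst) (g := v2)); [exact: cvg_fst|exact: cv2].
  have c2' : {for q, continuous (fun q : plane * plane => v1 (q.1 + q.2))}.
    apply: (continuous_comp (f := fun q : plane * plane => q.1 + q.2) (g := v1)); last exact: cv1.
    exact: add_continuous.
  have c3' : {for q, continuous (fun q : plane * plane => K * dotp q.2 q.2)}.
    apply: (continuous_comp (f := snd) (g := fun z : plane => K * dotp z z)).
      exact: cvg_snd.
    have := @Ck_sqdist 0 K 0; case => + _; move=> /(_ q.2).
    by have -> : (fun z : plane => K * dotp (z - 0) (z - 0)) = (fun z => K * dotp z z)
      by apply/funext => z; rewrite subr0.
  have := cvgD (cvgB c1' c2') c3'; exact.
have [[xm hm] Am minA] := compact_EVT_min A0 cA (continuous_subspaceT cPsi).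
(* The minimum over a compact set is global: Psi is periodic in x, and an increment longer than 1
   does no better than the increment 0. *)
have {}minA x h : Psi (xm, hm) <= Psi (x, h).
  have shift x' k h' : Psi (x' - lattice k, h') = Psi (x', h').
    rewrite /Psi /=; congr (_ - _ + _).
      by rewrite -[in RHS](subrK (lattice k) x') pv2.
    by rewrite -[LHS](pv1 k) -/(lattice k) addrAC subrK.
  have [k hk] := floor_lattice x; have xk := enorm_unit_box hk.
  have [h1|h1] := leP (enorm h) 1.
    by rewrite -(shift x k); apply: minA; rewrite inE.
  apply: (@le_trans _ _ (Psi (x, 0))).
    by rewrite -(shift x k); apply: minA; rewrite inE; split; rewrite //= enorm0.
  rewrite /Psi /= addr0 dotp0l mulr0 addr0 -sqr_enorm.
  have := osc x (x + h); have : 1 <= enorm h ^+ 2 by apply: exprn_ege1; exact: ltW.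
  nra.
pose ym := xm + hm; pose g := p + (2 * K) *: hm.
have Exy : xm - ym = - hm by apply: plane_eq; rewrite !mxE; ring.
have Eyx : ym - xm = hm by rewrite -opprB Exy opprK.
have h1 : c2 <= a xm * enorm g.
  have := sup2 (fun z => (- K) * dotp (z - ym) (z - ym)) xm (Ck_sqdist 1 _ _).
  rewrite gradient_sqdist.
  have -> : (2 * - K) *: (xm - ym) = (2 * K) *: hm.
    by rewrite Exy mulrN scaleNr scalerN opprK.
  apply; apply/near_enorm; exists 1 => // z _.
  have := minA z (ym - z); rewrite /Psi /= (addrC z) subrK -/ym.
  have -> : dotp (ym - z) (ym - z) = dotp (z - ym) (z - ym) by rewrite -opprB dotpNl dotpNr opprK.
  have -> : dotp hm hm = dotp (xm - ym) (xm - ym).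
    by rewrite Exy dotpNl dotpNr opprK.
  lra.
have h2 : a ym * enorm g <= c1.
  have := sub1 (fun z => K * dotp (z - xm) (z - xm)) ym (Ck_sqdist 1 _ _).
  rewrite gradient_sqdist.
  rewrite Eyx; apply; apply/near_enorm; exists 1 => // z _.
  have := minA xm (z - xm); rewrite /Psi /= (addrC _ (z - xm)) subrK -/ym.
  lra.
have h3 : enorm hm < d.
  have := minA xm 0; rewrite /Psi /= addr0 dotp0l mulr0 addr0 => h.
  rewrite -(ltr_pXn2r (n := 2)) ?nnegrE ?enorm_ge0 ?(ltW d0)// sqr_enorm.
  have Kp : 0 < K by lra.
  rewrite -(ltr_pM2l Kp); apply: le_lt_trans Kd; have := osc xm (xm + hm); lra.
have h4 : a xm <= (1 + e) * a ym.
  have := HL ym xm; rewrite ler_norml => /andP[_].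
  rewrite Exy enormN => h.
  have /andP[h5 _] := ma ym.
  have : L * enorm hm <= e * m.
    by rewrite mulrC -ler_pdivlMr// ltW.
  have : e * m <= e * a ym by rewrite ler_pM2l.
  lra.
exists (a ym * enorm g).
  apply: le_trans h1 _; rewrite mulrA ler_wpM2r ?enorm_ge0//.
rewrite h2 andbT mulr_ge0 ?enorm_ge0//; have /andP[h5 _] := ma ym; lra.
Qed.

Lemma effective_hamiltonian_solvable p : cell_problem_solvable a p (dual_norm a p).
Proof.
have [ca pa m0 ma] := Ha.
pose c := dual_norm a p; have c0 : 0 <= c by exact: dual_norm_ge0 Ha p.
pose u := busemann a p; pose v x := u x - dotp p x.
have ap x : 0 < a x by have /andP[h _] := ma x; exact: lt_le_trans m0 h.
have u_lip x z : u x - u z <= c * metric_dist a z x.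
  by have := busemann_lipschitz Ha p x z; rewrite /u /c; lra.
exists v; split.
- apply: (@lipschitz_continuous _ _ (c / m + enorm p)) => x z.
  have h1 := u_lip x z; have h2 := u_lip z x.
  rewrite (metric_dist_sym Ha z x) in h1.
  have h3 : c * metric_dist a x z <= c * (enorm (x - z) / m).
    by rewrite ler_wpM2l// enormB; exact: metric_dist_le Ha _ _.
  have := normr_dotp p (x - z); rewrite dotpBr ler_norml => /andP[h4 h5].
  rewrite ler_norml /v; apply/andP; split; lra.
- move=> k x; rewrite /v -/(lattice k) /u (busemann_shift Ha) dotpDr; lra.
- move=> phi y Cphi /near_enorm[d1 d10 hd1].
  pose Phi z := dotp p z + phi z.
  have CPhi : Ck 1 Phi by apply: Ck_add => //; exact: Ck_dotp.
  pose q := p + gradient phi y.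
  have Eq : gradient Phi y = q by exact: gradient_linear_add.
  rewrite -/q; have [q0|q0] := eqVneq q 0; first by rewrite q0 enorm0 mulr0.
  have nq : 0 < enorm q by rewrite enorm_gt0.
  rewrite mulrC -ler_pdivlMr//; apply/ler_addgt0Pr => e e0.
  pose e1 := e / (c + 1); have e10 : 0 < e1 by rewrite divr_gt0// ltr_wpDl.
  have [d2 d20 hd2] := C1_differentiable y CPhi e10.
  have cV : continuous (fun x => (a x)^-1) by apply: continuous_inv => // x; rewrite gt_eqF.
  have [d3 d30 hd3] := (continuous_enormP _ _).1 (cV y) _ e10.
  pose s := Num.min d1 (Num.min d2 d3) / 2.
  have s0 : 0 < s by rewrite divr_gt0// !lt_min d10 d20.
  have [sd1 sd2 sd3] : [/\ s < d1, s < d2 & s < d3].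
    have : Num.min d1 (Num.min d2 d3) <= d1 by rewrite ge_min lexx.
    have : Num.min d1 (Num.min d2 d3) <= d2 by rewrite !ge_min lexx orbT.
    have : Num.min d1 (Num.min d2 d3) <= d3 by rewrite !ge_min lexx !orbT.
    by rewrite /s => *; split; lra.
  (* A step of length s against the gradient: the test function drops by s times the norm of q to
     first order, u by at most c times the cost of a short segment. *)
  pose z := y - (s / enorm q) *: q.
  have zy : z - y = - ((s / enorm q) *: q) by rewrite /z addrAC subrr add0r.
  have nz : enorm (z - y) = s.
    rewrite zy enormN enormZ (gtr0_norm (divr_gt0 s0 nq)).
    by apply: divfK; rewrite gt_eqF.
  have h1 := hd1 z; rewrite nz in h1; have {}h1 := h1 sd1.
  have h2 := hd2 z; rewrite nz in h2; have {}h2 := h2 sd2.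
  rewrite Eq zy dotpNr dotpZr -sqr_enorm in h2.
  have E2 : s / enorm q * enorm q ^+ 2 = s * enorm q.
    by rewrite expr2 mulrA; congr (_ * _); apply: divfK; rewrite gt_eqF.
  rewrite E2 in h2.
  have h3 := u_lip y z.
  have h4 : metric_dist a z y <= s * ((a y)^-1 + e1).
    rewrite (metric_dist_sym Ha) -nz; apply: (metric_dist_le_segment Ha) => t /andP[t0 t1].
    have := hd3 (y + t *: (z - y)); rewrite addrAC subrr add0r enormZ nz ger0_norm// => h.
    have := h (le_lt_trans (ler_piMl (ltW s0) t1) sd3).
    by rewrite ltr_norml => /andP[_]; lra.
  have h5 : c * metric_dist a z y <= c * (s * ((a y)^-1 + e1)) by rewrite ler_wpM2l.
  rewrite ler_norml in h2; case/andP: h2 => _ h2.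
  have E : Phi y - Phi z <= u y - u z by rewrite /Phi; move: h1; rewrite /v; lra.
  have : s * enorm q <= s * (c / a y + e).
    have -> : s * (c / a y + e) = c * (s * ((a y)^-1 + e1)) + e1 * s.
      by rewrite /e1; field; rewrite gt_eqF ?ltr_wpDl//= gt_eqF.
    lra.
  by rewrite ler_pM2l.
- move=> phi y Cphi /near_enorm[d1 d10 hd1].
  pose Phi z := dotp p z + phi z.
  have CPhi : Ck 1 Phi by apply: Ck_add => //; exact: Ck_dotp.
  pose q := p + gradient phi y.
  have Eq : gradient Phi y = q by exact: gradient_linear_add.
  rewrite -/q -/c; apply/ler_addgt0Pr => e' e'0.
  (* The final estimate is [c <= (enorm q + 2 * e) * (a y + e)]; T bounds the factor of e in the
     expanded product when e is at most 1. *)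
  pose T := 2 * a y + enorm q + 2; have T0 : 0 < T.
    by rewrite /T; have := ap y; have := enorm_ge0 q; lra.
  pose e := Num.min 1 (e' / T).
  have e0 : 0 < e by rewrite lt_min ltr01 divr_gt0.
  have e1 : e <= 1 by rewrite ge_min lexx.
  have eT : e * T <= e' by rewrite -ler_pdivlMr// ge_min lexx orbT.
  have [d2 d20 hd2] := C1_differentiable y CPhi e0.
  have [d3 d30 hd3] := (continuous_enormP _ _).1 (ca y) _ e0.
  pose r := Num.min d1 (Num.min d2 d3) / 2.
  have r0 : 0 < r by rewrite divr_gt0// !lt_min d10 d20.
  have [rd1 rd2 rd3] : [/\ r < d1, r < d2 & r < d3].
    have : Num.min d1 (Num.min d2 d3) <= d1 by rewrite ge_min lexx.
    have : Num.min d1 (Num.min d2 d3) <= d2 by rewrite !ge_min lexx orbT.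
    have : Num.min d1 (Num.min d2 d3) <= d3 by rewrite !ge_min lexx !orbT.
    by rewrite /r => *; split; lra.
  have A0 : 0 < a y + e by rewrite addr_gt0.
  have er : 0 < e * r by rewrite mulr_gt0.
  have hA w : enorm (w - y) <= r -> a w <= a y + e.
    move=> wr; have := hd3 w (le_lt_trans wr rd3).
    by rewrite ltr_norml => /andP[_]; lra.
  have [z nz hz] := busemann_calibrated Ha p r0 A0 er hA.
  have h1 := hd1 z; rewrite nz in h1; have {}h1 := h1 rd1.
  have h2 := hd2 z; rewrite nz in h2; have {}h2 := h2 rd2.
  rewrite Eq in h2.
  have h3 := dotp_le (- q) (z - y); rewrite dotpNl enormN nz in h3.
  rewrite ler_norml in h2; case/andP: h2 => h2 _.
  rewrite -/u -/c in hz.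
  have E : u y - u z <= Phi y - Phi z by rewrite /Phi; move: h1; rewrite /v; lra.
  have h4 : r * (c / (a y + e)) <= r * (enorm q + 2 * e).
    have -> : r * (c / (a y + e)) = c * (r / (a y + e)) by ring.
    lra.
  rewrite ler_pM2l// ler_pdivrMr// in h4.
  apply: le_trans h4 _.
  have := enorm_ge0 q; have := ap y; rewrite /T in eT; nra.
Qed.

Lemma effective_hamiltonianE p : effective_hamiltonian a p = dual_norm a p.
Proof.
have [v [cv pv sv sv']] := effective_hamiltonian_solvable p.
apply: get_unique; first exact: effective_hamiltonian_solvable.
move=> c [w [cw pw sw sw']]; apply/eqP; rewrite eq_le.
rewrite (viscosity_comparison cv pv sv cw pw sw').
by rewrite (viscosity_comparison cw pw sw cv pv sv').
Qed.

Lemma SsetE p : Sset a p <-> forall v, dotp p v <= stable_norm a v.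
Proof.
rewrite /Sset /= effective_hamiltonianE; split=> [h v|h].
  apply: le_trans (dotp_le_dual_norm Ha p v) _.
  rewrite ler_piMl//; apply: le_trans (stable_norm_ge_enorm Ha v).
  have [_ _ m0 ma] := Ha; rewrite mulr_ge0 ?enorm_ge0// invr_ge0.
  by have /andP[h1 h2] := ma 0; rewrite (le_trans _ (le_trans h1 h2))// ltW.
by apply: (dual_norm_le Ha) => v; rewrite mul1r.
Qed.

End comparison.
End Viscosity.

(** * Convex bodies *)

Section ConvexBodies.
Context {R : realType}.
Local Notation plane := 'rV[R]_2.
Implicit Types (x y z v w p : plane) (K L : set plane) (N : plane -> R).

Lemma plane_convexP (K : set plane) : convex_set K <->
  forall x y (t : R), 0 <= t -> t <= 1 -> K x -> K y -> K (t *: x + (1 - t) *: y).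
Proof.
split=> [cK x y t t0 t1 /mem_set xK /mem_set yK|h x y l].
  by have := cK x y (Itv01 t0 t1) xK yK; rewrite inE.
by rewrite !inE => xK yK; apply: h.
Qed.

(* Norms whose constants of equivalence with the Euclidean norm are explicit. *)
Definition plane_norm N (al be : R) := [/\ 0 < al,
  (forall v w, N (v + w) <= N v + N w), (forall (c : R) v, 0 <= c -> N (c *: v) = c * N v),
  (forall v, N (- v) = N v) & (forall v, al * enorm v <= N v <= be * enorm v)].

Lemma plane_norm_be N al be : plane_norm N al be -> 0 < be.
Proof.
move=> [al0 _ _ _ /(_ (delta_mx 0 0))/andP[h1 h2]].
have e0 : 0 < enorm (delta_mx 0 0 : plane).
  by rewrite enorm_gt0//; apply/eqP => /rowP/(_ 0)/eqP; rewrite !mxE /= oner_eq0.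
by rewrite -(pmulr_lgt0 _ e0); apply: lt_le_trans (le_trans h1 h2); rewrite mulr_gt0.
Qed.

Lemma plane_norm_continuous N al be : plane_norm N al be -> continuous N.
Proof.
move=> Nn; have [_ ND _ NN Nb] := Nn; apply: (@lipschitz_continuous _ _ be) => x y.
have h1 := ND (x - y) y; have h2 := ND (y - x) x; rewrite !subrK in h1 h2.
have h3 := NN (x - y); rewrite opprB in h3.
by have /andP[_ h4] := Nb (x - y); rewrite ler_norml; apply/andP; split; lra.
Qed.

Lemma Wbodies_intro K (r s : R) : 0 < r -> closed K -> convex_set K -> centrally_symmetric K ->
  (forall x, enorm x <= r -> K x) -> (forall x, K x -> enorm x <= s) -> Wbodies K.
Proof.
move=> r0 cK vK sK hr hs; split=> //.
- apply: (@subclosed_compact _ _ [set x : plane | enorm x <= s]) => //.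
  exact: compact_ball.
- exists 0; apply/near_enorm; exists r => // y; rewrite subr0 => /ltW; exact: hr.
Qed.

Lemma unit_ball_Wbodies N al be : plane_norm N al be -> Wbodies [set v | N v <= 1].
Proof.
move=> Nn; have [al0 ND NZ NN Nb] := Nn; have be0 := plane_norm_be Nn.
apply: (@Wbodies_intro _ be^-1 al^-1); first by rewrite invr_gt0.
- have -> : [set v | N v <= 1] = N @^-1` [set s | s <= 1] by [].
  apply: closed_comp; last exact: closed_le.
  by move=> x _; exact: plane_norm_continuous Nn x.
- apply/plane_convexP => x y t t0 t1 /= Nx Ny.
  apply: le_trans (ND _ _) _; rewrite !NZ ?subr_ge0//; nra.
- by move=> x /=; rewrite NN.
- move=> x /= xr; have /andP[_ h] := Nb x; apply: le_trans h _.
  by rewrite -ler_pdivlMl// mulr1.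
- move=> x /= xr; have /andP[h _] := Nb x.
  by rewrite -[al^-1]mulr1 ler_pdivlMl//; exact: le_trans h xr.
Qed.

Lemma dual_ball_Wbodies N al be : plane_norm N al be ->
  Wbodies [set p | forall v, dotp p v <= N v].
Proof.
move=> Nn; have [al0 ND NZ NN Nb] := Nn; have be0 := plane_norm_be Nn.
apply: (@Wbodies_intro _ al be) => //.
- have -> : [set p | forall v, dotp p v <= N v] =
     \bigcap_(v in [set: plane]) (dotp v @^-1` [set s | s <= N v]).
    apply/seteqP; split=> [p h v _|p h v]; rewrite /= 1?dotpC; first exact: h.
    exact: (h v I).
  apply: closed_bigI => v _; apply: closed_comp; last exact: closed_le.
  by move=> x _; exact: continuous_dotp.
- apply/plane_convexP => x y t t0 t1 /= hx hy v; rewrite dotpDl !dotpZl.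
  have := hx v; have := hy v; nra.
- by move=> x hx v; rewrite dotpNl -dotpNr -NN.
- move=> x xr v; apply: le_trans (dotp_le _ _) _; have /andP[h _] := Nb v.
  by apply: le_trans h; rewrite ler_wpM2r ?enorm_ge0.
- move=> x hx; have [->|x0] := eqVneq x 0; first by rewrite enorm0 ltW.
  have n0 : 0 < enorm x by rewrite enorm_gt0.
  rewrite -(ler_pM2r n0) -expr2 sqr_enorm; apply: le_trans (hx x) _.
  by have /andP[] := Nb x.
Qed.

Lemma Wbodies_balls K : Wbodies K -> exists r s : R, [/\ 0 < r, 0 < s,
  (forall x, enorm x <= r -> K x) & (forall x, K x -> enorm x <= s)].
Proof.
move=> [cK vK sK [x0 /near_enorm[d d0 hd]]]; have {}vK := (plane_convexP K).1 vK.
have Kx0 : K x0 by apply: hd; rewrite subrr enorm0.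
have cnorm : {within K, continuous (@enorm R)} by apply: continuous_subspaceT; exact: continuous_enorm.
have [xm _ hm] := EVT_max_rV (ex_intro _ x0 Kx0) cK cnorm.
exists (d / 2), (enorm xm + 1); split.
- by rewrite divr_gt0.
- by rewrite ltr_wpDl// enorm_ge0.
- move=> x xr.
  (* Symmetry carries the interior point x0 to the origin: x is the midpoint of [x0 + x] and
     [x - x0]. *)
  have h1 : K (x0 + x) by apply: hd; rewrite addrAC subrr add0r; lra.
  have h2 : K (- (x0 - x)).
    by apply: sK; apply: hd; rewrite addrAC subrr add0r enormN; lra.
  have := vK _ _ (2^-1) _ _ h1 h2.
  have -> : 2^-1 *: (x0 + x) + (1 - 2^-1) *: - (x0 - x) = x.
    by apply: plane_eq; rewrite !mxE; field.
  by apply; lra.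
- by move=> x Kx; have := hm x (mem_set Kx); lra.
Qed.

(** The normal is [x - q], with q the point of K nearest to x: from a point of K beyond the
    supporting line at q, convexity would produce a point nearer to x. *)
Lemma separation K x : compact K -> convex_set K -> K !=set0 -> ~ K x ->
  exists v (s : R), (forall y, K y -> dotp v y <= s) /\ s < dotp v x.
Proof.
move=> cK /plane_convexP vK K0 nKx.
have cdist : {within K, continuous (fun y => enorm (y - x))}.
  apply: continuous_subspaceT; apply: (@lipschitz_continuous _ _ 1) => u w.
  by rewrite mul1r (le_trans (ler_dist_enorm _ _))// opprB addrA subrK.
have [q /set_mem Kq hq] := EVT_min_rV K0 cK cdist.
pose v := x - q; have v0 : 0 < enorm v.
  by rewrite enorm_gt0// subr_eq0; apply/eqP => E; apply: nKx; rewrite E.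
exists v, (dotp v q); split; last first.
  by rewrite -subr_gt0 -dotpBr -sqr_enorm exprn_gt0.
move=> y Ky; rewrite -subr_le0 -dotpBr leNgt; apply/negP => s0.
pose w := y - q; rewrite -/w in s0.
have w0 : 0 < enorm w.
  by rewrite enorm_gt0//; apply/eqP => E; move: s0; rewrite E dotp0r ltxx.
(* The foot of the perpendicular from x to the line through q and y, capped so as to stay in the
   segment. *)
pose t := Num.min 1 (dotp v w / enorm w ^+ 2).
have t0 : 0 < t by rewrite lt_min ltr01 divr_gt0// exprn_gt0.
have t1 : t <= 1 by rewrite ge_min lexx.
have tw : t * enorm w ^+ 2 <= dotp v w.
  by rewrite -ler_pdivlMr ?exprn_gt0// ge_min lexx orbT.
have Kz : K (t *: y + (1 - t) *: q) by apply: vK => //; exact: ltW.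
have := hq _ (mem_set Kz).
have -> : t *: y + (1 - t) *: q - x = t *: w - v.
  by rewrite /w /v; apply: plane_eq; rewrite !mxE; ring.
rewrite (enormB q x) -/v -(ler_pXn2r (n := 2)) ?nnegrE ?enorm_ge0//.
have E (a b : plane) : dotp (t *: a - b) (t *: a - b) =
    t * (t * dotp a a) - 2 * (t * dotp b a) + dotp b b.
  by rewrite !dotpE !mxE; ring.
rewrite !sqr_enorm E; rewrite sqr_enorm in tw.
have : 0 < t * dotp v w by rewrite mulr_gt0.
nra.
Qed.

Definition support_function K (v : plane) : R := sup [set dotp p v | p in K].
Local Notation h := support_function.

Section support.
Variable K : set plane.
Hypothesis WK : Wbodies K.

Let K0 : K 0.
Proof. by have [r [s [r0 _ hr _]]] := Wbodies_balls WK; apply: hr; rewrite enorm0 ltW. Qed.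

Lemma support_function_has_sup v : has_sup [set dotp p v | p in K].
Proof.
have [r [s [r0 _ hr hs]]] := Wbodies_balls WK.
split; first by exists (dotp 0 v), 0.
exists (s * enorm v) => _ [p Kp <-]; apply: le_trans (dotp_le _ _) _.
by rewrite ler_wpM2r ?enorm_ge0// hs.
Qed.

Lemma dotp_le_support p v : K p -> dotp p v <= h K v.
Proof. by move=> Kp; apply: ub_le_sup; [have [] := support_function_has_sup v|exists p]. Qed.

Lemma support_function_le v (b : R) : (forall p, K p -> dotp p v <= b) -> h K v <= b.
Proof.
move=> hb; apply: ge_sup; first by have [] := support_function_has_sup v.
by move=> _ [p Kp <-]; exact: hb.
Qed.

Lemma support_function_norm (r s : R) : 0 < r -> (forall x, enorm x <= r -> K x) ->
  (forall x, K x -> enorm x <= s) -> plane_norm (h K) r s.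
Proof.
move=> r0 hr hs; split=> //.
- move=> v w; apply: support_function_le => p Kp; rewrite dotpDr.
  by apply: lerD; exact: dotp_le_support.
- move=> c v; rewrite le_eqVlt => /predU1P[<-|c0].
    rewrite scale0r mul0r; apply/eqP; rewrite eq_le; apply/andP; split.
      by apply: support_function_le => p _; rewrite dotp0r.
    by rewrite -(dotp0r 0); exact: dotp_le_support.
  apply/eqP; rewrite eq_le; apply/andP; split.
    apply: support_function_le => p Kp; rewrite dotpZr ler_pM2l//.
    exact: dotp_le_support.
  rewrite mulrC -ler_pdivlMr//; apply: support_function_le => p Kp.
  by rewrite ler_pdivlMr// mulrC -dotpZr; exact: dotp_le_support.
- have key v : h K (- v) <= h K v.
    apply: support_function_le => p Kp; rewrite dotpNr -dotpNl.
    by apply: dotp_le_support; case: WK => _ _ + _; exact.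
  by move=> v; apply/eqP; rewrite eq_le key -{1}(opprK v) key.
- move=> v; apply/andP; split.
    have [->|v0] := eqVneq v 0.
      by rewrite enorm0 mulr0 -(dotp0r 0); exact: dotp_le_support.
    have n0 : 0 < enorm v by rewrite enorm_gt0.
    have -> : r * enorm v = dotp ((r / enorm v) *: v) v.
      by rewrite dotpZl -sqr_enorm expr2 mulrA divfK// gt_eqF.
    apply: dotp_le_support; apply: hr.
    by rewrite enormZ gtr0_norm ?divr_gt0// divfK// gt_eqF.
  apply: support_function_le => p Kp; apply: le_trans (dotp_le _ _) _.
  by rewrite ler_wpM2r ?enorm_ge0// hs.
Qed.

Lemma support_function_normW : exists r s, plane_norm (h K) r s.
Proof.
have [r [s [r0 _ hr hs]]] := Wbodies_balls WK.
by exists r, s; exact: support_function_norm.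
Qed.

Lemma bipolar p : (forall v, dotp p v <= h K v) -> K p.
Proof.
move=> hp; apply: contrapT => nKp; have [cK vK _ _] := WK.
have [v [s [h1 h2]]] := separation cK vK (ex_intro _ 0 K0) nKp.
have := hp v; rewrite dotpC leNgt => /negP; apply; apply: le_lt_trans h2.
by apply: support_function_le => q Kq; rewrite dotpC; exact: h1.
Qed.

End support.

Lemma polar_Wbodies K : Wbodies K -> Wbodies [set p | h K p <= 1].
Proof. by move=> WK; have [r [s hn]] := support_function_normW WK; exact: unit_ball_Wbodies hn. Qed.

(** The half of the bipolar theorem that rests on separation; it transfers estimates on the polar
    body back to K. *)
Lemma polar_support K v : Wbodies K -> h [set p | h K p <= 1] v <= 1 -> K v.
Proof.
move=> WK hv; have WL := polar_Wbodies WK.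
apply: (bipolar WK) => w; have [r [s [r0 hD hZ hN hb]]] := support_function_normW WK.
have [->|w0] := eqVneq w 0.
  by rewrite dotp0r; have /andP[+ _] := hb 0; rewrite enorm0 mulr0.
have hw : 0 < h K w.
  by have /andP[h1 _] := hb w; apply: lt_le_trans h1; rewrite mulr_gt0// enorm_gt0.
have Lw : [set p | h K p <= 1] ((h K w)^-1 *: w).
  by rewrite /= hZ ?mulVf ?gt_eqF// invr_ge0 ltW.
have := le_trans (dotp_le_support WL v Lw) hv.
by rewrite dotpZl ler_pdivrMl// mulr1 dotpC.
Qed.

Lemma hausdorff_dist_le (A B : set plane) (d : R) :
  (forall x, A x -> exists2 y, B y & enorm (x - y) <= d) ->
  (forall y, B y -> exists2 x, A x & enorm (y - x) <= d) ->
  (hausdorff_dist A B <= d%:E)%E.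
Proof.
move=> hA hB; rewrite /hausdorff_dist ge_max; apply/andP; split.
  apply: ge_ereal_sup => _ [x Ax <-]; have [y By xy] := hA x Ax.
  by apply: le_trans (_ : ((enorm (x - y))%:E <= _)%E); [apply: ereal_inf_lbound; exists y|rewrite lee_fin].
apply: ge_ereal_sup => _ [x Ax <-]; have [y By xy] := hB x Ax.
by apply: le_trans (_ : ((enorm (x - y))%:E <= _)%E); [apply: ereal_inf_lbound; exists y|rewrite lee_fin].
Qed.

(** Turns a relative error into a distance: x and its quotient by 1 + e are apart by e / (1 + e)
    times the norm of x. *)
Lemma hausdorff_dist_scaled (A B : set plane) (e s : R) : 0 <= e ->
  (forall x, A x -> enorm x <= s) ->
  (forall x, A x -> B ((1 + e)^-1 *: x)) -> (forall x, B x -> A ((1 + e)^-1 *: x)) ->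
  (hausdorff_dist A B <= (e * s)%:E)%E.
Proof.
move=> e0 hs AB BA; have e1 : 0 < 1 + e by lra.
have E x : enorm (x - (1 + e)^-1 *: x) = e * ((1 + e)^-1 * enorm x).
  have -> : x - (1 + e)^-1 *: x = (e / (1 + e)) *: x.
    by apply: plane_eq; rewrite !mxE; field; rewrite gt_eqF.
  by rewrite enormZ ger0_norm ?mulrA// divr_ge0// ltW.
apply: hausdorff_dist_le => x hx; exists ((1 + e)^-1 *: x); rewrite ?E; try by auto.
  rewrite ler_wpM2l// ler_pdivrMl//; have := hs x hx; have := enorm_ge0 x; nra.
rewrite ler_wpM2l//; have := hs _ (BA x hx).
by rewrite enormZ ger0_norm// invr_ge0 ltW.
Qed.

End ConvexBodies.

(** * Entropy and properness *)

Section Entropy.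
Context {R : realType}.
Local Notation plane := 'rV[R]_2.
Implicit Types (x y z v w p : plane) (f g u a b : plane -> R).

Definition iter_partial (w : seq 'I_2) f : plane -> R := foldl (fun g i => partial i g) f w.

(* Taylor's formula around [x0], with the partial derivatives indexed by words
   so that no symmetry of mixed derivatives is involved. *)
Lemma word_taylor k u x0 (e n B : R) : Ck k u -> 0 <= e -> 0 < n ->
  (forall (w : seq 'I_2), (size w < k)%N -> `|iter_partial w u x0| <= e * n ^+ size w) ->
  (forall (w : seq 'I_2) x, size w = k -> `|iter_partial w u x| <= B) ->
  forall x, (forall i, `|x 0 i - x0 0 i| <= n^-1) -> `|u x| <= 3 ^+ k * (e + B / n ^+ k).
Proof.
move=> Cu e0 n0; elim: k u e Cu e0 => [|k IH] u e Cu e0 hlow htop x hx.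
  have := htop [::] x erefl; rewrite /= expr0 mul1r divr1; lra.
have B0 : 0 <= B by apply: le_trans (normr_ge0 _) (htop (nseq k.+1 0) x0 (size_nseq _ _)).
have d i z : (forall i, `|z 0 i - x0 0 i| <= n^-1) ->
    `|partial i u z| <= 3 ^+ k * (e * n + B / n ^+ k).
  apply: IH => //.
  - exact: Ck_partial.
  - by rewrite mulr_ge0// ltW.
  - move=> w wk; rewrite -mulrA -exprS.
    by have := hlow (i :: w); rewrite /= ltnS => /(_ wk).
  - by move=> w z' wk; have := htop (i :: w) z'; rewrite /= wk; apply.
have [z1 [z2 [hz1 hz2 E]]] := mean_value_plane x0 x (Ck_le (isT : (1 <= k.+1)%N) Cu).
have h0 := hlow [::] isT; rewrite /= mulr1 in h0.
have d1 := d 0 z1 (fun i => le_trans (hz1 i) (hx i)).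
have d2 := d 1 z2 (fun i => le_trans (hz2 i) (hx i)).
pose T := 3 ^+ k * (e + B / n ^+ k.+1).
have ET : 3 ^+ k * (e * n + B / n ^+ k) * n^-1 = T.
  have q0 : n ^+ k != 0 by rewrite expf_neq0// gt_eqF.
  have n0' : n != 0 by rewrite gt_eqF.
  by rewrite /T exprS; move: (n ^+ k) q0 => q q0; field; apply/andP.
have m1 : `|partial 0 u z1 * (x 0 0 - x0 0 0)| <= T by rewrite normrM -ET ler_pM.
have m2 : `|partial 1 u z2 * (x 0 1 - x0 0 1)| <= T by rewrite normrM -ET ler_pM.
have eT : e <= T.
  have h1 : 1 <= 3 ^+ k :> R by rewrite exprn_ege1//; lra.
  have h2 : 0 <= B / n ^+ k.+1 by rewrite divr_ge0// exprn_ge0// ltW.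
  rewrite /T; nra.
have -> : 3 ^+ k.+1 * (e + B / n ^+ k.+1) = T + T + T by rewrite /T exprS; ring.
have -> : u x = u x0 + (u x - u x0) by ring.
apply: le_trans (ler_normD _ _) _; rewrite E.
by have := ler_normD (partial 0 u z1 * (x 0 0 - x0 0 0)) (partial 1 u z2 * (x 0 1 - x0 0 1)); lra.
Qed.

Lemma smooth_partial f i : smooth f -> smooth (partial i f).
Proof. by move=> sf k; exact: Ck_partial. Qed.

Lemma iter_partialB (w : seq 'I_2) f g : smooth f -> smooth g ->
  iter_partial w (fun x => f x - g x) = (fun x => iter_partial w f x - iter_partial w g x).
Proof.
elim: w f g => [|i w IH] f g sf sg //=.
rewrite -IH; try exact: smooth_partial.
congr (iter_partial w _); apply/funext => x.
by have [_] := is_deriveB (Ck_is_derive i x (sf 1%N)) (Ck_is_derive i x (sg 1%N)).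
Qed.

Lemma iter_partial_bounded k f : smooth f -> periodic f ->
  exists B : R, forall (w : seq 'I_2) x, (size w <= k)%N -> `|iter_partial w f x| <= B.
Proof.
elim: k f => [|k IH] f sf pf.
  have [x0 [x1 h]] := periodic_bounded (Ck_continuous (sf 0%N)) pf.
  exists (`|f x0| + `|f x1|) => -[|//] x _ /=; have /andP[h0 h1] := h x.
  have := ler_norm (f x1); have := ler_norm (- f x0); rewrite normrN.
  have := normr_ge0 (f x0); have := normr_ge0 (f x1).
  by rewrite ler_norml => *; apply/andP; split; lra.
have [x0 [x1 h]] := periodic_bounded (Ck_continuous (sf 0%N)) pf.
have [B0 h0] := IH _ (smooth_partial 0 sf) (periodic_partial 0 pf).
have [B1 h1] := IH _ (smooth_partial 1 sf) (periodic_partial 1 pf).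
have p0 := le_trans (normr_ge0 _) (h0 [::] 0 isT).
have p1 := le_trans (normr_ge0 _) (h1 [::] 0 isT).
exists (`|f x0| + `|f x1| + B0 + B1) => -[|i w] x /=.
  move=> _; have /andP[q0 q1] := h x.
  have := ler_norm (f x1); have := ler_norm (- f x0); rewrite normrN.
  have := normr_ge0 (f x0); have := normr_ge0 (f x1).
  by rewrite ler_norml => *; apply/andP; split; lra.
rewrite ltnS => wk; have := normr_ge0 (f x0); have := normr_ge0 (f x1).
by move: i; apply: ord2_ind; [have := h0 w x wk|have := h1 w x wk]; lra.
Qed.

(** The index M is a natural number so that countably many classes exhaust the coefficients. The
    lower bound on a turns closeness of values into closeness of ratios. *)
Definition Ck_ball (k M : nat) a := [/\ smooth a, periodic a,
  (forall x, 1 <= M%:R * a x) &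
  (forall (w : seq 'I_2) x, (size w <= k)%N -> `|iter_partial w a x| <= M%:R)].

Lemma coefficient_Ck_ball k a : coefficient a -> exists M, Ck_ball k M.+1 a.
Proof.
move=> [pa sa a0 _]; have [B hB] := iter_partial_bounded k sa pa.
have [x0 [x1 hx]] := periodic_bounded (Ck_continuous (sa 0%N)) pa.
have i0 : 0 < (a x0)^-1 by rewrite invr_gt0.
exists (Num.truncn (`|B| + (a x0)^-1)).
have hM := truncnS_gt (`|B| + (a x0)^-1).
split=> //.
  move=> x; have /andP[h _] := hx x.
  apply: (@le_trans _ _ ((a x0)^-1 * a x)); first by rewrite ler_pdivlMl// mulr1.
  by rewrite ler_pM2r//; have := normr_ge0 B; lra.
by move=> w x wk; apply: le_trans (hB w x wk) _; have := ler_norm B; lra.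
Qed.

Section code.
Variables (k M n : nat).
Hypothesis n0 : (0 < n)%N.
Let nR : R := n%:R.
Let nR0 : 0 < nR. Proof. by rewrite ltr0n. Qed.

(** Largest rounded value: shifted by M the derivatives lie in [0, 2M], and the finest scale, that
    of order 0, is n^k. *)
Definition code_size := (2 * M * n ^ k)%N.

Definition node (i j : 'I_n) : plane := \row_(l < 2) (if l == 0 then i%:R / nR else j%:R / nR).

Definition code_index : finType := ('I_n * 'I_n * 'I_k * k.-tuple 'I_2)%type.

(* The partial derivatives of order below k on a grid of step 1/n, those of
   order l being rounded at precision [n ^ (l - k)]. *)
Definition code a : {ffun code_index -> 'I_code_size.+1} :=
  [ffun q : code_index => inord (Num.truncn
     ((iter_partial (take q.1.2 q.2) a (node q.1.1.1 q.1.1.2) + M%:R) * nR ^+ (k - q.1.2)))].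

(** By periodicity x may be taken in the unit cell. At the grid node below it, equal codes make the
    derivatives of order l < k differ by at most n^(l-k), and those of order k differ by at most 2M
    everywhere; [word_taylor] applies at step 1/n. *)
Lemma code_eq_close a b : Ck_ball k M a -> Ck_ball k M b -> code a = code b ->
  forall x, `|a x - b x| <= 3 ^+ k * (1 + 2 * M%:R) / nR ^+ k.
Proof.
move=> [sa pa _ ha] [sb pb _ hb] E x.
pose u z := a z - b z; have su : smooth u by move=> l; apply: Ck_sub.
have pu : periodic u by move=> l z; rewrite /u pa pb.
have [l hl] := floor_lattice x.
have -> : a x - b x = u (x - lattice l) by rewrite -[in LHS](subrK (lattice l) x) -[LHS]/(u _) pu.
set y := x - lattice l in hl *.
pose t i := Num.truncn (y 0 i * nR).
have ht i : ((t i)%:R <= y 0 i * nR < (t i).+1%:R) && (t i < n)%N.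
  have /andP[h0 h1] := hl i.
  have hh : 0 <= y 0 i * nR by rewrite mulr_ge0// ltW.
  by rewrite truncn_itv// truncn_lt_nat//= gtr_pMl.
have tn i : (t i < n)%N by have /andP[] := ht i.
have hk : 3 ^+ k * (1 + 2 * M%:R) / nR ^+ k = 3 ^+ k * ((nR ^+ k)^-1 + (2 * M%:R) / nR ^+ k).
  by rewrite -mulrA mulrDl mul1r.
rewrite hk; apply: (@word_taylor k u (node (Ordinal (tn 0)) (Ordinal (tn 1)))) => //.
- by rewrite invr_ge0 exprn_ge0// ltW.
- move=> w wk; rewrite /u iter_partialB//.
  (* A word shorter than k is padded, because codes are indexed by words of length k together with
     the length of the prefix that counts. *)
  pose tw := [tuple nth 0 w (i : nat) | i < k].
  have Ew : take (size w) tw = w.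
    have st : size (take (size w) tw) = size w by rewrite size_takel// size_tuple ltnW.
    apply: (@eq_from_nth _ 0) => // i; rewrite st => iw.
    rewrite nth_take// -[i]/(nat_of_ord (Ordinal (ltn_trans iw wk))) nth_mktuple.
    by [].
  have /ffunP/(_ (Ordinal (tn 0), Ordinal (tn 1), Ordinal wk, tw)) := E.
  rewrite !ffunE /= Ew; set z := node _ _.
  set A := iter_partial w a z; set B := iter_partial w b z.
  have hA : `|A| <= M%:R by apply: ha; exact: ltnW.
  have hB : `|B| <= M%:R by apply: hb; exact: ltnW.
  set s := nR ^+ (k - size w); have s0 : 0 < s by rewrite exprn_gt0.
  have bnd (C : R) : `|C| <= M%:R -> 0 <= (C + M%:R) * s /\
      (Num.truncn ((C + M%:R) * s) < code_size.+1)%N.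
    rewrite ler_norml => /andP[C1 C2]; have hh : 0 <= (C + M%:R) * s.
      by apply: mulr_ge0; [lra|exact: ltW].
    split=> //; rewrite truncn_lt_nat//; apply: (@le_lt_trans _ _ code_size%:R); last by rewrite ltr_nat.
    rewrite /code_size natrM natrM natrX -/nR; apply: ler_pM => //; first by lra.
      exact: ltW.
      by lra.
    by rewrite ler_weXn2l ?leq_subr// ler1n.
  have [A1 A2] := bnd _ hA; have [B1 B2] := bnd _ hB.
  move=> /(congr1 (@nat_of_ord _)); rewrite !inordK// => EE.
  have /andP[a1 a2] := truncn_itv A1; have /andP[b1 b2] := truncn_itv B1.
  rewrite EE in a1 a2.
  have : `|(A - B) * s| <= 1.
    rewrite -natr1 in a2 b2; rewrite ler_norml; apply/andP; split; nra.
  rewrite normrM (gtr0_norm s0) -ler_pdivlMr// div1r /s => h.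
  apply: le_trans h _; rewrite exprB ?(ltnW wk) ?unitfE ?gt_eqF// invf_div.
  by rewrite mulrC.
- move=> w z wk; rewrite /u iter_partialB//.
  apply: le_trans (ler_normB _ _) _; rewrite mulr_natl mulr2n.
  by apply: lerD; [apply: ha|apply: hb]; rewrite wk.
- have hn i : `|y 0 i - (t i)%:R / nR| <= nR^-1.
    have /andP[/andP[h1 h2] _] := ht i; rewrite -natr1 in h2.
    rewrite -(ler_pM2r nR0) -[X in `|_| * X](gtr0_norm nR0) -normrM mulrBl.
    rewrite divfK ?mulVf ?gt_eqF// ler_norml; apply/andP; split; lra.
  apply: ord2_ind.
    by have -> : node (Ordinal (tn 0)) (Ordinal (tn 1)) 0 0 = (t 0)%:R / nR by rewrite mxE.
  by have -> : node (Ordinal (tn 0)) (Ordinal (tn 1)) 0 1 = (t 1)%:R / nR by rewrite mxE.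
Qed.

Lemma card_code : #|{ffun code_index -> 'I_code_size.+1}| = (code_size.+1 ^ (n * n * k * 2 ^ k))%N.
Proof. by rewrite card_ffun !card_prod card_tuple !card_ord. Qed.

End code.
End Entropy.

(** * Convex bodies with prescribed cuts *)

Section CutBodies.
Context {R : realType}.
Local Notation plane := 'rV[R]_2.
Implicit Types (x y z v w p : plane) (C : R -> R -> Prop).

Definition vec (s t : R) : plane := \row_(i < 2) (if i == 0 then s else t).

Lemma vec0 s t : vec s t 0 0 = s. Proof. by rewrite mxE. Qed.
Lemma vec1 s t : vec s t 0 1 = t. Proof. by rewrite mxE. Qed.

(* A region bounded by the parabola [y = 2 - x^2] and its mirror image, cut by
   the tangent lines at abscissa t lowered by d, for each pair [C t d]. *)
Definition cut_body C : set plane := [set z | [/\ `|z 0 0| <= 1, `|z 0 1| <= 2 &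
  forall t d, C t d -> z 0 1 <= 2 + t ^+ 2 - 2 * t * z 0 0 - d /\
                       - z 0 1 <= 2 + t ^+ 2 + 2 * t * z 0 0 - d]].

Definition parabola (s : R) : plane := vec s (2 - s ^+ 2).

Section cut_body.
Variable C : R -> R -> Prop.
Hypothesis HC : forall t d, C t d -> [/\ 0 <= t, t <= 1, 0 <= d & d <= 1].

Lemma cut_body_Wbodies : Wbodies (cut_body C).
Proof.
have c0 : continuous (fun z : plane => z 0 0) by exact: coord_continuous.
have c1 : continuous (fun z : plane => z 0 1) by exact: coord_continuous.
apply: (@Wbodies_intro _ _ (1/4) 3).
- by lra.
- have -> : cut_body C = ((fun z : plane => `|z 0 0|) @^-1` [set s | s <= 1]) `&`
     (((fun z : plane => `|z 0 1|) @^-1` [set s | s <= 2]) `&`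
     \bigcap_(q in [set q | C q.1 q.2])
       ((((fun z : plane => dotp (vec (2 * q.1) 1) z) @^-1` [set s | s <= 2 + q.1 ^+ 2 - q.2])) `&`
        (((fun z : plane => dotp (vec (- (2 * q.1)) (-1)) z) @^-1` [set s | s <= 2 + q.1 ^+ 2 - q.2])))).
    apply/seteqP; split=> z.
      move=> [h0 h1 h2]; split=> //; split=> // -[t d] /= /h2[h3 h4].
      by split; rewrite /= dotpE vec0 vec1; lra.
    move=> [h0 [h1 h2]]; split=> // t d Ctd; have [] := h2 (t, d) Ctd.
    by rewrite /= !dotpE !vec0 !vec1; split; lra.
  apply: closedI.
    apply: closed_comp; last exact: closed_le.
    by move=> x _; apply: continuous_comp; [exact: c0|exact: norm_continuous].
  apply: closedI.
    apply: closed_comp; last exact: closed_le.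
    by move=> x _; apply: continuous_comp; [exact: c1|exact: norm_continuous].
  apply: closed_bigI => q _; apply: closedI; apply: closed_comp;
    by [move=> x _; exact: continuous_dotp|exact: closed_le].
- apply/plane_convexP => x y t t0 t1 [x0 x1 hx] [y0 y1 hy]; split.
  + rewrite !mxE; move: x0 y0; rewrite !ler_norml => /andP[? ?] /andP[? ?].
    by apply/andP; split; nra.
  + rewrite !mxE; move: x1 y1; rewrite !ler_norml => /andP[? ?] /andP[? ?].
    by apply/andP; split; nra.
  + move=> s d Csd; have [h1 h2] := hx _ _ Csd; have [h3 h4] := hy _ _ Csd.
    rewrite !mxE; split; nra.
- move=> x [x0 x1 hx]; split; rewrite ?mxE ?normrN// => t d Ctd.
  have [h1 h2] := hx _ _ Ctd; split; lra.
- move=> x xr; have h0 := coord_le_enorm x 0; have h1 := coord_le_enorm x 1.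
  have {}h0 := le_trans h0 xr; have {}h1 := le_trans h1 xr.
  split; [lra|lra|] => t d /HC[t0 t1 d0 d1].
  move: h0 h1; rewrite !ler_norml => /andP[? ?] /andP[? ?]; split; nra.
- move=> x [x0 x1 _]; apply: le_trans (enorm_le_coord _) _; lra.
Qed.

(** At abscissa s the tangent at t lies [(s - t) ^+ 2] above the parabola, so a cut of at most this
    depth spares the point. *)
Lemma parabola_in s : 0 <= s <= 1 -> (forall t d, C t d -> d <= (s - t) ^+ 2) ->
  cut_body C (parabola s).
Proof.
move=> /andP[s0 s1] hs; split; rewrite ?vec0 ?vec1.
- by rewrite ger0_norm.
- by rewrite ger0_norm; nra.
- move=> t d Ctd; have := hs _ _ Ctd; have [t0 t1 d0 d1] := HC Ctd; split; nra.
Qed.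

(** The point exceeds the lowered tangent by d, and shrinking by the factor [1 - d / 4] takes away
    at most three quarters of this excess. So the gauge of the body at the point is above 1 by a
    definite amount. *)
Lemma parabola_out s d : C s d -> 0 < d -> ~ cut_body C ((1 - d / 4) *: parabola s).
Proof.
move=> Csd d0 [_ _ h]; have [h1 _] := h _ _ Csd; have [s0 s1 _ d1] := HC Csd.
have ss : s ^+ 2 <= 1 by rewrite expr_le1.
have ds : d * s ^+ 2 <= d by rewrite ler_piMr// ltW.
move: h1; rewrite !mxE /=.
have -> : 2 + s ^+ 2 - 2 * s * ((1 - d / 4) * s) - d = 2 - s ^+ 2 + (d * s ^+ 2) / 2 - d by field.
have -> : (1 - d / 4) * (2 - s ^+ 2) = 2 - s ^+ 2 - d / 2 + (d * s ^+ 2) / 4 by field.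
lra.
Qed.

End cut_body.

Section levels.
Variable m : nat -> nat.
Hypothesis m0 : forall M, (0 < m M)%N.
Variable bit : forall M, 'I_(m M) -> bool.

Definition level_size (M : nat) : R := (2 ^+ M)^-1.
Definition cut_point M (j : 'I_(m M)) : R := level_size M * (1 / 2 + j%:R / (4 * (m M)%:R)).
(** The square of half the spacing of the cut points of the level, so that a cut does not reach the
    neighbouring points. *)
Definition cut_depth M : R := (level_size M / (8 * (m M)%:R)) ^+ 2.
Definition cuts (t d : R) := exists M (j : 'I_(m M)), [/\ bit j, t = cut_point j & d = cut_depth M].

Let h M : 0 < level_size M. Proof. by rewrite invr_gt0 exprn_gt0. Qed.
Let mR M : 1 <= (m M)%:R :> R. Proof. by rewrite ler1n. Qed.
Let h1 M : level_size M <= 1. Proof. by rewrite invf_le1 ?exprn_ege1 ?exprn_gt0//; lra. Qed.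

(* The levels occupy disjoint ranges of abscissae, so that the patterns of cuts
   can be prescribed independently at all levels. *)
Lemma level_size_lt M M' : (M < M')%N -> 2 * level_size M' <= level_size M.
Proof.
move=> MM; rewrite /level_size -{1}(invrK 2) -invfM lef_pV2 ?posrE ?exprn_gt0 ?mulr_gt0 ?invr_gt0 ?exprn_gt0//.
rewrite ler_pdivlMl// -exprS ler_eXn2l//; lra.
Qed.

Lemma cut_point_bounds M (j : 'I_(m M)) :
  level_size M / 2 <= cut_point j <= 3 / 4 * level_size M.
Proof.
have j0 : 0 <= j%:R / (4 * (m M)%:R) :> R by rewrite divr_ge0// mulr_ge0.
have j1 : j%:R / (4 * (m M)%:R) <= 1 / 4 :> R.
  have mp : 0 < (m M)%:R :> R by rewrite ltr0n.
  rewrite ler_pdivrMr ?mulr_gt0//.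
  have : j%:R <= (m M)%:R :> R by rewrite ler_nat ltnW.
  lra.
by have hM := h M; rewrite /cut_point; apply/andP; split; nra.
Qed.

Lemma cut_depth_bounds M : 0 < cut_depth M /\ cut_depth M <= (level_size M / 8) ^+ 2.
Proof.
have mp : 0 < (m M)%:R :> R by rewrite ltr0n.
split; first by rewrite exprn_gt0// divr_gt0// mulr_gt0.
have hM := h M; have p1 : 0 <= level_size M / (8 * (m M)%:R).
  by rewrite ltW// divr_gt0// mulr_gt0.
have p2 : 0 <= level_size M / 8 by lra.
rewrite /cut_depth ler_pXn2r ?nnegrE//.
by rewrite ler_pM2l// lef_pV2 ?posrE ?mulr_gt0//; have := mR M; lra.
Qed.

Lemma cuts_bounds t d : cuts t d -> [/\ 0 <= t, t <= 1, 0 <= d & d <= 1].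
Proof.
move=> [M [j [_ -> ->]]]; have /andP[p1 p2] := cut_point_bounds j.
have [d1 d2] := cut_depth_bounds M; have := h M; have := h1 M.
by move=> *; split; [lra|lra|lra|nra].
Qed.

(** Points of different levels are apart by at least an eighth of the level size of the cut, points
    of one level by at least their spacing; both distances squared dominate the depth. *)
Lemma cuts_separated M (j : 'I_(m M)) t d : ~~ bit j -> cuts t d -> d <= (cut_point j - t) ^+ 2.
Proof.
move=> nb [M' [j' [b' -> ->]]].
have /andP[p1 p2] := cut_point_bounds j; have /andP[p1' p2'] := cut_point_bounds j'.
have hM := h M; have hM' := h M'.
have [d1 d2] := cut_depth_bounds M'.
have [MM|MM|MM] := ltngtP M M'.
- have l := level_size_lt MM; apply: le_trans d2 _.
  have q1 : level_size M' / 8 <= cut_point j - cut_point j' by lra.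
  have q2 : 0 <= level_size M' / 8 by lra.
  by rewrite ler_pXn2r ?nnegrE// (le_trans q2).
- have l := level_size_lt MM; apply: le_trans d2 _.
  have q1 : level_size M' / 8 <= cut_point j' - cut_point j by lra.
  have q2 : 0 <= level_size M' / 8 by lra.
  by rewrite -[leRHS]sqrrN opprB ler_pXn2r ?nnegrE// (le_trans q2).
- move: j' b' p1' p2' d1 d2; rewrite -MM => j' b' _ _ _ _.
  have jj : j != j' by apply: contraNneq nb => ->.
  have mp : 0 < (m M)%:R :> R by rewrite ltr0n.
  have -> : cut_point j - cut_point j' = level_size M / (4 * (m M)%:R) * (j%:R - j'%:R).
    by rewrite /cut_point; field; rewrite gt_eqF.
  have j1 : 1 <= (j%:R - j'%:R) ^+ 2 :> R.
    have jj' : (j : nat) != j' by [].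
    move: jj'; rewrite neq_ltn => /orP[l|l].
      rewrite -[leRHS]sqrrN opprB exprn_ege1// -natrB ?ler1n ?subn_gt0// ltnW//.
    by rewrite exprn_ege1// -natrB ?ler1n ?subn_gt0// ltnW.
  rewrite exprMn; apply: le_trans (_ : (level_size M / (4 * (m M)%:R)) ^+ 2 <= _).
    have q1 : 0 <= level_size M / (8 * (m M)%:R) by rewrite ltW// divr_gt0// mulr_gt0.
    have q2 : 0 <= level_size M / (4 * (m M)%:R) by rewrite ltW// divr_gt0// mulr_gt0.
    rewrite /cut_depth ler_pXn2r ?nnegrE//.
    by rewrite ler_pM2l// lef_pV2 ?posrE ?mulr_gt0//; lra.
  by rewrite ler_peMr// sqr_ge0.
Qed.

End levels.

End CutBodies.

(** * Counting codes against patterns of cuts *)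

Section NotAll.
Context {R : realType}.
Local Notation plane := 'rV[R]_2.
Variable N : (plane -> R) -> plane -> R.
(** The comparison is two-sided so as to cover the stable norm, which decreases in the coefficient,
    and the effective Hamiltonian, which increases. *)
Hypothesis Nmono : forall a b (c : R) v, coefficient a -> coefficient b -> 1 <= c ->
  (forall x, a x <= c * b x /\ b x <= c * a x) -> N b v <= c * N a v.
Hypothesis Nhom : forall a (c : R) v, coefficient a -> 0 <= c -> N a (c *: v) = c * N a v.

(** Allows n = 2^s to beat a bound that grows like s, that is, like the logarithm of n. *)
Lemma linear_le_exp2 (c : nat) : exists s, (c * s.+1 <= 2 ^ s)%N.
Proof.
exists (2 * (c + 3))%N; rewrite mulnC expnM -/(expn 2 2).
have h1 (t : nat) : (t < 2 ^ t)%N by exact: ltn_expl.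
have h2 (t : nat) : (2 * (t + 3) < 2 ^ (t + 3))%N.
  elim: t => // t IH; rewrite addSn expnS; lia.
rewrite (_ : 2 ^ 2 = 2 * 2)%N// expnMn mulnC.
by apply: leq_mul; [have := h1 (c + 3)%N; lia|have := h2 c; lia].
Qed.

(** With m = r n^2 this is c m^2 <= n^6: precision n^-6 resolves cuts of depth of order m^-2
    although r grows like the logarithm of n. *)
Lemma mul_sqr_le_exp6 (c r n : nat) : (0 < c)%N -> (c * r <= n)%N ->
  (c * (r * (n * n) * (r * (n * n))) <= n ^ 6)%N.
Proof.
move=> c0 cr; have -> : (n ^ 6 = n * n * (n * n * (n * n)))%N.
  by rewrite !expnS expn0 muln1 !mulnA.
rewrite mulnACA (mulnA c); apply: leq_mul => //.
by apply: leq_trans (leq_mul cr cr); rewrite mulnACA leq_mul2r leq_pmulr// orbT.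
Qed.

(* There are at most [(2 P n ^ 6 + 1) ^ (384 n ^ 2)] codes (384 = 6 * 2 ^ 6 words at
   each of the n ^ 2 nodes), whereas coefficients with the same code have
   distances proportional up to a factor [1 + O(n ^ -6)]; this factor still
   separates cuts of depth of order [m ^ -2], m of order [n ^ 2 ln n], and
   [2 ^ m] patterns exceed the number of codes. *)
Lemma bad_pattern (M : nat) : exists2 m, (0 < m)%N & forall q : 'I_m -> plane,
  exists b : 'I_m -> bool, forall a, coefficient a -> Ck_ball 6 M.+1 a ->
  ~ forall j, (~~ b j -> N a (q j) <= 1) /\
    (b j -> 1 < N a ((1 - (level_size M / (8 * m%:R)) ^+ 2 / 4) *: q j)).
Proof.
(* A quarter of the cut depth is the inverse of 256 4^M m^2; the factors 729 = 3^6 and 1 + 2P come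
   from [code_eq_close], and P from the lower bound 1/P on the coefficients. *)
pose P := M.+1; pose c := (256 * 729 * (P * (1 + 2 * P)) * 4 ^ M)%N.
have [s hs] := linear_le_exp2 (c * (384 * (P + 1) + 2305)).
(* With n a power of two, the number of codes is at most 2 to the power 384 (P + 1 + 6s) n^2; the
   final 1 in r makes [r * n ^ 2] exceed this exponent. The 2305 above is 384 * 6 + 1. *)
pose n := (2 ^ s)%N; pose r := (384 * (P + 1 + 6 * s) + 1)%N.
have n0 : (0 < n)%N by rewrite expn_gt0.
have cr : (c * r <= n)%N.
  apply: leq_trans hs; rewrite -mulnA leq_mul2l; apply/orP; right; rewrite /r; lia.
have c0 : (0 < c)%N by rewrite !muln_gt0 expn_gt0.
pose m := (r * (n * n))%N.
have r0 : (0 < r)%N by rewrite /r addn1.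
have m0 : (0 < m)%N by rewrite !muln_gt0 r0 n0.
have hm : (c * (m * m) <= n ^ 6)%N by exact: mul_sqr_le_exp6.
have hcard : ((code_size 6 P n).+1 ^ (n * n * 6 * 2 ^ 6) < 2 ^ m)%N.
  have h1 : ((code_size 6 P n).+1 <= 2 ^ (P + 1 + 6 * s))%N.
    have -> : (2 ^ (P + 1 + 6 * s) = 2 * 2 ^ P * n ^ 6)%N.
      by rewrite 2!expnD expn1 (mulnC 6) expnM (mulnC 2).
    have n6 : (0 < n ^ 6)%N by rewrite expn_gt0 n0.
    have PP : (P < 2 ^ P)%N by exact: ltn_expl.
    rewrite /code_size; apply: (@leq_trans (2 * P * n ^ 6 + n ^ 6)); first by rewrite -addn1 leq_add2l.
    by rewrite -mulSnr leq_mul2r ltn_mul2l PP !orbT.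
  apply: (@leq_ltn_trans ((2 ^ (P + 1 + 6 * s)) ^ (n * n * 6 * 2 ^ 6))).
    by rewrite leq_exp2r// !muln_gt0 n0.
  have : (0 < n * n)%N by rewrite muln_gt0 n0.
  rewrite -expnM ltn_exp2l// /m /r; move: (P + 1 + 6 * s)%N (n * n)%N => u v v0.
  have -> : (u * (v * 6 * 2 ^ 6) = 384 * u * v)%N by rewrite -mulnA (mulnC 384) -mulnA (mulnC v).
  by rewrite mulnDl mul1n -[X in (X < _)%N]addn0 ltn_add2l.
exists m => // q; apply: contrapT => nb.
pose dl : R := (level_size M / (8 * m%:R)) ^+ 2.
have ex (b : {ffun 'I_m -> bool}) : exists a, [/\ coefficient a, Ck_ball 6 P a &
    forall j, (~~ b j -> N a (q j) <= 1) /\ (b j -> 1 < N a ((1 - dl / 4) *: q j))].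
  apply: contrapT => na; apply: nb; exists b => a ca Ma H.
  by apply: na; exists a; split.
have [A hA] := choice ex.
pose E : R := 3 ^+ 6 * (1 + 2 * P%:R) / n%:R ^+ 6.
pose kap : R := 1 + P%:R * E.
have lv : 0 < level_size M :> R by rewrite invr_gt0 exprn_gt0.
have lv1 : level_size M <= 1 :> R by rewrite invf_le1 ?exprn_ege1 ?exprn_gt0//; lra.
have mR : 1 <= m%:R :> R by rewrite ler1n.
have nR : 0 < n%:R :> R by rewrite ltr0n.
have PR : 1 <= P%:R :> R by rewrite ler1n.
have dl0 : 0 < dl by rewrite exprn_gt0// divr_gt0// mulr_gt0//; lra.
have dl1 : dl <= 1.
  rewrite expr_le1// ?divr_ge0 ?(ltW lv) ?mulr_ge0//; try lra.
  by rewrite ler_pdivrMr ?mulr_gt0//; lra.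
have E0 : 0 <= E by rewrite divr_ge0 ?mulr_ge0 ?exprn_ge0//; lra.
have kapE : P%:R * E <= dl / 4.
  have h : (c%:R * (m%:R * m%:R) <= n%:R ^+ 6 :> R) by rewrite -!natrM -natrX ler_nat.
  have cE : c%:R = 256 * 729 * (P%:R * (1 + 2 * P%:R)) * 4 ^+ M :> R.
    by rewrite /c !natrM natrD natrM natrX.
  rewrite cE in h; rewrite /dl /E /level_size.
  have f2 : (2 : R) ^+ M != 0 by rewrite expf_neq0// pnatr_eq0.
  have f4 : (4 : R) ^+ M = (2 ^+ M) ^+ 2.
    by rewrite -exprM mulnC exprM; congr (_ ^+ _); ring.
  rewrite f4 in h; move: (2 ^+ M) f2 h => f f2 h.
  have n6 : 0 < n%:R ^+ 6 :> R by rewrite exprn_gt0.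
  move: (n%:R ^+ 6) n6 h => n6 n60 h.
  have mn0 : m%:R != 0 :> R by rewrite gt_eqF//; lra.
  move: (m%:R : R) mn0 h => mm mm0 h.
  have -> : (f^-1 / (8 * mm)) ^+ 2 / 4 = (256 * f ^+ 2 * (mm * mm))^-1.
    by field; rewrite f2 mm0.
  have fm : 0 < 256 * f ^+ 2 * (mm * mm).
    have p1 : 0 < f ^+ 2 by rewrite exprn_even_gt0.
    have p2 : 0 < mm * mm by rewrite -expr2 exprn_even_gt0.
    by apply: mulr_gt0 p2; apply: mulr_gt0.
  rewrite -[leRHS]mulr1 ler_pdivlMl//.
  have -> : 256 * f ^+ 2 * (mm * mm) * (P%:R * (3 ^+ 6 * (1 + 2 * P%:R) / n6)) =
     256 * 729 * (P%:R * (1 + 2 * P%:R)) * f ^+ 2 * (mm * mm) / n6.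
    by field; rewrite gt_eqF.
  by rewrite ler_pdivrMr// mul1r.
have kap1 : 1 <= kap by rewrite /kap lerDl mulr_ge0//; lra.
(* Equal codes make the norms agree up to the factor [1 + dl / 4]. Where the patterns differ, one
   norm is at most 1 and the other exceeds 1 / (1 - dl / 4), which is larger than that factor. *)
have bad (b1 b2 : {ffun 'I_m -> bool}) j : code 6 P n (A b1) = code 6 P n (A b2) ->
    ~~ b1 j -> b2 j -> False.
  move=> eqc nb1 pb2; have [c1 M1 H1] := hA b1; have [c2 M2 H2] := hA b2.
  have close := code_eq_close n0 M1 M2 eqc.
  have h : N (A b2) (q j) <= kap * N (A b1) (q j).
    apply: Nmono => // x; have := close x; rewrite -/E => cl.
    have [_ _ p1 _] := M1; have [_ _ p2 _] := M2.
    have {}p1 := p1 x; have {}p2 := p2 x.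
    move: cl; rewrite ler_norml => /andP[? ?].
    by split; rewrite /kap; nra.
  have h1 := (H1 j).1 nb1; have h2 := (H2 j).2 pb2.
  rewrite Nhom// in h2; last by lra.
  have : N (A b2) (q j) <= 1 + dl / 4 by apply: le_trans h _; rewrite /kap in kap1 *; nra.
  nra.
have inj : injective (fun b => code 6 P n (A b)).
  move=> b1 b2 eqc; apply/ffunP => j.
  case e1: (b1 j); case e2: (b2 j) => //.
    by case: (bad b2 b1 j (esym eqc)); rewrite ?e1 ?e2.
  by case: (bad b1 b2 j eqc); rewrite ?e1 ?e2.
have := leq_card _ inj; rewrite card_code card_ffun card_bool card_ord.
by rewrite leqNgt hcard.
Qed.

Lemma unit_balls_proper : [set [set v | N a v <= 1] | a in @coefficient R] <> Wbodies.
Proof.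
have [m hm] : {m : nat -> nat & forall M, (0 < m M)%N /\ forall q : 'I_(m M) -> plane,
  exists b : 'I_(m M) -> bool, forall a, coefficient a -> Ck_ball 6 M.+1 a ->
  ~ forall j, (~~ b j -> N a (q j) <= 1) /\
    (b j -> 1 < N a ((1 - (level_size M / (8 * (m M)%:R)) ^+ 2 / 4) *: q j))}.
  apply: (@choice nat nat (fun M k => (0 < k)%N /\ forall q : 'I_k -> plane,
  exists b : 'I_k -> bool, forall a, coefficient a -> Ck_ball 6 M.+1 a ->
  ~ forall j, (~~ b j -> N a (q j) <= 1) /\
    (b j -> 1 < N a ((1 - (level_size M / (8 * k%:R)) ^+ 2 / 4) *: q j)))) => M.
  by have [k k0 hk] := bad_pattern M; exists k.
have m0 M : (0 < m M)%N by have [] := hm M.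
pose q M (j : 'I_(m M)) := parabola (@cut_point R m M j).
have ex M : {b : 'I_(m M) -> bool | forall a, coefficient a -> Ck_ball 6 M.+1 a ->
  ~ forall j, (~~ b j -> N a (q M j) <= 1) /\
    (b j -> 1 < N a ((1 - cut_depth m M / 4) *: q M j))}.
  by apply: cid; have [_ /(_ (q M))] := hm M.
pose bit M := sval (ex M).
have HC := cuts_bounds (R := R) m0 (bit := bit).
move=> EW; have := cut_body_Wbodies HC.
rewrite -EW => -[a ca Ea].
have [M hM] := coefficient_Ck_ball 6 ca.
apply: (svalP (ex M) a ca hM) => j; rewrite -/(bit M).
have Eq v : (N a v <= 1) <-> cut_body (cuts bit) v by rewrite -Ea.
have /andP[p1 p2] := cut_point_bounds (R := R) m0 j.
have lv : 0 < level_size M :> R by rewrite invr_gt0 exprn_gt0.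
have lv1 : level_size M <= 1 :> R by rewrite invf_le1 ?exprn_ege1 ?exprn_gt0//; lra.
split=> bj.
  apply/Eq; apply: parabola_in => //; first by apply/andP; split; lra.
  by move=> t d; exact: cuts_separated.
have [d0 _] := cut_depth_bounds (R := R) m0 M.
rewrite ltNge; apply/negP => /Eq; apply: parabola_out => //.
by exists M, j.
Qed.

End NotAll.

(** * Density *)

Section Bump.
Context {R : realType}.
Implicit Types (s t : R) (N : nat).

Definition bump N s : R := cos (pi * s) ^+ (2 * N).

(** The Wallis product, which is the mean of [bump N] over a period. *)
Fixpoint bump_mean N : R :=
  if N is N'.+1 then (2 * N'%:R + 1) / (2 * N'%:R + 2) * bump_mean N' else 1.

(* Reduction formula for the primitive of [cos ^ 2N - mean]. *)
Fixpoint bump_primitive N s : R :=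
  if N is N'.+1 then cos (pi * s) ^+ (2 * N').+1 * sin (pi * s) / ((2 * N'%:R + 2) * pi)
     + (2 * N'%:R + 1) / (2 * N'%:R + 2) * bump_primitive N' s
  else 0.

Lemma bump_ge0 N s : 0 <= bump N s.
Proof. by rewrite /bump exprM exprn_ge0// sqr_ge0. Qed.

Lemma bump_le1 N s : bump N s <= 1.
Proof.
by rewrite /bump exprM exprn_ile1 ?sqr_ge0.
Qed.

Lemma bump0 N : bump N 0 = 1.
Proof. by rewrite /bump mulr0 cos0 expr1n. Qed.

Lemma bump_mean_gt0 N : 0 < bump_mean N.
Proof.
elim: N => [|N IH] /=; first exact: ltr01.
by rewrite mulr_gt0// divr_gt0// ltr_wpDl// mulr_ge0.
Qed.

(** The left-hand side does not increase with N, because (2N + 1)(2N + 3) <= (2N + 2)^2. *)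
Lemma bump_mean_le N : bump_mean N ^+ 2 * (2 * N%:R + 1) <= 1.
Proof.
elim: N => [|N IH] /=; first by rewrite expr1n; lra.
have N0 : 0 <= N%:R :> R by [].
rewrite exprMn -[N.+1%:R]natr1; set e := bump_mean N in IH *.
have -> : ((2 * N%:R + 1) / (2 * N%:R + 2)) ^+ 2 * e ^+ 2 * (2 * (N%:R + 1) + 1) =
  (e ^+ 2 * (2 * N%:R + 1)) * ((2 * N%:R + 1) * (2 * N%:R + 3) / (2 * N%:R + 2) ^+ 2) :> R.
  by field; rewrite gt_eqF//; lra.
rewrite -[leRHS]mulr1; apply: ler_pM => //.
- by rewrite mulr_ge0 ?sqr_ge0//; lra.
- by rewrite ler_pdivrMr ?exprn_gt0// mul1r; lra.
Qed.

Lemma bump_mean_small (e : R) : 0 < e -> exists N, bump_mean N <= e.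
Proof.
move=> e0; exists (Num.truncn ((e ^+ 2)^-1)).+1; set N := _.+1.
have hN : (e ^+ 2)^-1 < N%:R by exact: truncnS_gt.
have e2 : 0 < e ^+ 2 by rewrite exprn_gt0.
rewrite -(ler_pXn2r (n := 2)) ?nnegrE ?(ltW e0) ?(ltW (bump_mean_gt0 N))//.
have hp : 1 <= e ^+ 2 * N%:R by rewrite -ler_pdivrMl// mulr1 ltW.
have Np : 0 < 2 * N%:R + 1 :> R by rewrite ltr_wpDl// mulr_ge0.
rewrite -(ler_pM2r Np); apply: le_trans (bump_mean_le N) _.
have : 0 <= e ^+ 2 * N%:R by lra.
rewrite mulrDr; lra.
Qed.

Lemma is_derive_cos_pi s : is_derive s 1 (fun t : R => cos (pi * t)) (- (pi * sin (pi * s))).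
Proof.
have h := is_derive_affine (0 : R) pi s.
have := @is_derive1_comp R cos (fun t => 0 + pi * t) s _ _ (is_derive_cos _) h.
by rewrite add0r mulrC mulrN; under [X in is_derive _ _ X]eq_fun do rewrite /= add0r.
Qed.

Lemma is_derive_sin_pi s : is_derive s 1 (fun t : R => sin (pi * t)) (pi * cos (pi * s)).
Proof.
have h := is_derive_affine (0 : R) pi s.
have := @is_derive1_comp R sin (fun t => 0 + pi * t) s _ _ (is_derive_sin _) h.
by rewrite add0r mulrC; under [X in is_derive _ _ X]eq_fun do rewrite /= add0r.
Qed.

Lemma bump_primitive_derive N s : is_derive s 1 (bump_primitive N) (bump N s - bump_mean N).
Proof.
elim: N => [|N IH].
  rewrite /bump muln0 expr0 subrr; exact: is_derive_cst.
pose c := cos (pi * s); pose d := sin (pi * s).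
have dc := is_derive_cos_pi s; have ds := is_derive_sin_pi s.
have dp : is_derive s 1 (fun t : R => cos (pi * t) ^+ (2 * N).+1)
    ((2 * N).+1%:R * c ^+ (2 * N) * (- (pi * d))).
  by have := is_deriveX (2 * N).+1 dc; rewrite exprfctE; exact.
have dm := is_deriveM dp ds.
have dz := is_deriveZ ((2 * N%:R + 2) * pi)^-1 dm.
have dz2 := is_deriveZ ((2 * N%:R + 1) / (2 * N%:R + 2)) IH.
have := is_deriveD dz dz2.
have -> : (((2 * N%:R + 2) * pi)^-1 \*: (fun x : R => cos (pi * x) ^+ (2 * N).+1 * sin (pi * x))
   + ((2 * N%:R + 1) / (2 * N%:R + 2)) \*: bump_primitive N) = bump_primitive N.+1.
  apply/funext => t; rewrite fctE /=; congr (_ + _); exact: mulrC.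
move=> D; apply: is_derive_eq D _.
rewrite /GRing.scale /= -/c -/d.
have cd : d ^+ 2 = 1 - c ^+ 2 by rewrite -(cos2Dsin2 (pi * s)) -/c -/d; ring.
have E1 : bump N.+1 s = c ^+ (2 * N) * c ^+ 2 by rewrite /bump -exprD; congr (_ ^+ _); lia.
have E2 : bump N s = c ^+ (2 * N) by [].
rewrite E1 E2 exprS.
have -> : (2 * N).+1%:R = 2 * N%:R + 1 :> R by rewrite -[(2 * N).+1%:R]natr1 natrM.
have p0 : pi != 0 :> R by rewrite gt_eqF// pi_gt0.
have n0 : 2 * N%:R + 2 != 0 :> R by rewrite gt_eqF// ltr_wpDl// mulr_ge0.
have -> : c * c ^+ (2 * N) * (pi * c) + d * ((2 * N%:R + 1) * c ^+ (2 * N) * - (pi * d)) =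
  pi * c ^+ (2 * N) * (c ^+ 2 - (2 * N%:R + 1) * d ^+ 2) by ring.
rewrite cd; move: p0; clearbody c d; clear -n0; generalize (@pi R) => P P0.
field.
by rewrite n0 P0.
Qed.

Lemma bump_primitive_shift N s : bump_primitive N (s + 1) = bump_primitive N s.
Proof.
elim: N => [|N IH] //=; rewrite IH mulrDr mulr1 cosDpi sinDpi; congr (_ / _ + _).
by rewrite !exprS !exprM sqrrN; ring.
Qed.

Lemma bump_shift N s : bump N (s + 1) = bump N s.
Proof. by rewrite /bump mulrDr mulr1 cosDpi exprM sqrrN -exprM. Qed.

Lemma shift_int (F : R -> R) : (forall s, F (s + 1) = F s) -> forall (z : int) s, F (s + z%:~R) = F s.
Proof.
move=> h; have hn (n : nat) s : F (s + n%:R) = F s.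
  elim: n s => [|n IH] s; first by rewrite addr0.
  by rewrite -[n.+1%:R]natr1 addrA h IH.
case=> n s; first exact: hn.
by rewrite NegzE mulrNz -[in RHS](subrK (n.+1%:R) s) hn.
Qed.

Lemma bump_primitive_bounded N : exists2 B : R, 0 <= B & forall s, `|bump_primitive N s| <= B.
Proof.
have cG : continuous (bump_primitive N) by exact: (is_derive_continuous (bump_primitive_derive N)).
have c01 : {within `[0, 1], continuous (bump_primitive N)} by exact: continuous_subspaceT.
have [u _ hu] := EVT_max (ler01 : (0 : R) <= 1) c01.
have [l _ hl] := EVT_min (ler01 : (0 : R) <= 1) c01.
exists (`|bump_primitive N u| + `|bump_primitive N l|); first by rewrite addr_ge0.
move=> s; rewrite -(shift_int (bump_primitive_shift N) (- Num.floor s)) mulrNz.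
have s01 : s - (Num.floor s)%:~R \in `[0, 1].
  by rewrite in_itv /= subr_ge0 floor_le_tmp lerBlDr addrC -intrD1 ltW// floorD1_gt.
have := hu _ s01; have := hl _ s01.
set x := bump_primitive N (s - _); set p := bump_primitive N u; set q := bump_primitive N l.
have := ler_norm p; have := ler_norm (- q); rewrite normrN.
have := normr_ge0 p; have := normr_ge0 q.
by rewrite ler_norml => *; apply/andP; split; lra.
Qed.

End Bump.

Section Auxiliary.
Context {R : realType}.
Local Notation plane := 'rV[R]_2.
Implicit Types (x y v w p q : plane).

Lemma is_derive_bigsum (V : normedModType R) (J : Type) (s : seq J) (P : pred J)
    (F : J -> V -> R) (dF : J -> R) (z e : V) :
  (forall j, is_derive z e (F j) (dF j)) ->
  is_derive z e (fun t => \sum_(j <- s | P j) F j t) (\sum_(j <- s | P j) dF j).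
Proof.
move=> hF; elim: s => [|j s IH].
  rewrite big_nil; have -> : (fun t => \sum_(j <- [::] | P j) F j t) = cst (0 : R).
    by apply/funext => t; rewrite big_nil.
  exact: is_derive_cst.
have -> : (fun t => \sum_(j <- j :: s | P j) F j t) =
    (if P j then F j else cst 0) + (fun t => \sum_(j <- s | P j) F j t).
  by apply/funext => t; rewrite big_cons fctE; case: (P j); rewrite //= add0r.
have -> : \sum_(j <- j :: s | P j) dF j =
    (if P j then dF j else 0) + \sum_(j <- s | P j) dF j.
  by rewrite big_cons; case: (P j); rewrite ?add0r.
by apply: is_deriveD IH; case: (P j); [exact: hF|exact: is_derive_cst].
Qed.

Lemma subr1_prod_le (J : Type) (s : seq J) (P : pred J) (F : J -> R) :
  (forall j, 0 <= F j <= 1) -> 1 - \prod_(j <- s | P j) (1 - F j) <= \sum_(j <- s | P j) F j.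
Proof.
move=> hF; elim: s => [|j s IH]; first by rewrite !big_nil subrr.
rewrite !big_cons; case: (P j) => //; have /andP[F0 F1] := hF j.
have p1 : \prod_(j <- s | P j) (1 - F j) <= 1.
  by apply: Num.Theory.prodr_ile1 => i _; have /andP[] := hF i => *; apply/andP; split; lra.
have : 0 <= F j * (1 - \prod_(j <- s | P j) (1 - F j)) by rewrite mulr_ge0// subr_ge0.
move: IH; set q := \prod_(_ <- _ | _) _; set t := \sum_(_ <- _ | _) _; lra.
Qed.

Definition perp v : plane := \row_j (if j == 0 then - v 0 1 else v 0 0).

Lemma dotp_perp v w : dotp (perp v) w = v 0 0 * w 0 1 - v 0 1 * w 0 0.
Proof. by rewrite dotpE !mxE /=; ring. Qed.

Lemma dotp_perp_self v : dotp (perp v) v = 0.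
Proof. by rewrite dotp_perp; ring. Qed.

Lemma dotp_perpp v : dotp (perp v) (perp v) = dotp v v.
Proof. by rewrite !dotpE !mxE /=; ring. Qed.

Lemma enorm_perp v : enorm (perp v) = enorm v.
Proof. by rewrite /enorm dotp_perpp. Qed.

Lemma perp_decomposition v p : v != 0 ->
  p - (dotp p (perp v) / dotp v v) *: perp v = (dotp p v / dotp v v) *: v.
Proof.
move=> v0; have vv : dotp v v != 0.
  by rewrite -sqr_enorm expf_neq0// gt_eqF// enorm_gt0.
by apply: plane_eq; move: vv; rewrite !dotpE !mxE /= => vv; field.
Qed.

Lemma enorm_projection v p : v != 0 ->
  enorm ((dotp p v / dotp v v) *: v) = `|dotp p v| / enorm v.
Proof.
move=> v0; have := enorm_gt0 v0 => ev.
rewrite enormZ normrM normfV -sqr_enorm (ger0_norm (sqr_ge0 _)).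
by field; rewrite gt_eqF.
Qed.

End Auxiliary.

Section FoldConvex.
Context {R : realDomainType} {J : eqType}.
Implicit Types (om X : J -> R) (s : seq J).

(** Successive interpolation from the default c. With weights in [0, 1] it is a convex combination
    even if they do not sum to 1, so a lower bound common to c and all [X j] passes to it. *)
Definition convex_fold om X (c : R) s := foldr (fun j acc => om j * X j + (1 - om j) * acc) c s.

Lemma convex_fold_ge om X c s (b : R) : (forall j, 0 <= om j <= 1) -> b <= c ->
  (forall j, b <= X j) -> b <= convex_fold om X c s.
Proof.
move=> hom bc bX; elim: s => //= j s IH; have /andP[h0 h1] := hom j.
have := ler_wpM2l h0 (bX j); have h2 : 0 <= 1 - om j by rewrite subr_ge0.
have := ler_wpM2l h2 IH; rewrite mulrBl mul1r.
set z := convex_fold _ _ _ _; set u := om j * X j; set w := (1 - om j) * z; set q := om j * b.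
lra.
Qed.

Lemma convex_fold_eq0 om X c s : {in s, forall j, om j = 0} -> convex_fold om X c s = c.
Proof.
elim: s => //= j s IH h; rewrite h ?mem_head// mul0r add0r subr0 mul1r IH// => i si.
by rewrite h// in_cons si orbT.
Qed.

Lemma convex_fold_single om X c s i : uniq s -> i \in s -> {in s, forall j, j != i -> om j = 0} ->
  convex_fold om X c s = om i * X i + (1 - om i) * c.
Proof.
elim: s => //= j s IH /andP[js us]; rewrite in_cons => /orP[/eqP ij|si] h.
  rewrite -ij convex_fold_eq0// => k sk; apply: h; first by rewrite in_cons sk orbT.
  by move: js; rewrite -ij; apply: contraNneq => <-.
have ji : j != i by apply: contraNneq js => ->.
rewrite (h j (mem_head _ _) ji) mul0r add0r subr0 mul1r IH// => k sk; apply: h.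
by rewrite in_cons sk orbT.
Qed.

End FoldConvex.

Section CkConstruction.
Context {R : realType}.
Local Notation plane := 'rV[R]_2.

Lemma Ck_bump k N (q : plane) : Ck k (fun x => bump N (dotp q x)).
Proof.
apply: (@Ck_ext _ _ (fun x => cos (dotp (pi *: q) x) ^+ (2 * N))).
  by move=> x; rewrite dotpZl.
by apply: Ck_exp; have [] := Ck_sin_cos k (pi *: q).
Qed.

Lemma Ck_bump_primitive k N (q : plane) : Ck k (fun x => bump_primitive N (dotp q x)).
Proof.
have [Cs Cc] := Ck_sin_cos k (pi *: q).
elim: N => [|N IH] /=; first exact: Ck_cst.
apply: Ck_add; last by apply: Ck_mul => //; exact: Ck_cst.
apply: Ck_mul; last exact: Ck_cst.
apply: (@Ck_ext _ _ (fun x => cos (dotp (pi *: q) x) ^+ (2 * N).+1 * sin (dotp (pi *: q) x))).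
  by move=> x; rewrite dotpZl.
by apply: Ck_mul => //; exact: Ck_exp.
Qed.

Lemma Ck_convex_fold k (J : eqType) (om X : J -> plane -> R) (c : R) (s : seq J) :
  (forall j, Ck k (om j)) -> (forall j, Ck k (X j)) ->
  Ck k (fun x => convex_fold (om^~ x) (X^~ x) c s).
Proof.
move=> Com CX; elim: s => [|j s IH] /=; first exact: Ck_cst.
apply: Ck_add; first exact: Ck_mul.
by apply: Ck_mul => //; apply: Ck_sub => //; exact: Ck_cst.
Qed.

End CkConstruction.

(** * The coefficient attached to finitely many lattice directions *)

Section Construction.
Context {R : realType} {J : finType}.
Local Notation plane := 'rV[R]_2.
Implicit Types (x y v w p q : plane) (i j : J).
Variables (K : J -> 'rV[int]_2) (L : set plane) (r s : R) (N : nat).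
Hypotheses (WL : Wbodies L) (r0 : 0 < r) (hr : forall x, enorm x <= r -> L x)
  (hs : forall x, L x -> enorm x <= s).
Local Notation u i := (lattice (K i) : plane).
Local Notation h := (support_function L).
Local Notation eta := (bump_mean N : R).
Local Notation m := (#|J|%:R : R).
Hypotheses (K0 : forall i, u i != 0)
  (Kx : forall i j, i != j -> K i 0 0 * K j 0 1 - K i 0 1 * K j 0 0 != 0)
  (J2 : forall i, exists j, j != i) (etam : (m + 2) * eta < 1) (i0 : J).

Let hnorm : plane_norm h r s. Proof. exact: support_function_norm. Qed.
Let s0 : 0 < s. Proof. exact: plane_norm_be hnorm. Qed.
Let m0 : 0 <= m. Proof. exact: ler0n. Qed.
Let eta0 : 0 <= eta. Proof. by rewrite ltW// bump_mean_gt0. Qed.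
Let eu i : 0 < enorm (u i). Proof. exact: enorm_gt0. Qed.

(** The argument is the determinant of [u i] and x, constant along [u i] and an integer at lattice
    points. So the bump is periodic and equals 1 on each line directed by [u i] through a lattice
    point. *)
Definition line_bump i x := bump N (dotp (perp (u i)) x).
Definition line_weight i x := line_bump i x * \prod_(j | j != i) (1 - line_bump j x).
(** The triangle inequality for p in L minus its normal parts weighted by the bumps: the part along
    [u i] costs the slope of h, what remains of the normal part s times [1 - line_bump i x], and
    every other direction s times its bump. *)
Definition line_cost i x : R := h (u i) / enorm (u i) +
  s * ((1 - line_bump i x) + \sum_(j | j != i) line_bump j x).

(* The reciprocal of the coefficient: close to the slope of [h] in direction
   [u i] on the closed geodesic carried by [u i], and large away from these
   lines. *)
Definition slowness x : R :=
  convex_fold (line_weight^~ x) (line_cost^~ x) ((m + 1) * s) (enum J) + m * s * eta.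

Lemma line_bump01 i x : 0 <= line_bump i x <= 1.
Proof. by rewrite bump_ge0 bump_le1. Qed.

Let lb0 i x : 0 <= line_bump i x. Proof. by have /andP[] := line_bump01 i x. Qed.
Let lb1 i x : 0 <= 1 - line_bump i x. Proof. by have /andP[_] := line_bump01 i x; rewrite subr_ge0. Qed.

Lemma line_weight01 i x : 0 <= line_weight i x <= 1.
Proof.
have h1 : 0 <= \prod_(j | j != i) (1 - line_bump j x) by apply: prodr_ge0.
have h2 : \prod_(j | j != i) (1 - line_bump j x) <= 1.
  by apply: Num.Theory.prodr_ile1 => j _; rewrite lb1 lerBlDr lerDl lb0.
have /andP[h3 h4] := line_bump01 i x.
by rewrite /line_weight mulr_ge0//= -[leRHS]mulr1 ler_pM.
Qed.

Lemma slope_bounds i : r <= h (u i) / enorm (u i) <= s.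
Proof.
by have [_ _ _ _ /(_ (u i))] := hnorm; rewrite ler_pdivlMr// ler_pdivrMr.
Qed.

Lemma slowness_ge (x : plane) (c : R) : c <= (m + 1) * s ->
  (forall i, c <= line_cost i x) -> c + m * s * eta <= slowness x.
Proof.
move=> h1 h2; rewrite lerD2r; apply: convex_fold_ge => // j; exact: line_weight01.
Qed.

Lemma slowness_gt0 x : 0 < slowness x.
Proof.
apply: lt_le_trans r0 _; have mse : 0 <= m * s * eta by rewrite !mulr_ge0// ltW.
apply: le_trans (slowness_ge (c := r) _ _); first by rewrite lerDl.
  have /andP[h1 h2] := slope_bounds i0.
  by apply: le_trans h1 _; apply: le_trans h2 _; rewrite ler_peMl ?(ltW s0)// lerDr.
move=> i; have /andP[h1 _] := slope_bounds i; apply: le_trans h1 _.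
by rewrite lerDl mulr_ge0 ?(ltW s0)// addr_ge0// sumr_ge0.
Qed.

Lemma Ck_slowness k : Ck k slowness.
Proof.
have Cb i : Ck k (line_bump i) by exact: Ck_bump.
have C1b i : Ck k (fun x => 1 - line_bump i x) by apply: Ck_sub => //; exact: Ck_cst.
apply: Ck_add; last exact: Ck_cst.
apply: Ck_convex_fold => i.
  by apply: Ck_mul => //; apply: Ck_prod.
apply: Ck_add; first exact: Ck_cst.
apply: Ck_mul; first exact: Ck_cst.
by apply: Ck_add => //; apply: Ck_sum.
Qed.

Lemma dotp_perp_lattice (k l : 'rV[int]_2) :
  dotp (perp (lattice k : plane)) (lattice l) = (k 0 0 * l 0 1 - k 0 1 * l 0 0)%:~R.
Proof. by rewrite dotp_perp !mxE intrB !intrM. Qed.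

Lemma line_bump_lattice i k x : line_bump i (x + lattice k) = line_bump i x.
Proof. by rewrite /line_bump dotpDr dotp_perp_lattice (shift_int (bump_shift N)). Qed.

Lemma slowness_periodic : periodic slowness.
Proof.
move=> k x; rewrite /slowness -/(lattice k); congr (convex_fold _ _ _ _ + _).
  by apply/funext => i; rewrite /line_weight line_bump_lattice; congr (_ * _);
    apply: eq_bigr => j _; rewrite line_bump_lattice.
apply/funext => i; rewrite /line_cost line_bump_lattice; congr (_ + _ * (_ + _)).
by apply: eq_bigr => j _; rewrite line_bump_lattice.
Qed.

Definition density_coefficient x : R := (slowness x)^-1.
Local Notation a := density_coefficient.

Lemma density_coefficient_gt0 x : 0 < a x.
Proof. by rewrite invr_gt0 slowness_gt0. Qed.

Lemma Ck_density_coefficient k : Ck k a.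
Proof. by apply: Ck_inv (Ck_slowness k) => x; rewrite gt_eqF// slowness_gt0. Qed.

Lemma density_coefficient_periodic : periodic a.
Proof. by move=> k x; rewrite /a slowness_periodic. Qed.

Lemma density_coefficient_bounds : exists am aM, periodic_bounds a am aM.
Proof.
have ca := Ck_continuous (Ck_density_coefficient 0).
have pa := density_coefficient_periodic.
have [x0 [x1 hx]] := periodic_bounded ca pa.
by exists (a x0), (a x1); split => //; exact: density_coefficient_gt0.
Qed.

(* For p in L, [p - normal_part p i] has norm at most the slope of [h] along
   [u i]; the corrector below removes the normal part near the line carried by
   [u i] and costs little elsewhere, because [bump - eta] has mean zero. *)
Definition normal_part p i : plane := (dotp p (perp (u i)) / dotp (u i) (u i)) *: perp (u i).

Lemma enorm_normal_part p i : enorm (normal_part p i) <= enorm p.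
Proof.
have n0 : perp (u i) != 0.
  by apply/eqP => e; have := eu i; rewrite -enorm_perp e enorm0 ltxx.
rewrite /normal_part -dotp_perpp enorm_projection// ler_pdivrMr ?enorm_gt0//.
exact: normr_dotp.
Qed.

Lemma enorm_tangent_part p i : L p -> enorm (p - normal_part p i) <= h (u i) / enorm (u i).
Proof.
move=> Lp; have [_ _ sL _] := WL.
rewrite perp_decomposition// enorm_projection// ler_pM2r ?invr_gt0// ler_norml.
have h1 := dotp_le_support WL (u i) Lp; have h2 := dotp_le_support WL (u i) (sL _ Lp).
by rewrite h1 andbT; move: h2; rewrite dotpNl; lra.
Qed.

Lemma enorm_sum (P : pred J) (F : J -> plane) :
  enorm (\sum_(j | P j) F j) <= \sum_(j | P j) enorm (F j).
Proof.
elim/big_rec2: _ => [|j b v _ IH]; first by rewrite enorm0.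
by apply: le_trans (enormD _ _) _; rewrite lerD2l.
Qed.

Lemma enorm_weighted_normal_parts (P : pred J) (w : J -> R) p : L p -> (forall j, 0 <= w j) ->
  enorm (\sum_(j | P j) w j *: normal_part p j) <= s * \sum_(j | P j) w j.
Proof.
move=> Lp w0; apply: le_trans (enorm_sum _ _) _; rewrite mulr_sumr; apply: ler_sum => j _.
rewrite enormZ ger0_norm// mulrC ler_wpM2r//.
by apply: le_trans (enorm_normal_part _ _) _; exact: hs.
Qed.

Lemma sum_line_bump_le (P : pred J) x : \sum_(j | P j) line_bump j x <= m.
Proof.
apply: (@le_trans _ _ (\sum_(j | P j) 1)).
  by apply: ler_sum => j _; have /andP[] := line_bump01 j x.
by rewrite sumr_const ler_nat max_card.
Qed.

(** [slowness] interpolates between upper bounds that all hold, so it is one itself. The default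
    [(m + 1) * s] bounds p and m normal parts, each of length at most s; [m * s * eta] pays for the
    means subtracted from the bumps. *)
Lemma corrected_gradient_le p x : L p ->
  enorm (p - \sum_j (line_bump j x - eta) *: normal_part p j) <= slowness x.
Proof.
move=> Lp; pose W := \sum_j line_bump j x *: normal_part p j.
have -> : p - \sum_j (line_bump j x - eta) *: normal_part p j =
    (p - W) + \sum_j eta *: normal_part p j.
  rewrite -addrA; congr (_ + _); apply: oppr_inj; rewrite opprK opprD opprK -sumrB.
  by apply: eq_bigr => j _; rewrite scalerBl.
apply: le_trans (enormD _ _) _.
have h1 := enorm_weighted_normal_parts xpredT Lp (fun _ => eta0).
rewrite sumr_const -[#|_|]/#|J| -mulr_natr in h1.
have {}h1 : enorm (\sum_j eta *: normal_part p j) <= m * s * eta.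
  by rewrite mulrAC mulrC [_ * eta]mulrC.
apply: (le_trans (lerD (lexx _) h1)); apply: slowness_ge => [|i].
  apply: le_trans (enormD _ _) _; rewrite enormN.
  have h2 := ler_wpM2l (ltW s0) (sum_line_bump_le xpredT x).
  have := hs Lp; have := enorm_weighted_normal_parts xpredT Lp (lb0^~ x); rewrite -/W; lra.
have E : p - W = (p - normal_part p i) + ((1 - line_bump i x) *: normal_part p i
    - \sum_(j | j != i) line_bump j x *: normal_part p j).
  by rewrite /W (bigD1 i)//= scalerBl scale1r opprD !addrA subrK.
rewrite E; apply: le_trans (enormD _ _) _; apply: lerD; first exact: enorm_tangent_part.
apply: le_trans (enormD _ _) _; rewrite enormN mulrDr; apply: lerD.
  rewrite enormZ ger0_norm// mulrC ler_wpM2r//.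
  by apply: le_trans (enorm_normal_part _ _) _; exact: hs.
exact: enorm_weighted_normal_parts.
Qed.

Definition corrector p x : R := dotp p x -
  \sum_j dotp p (perp (u j)) / dotp (u j) (u j) * bump_primitive N (dotp (perp (u j)) x).

Lemma Ck_corrector k p : Ck k (corrector p).
Proof.
apply: Ck_sub; first exact: Ck_dotp.
by apply: Ck_sum => j; apply: Ck_mul; [exact: Ck_cst|exact: Ck_bump_primitive].
Qed.

Lemma gradient_corrector p x : gradient (corrector p) x =
  p - \sum_j (line_bump j x - eta) *: normal_part p j.
Proof.
apply: gradient_derive => i; rewrite !mxE summxE.
have dG j := is_derive_dotp_comp (delta_mx 0 i : plane)
  (bump_primitive_derive N (dotp (perp (u j)) x)).
have dS := is_derive_bigsum (index_enum J) xpredT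
  (fun j => is_deriveZ (dotp p (perp (u j)) / dotp (u j) (u j)) (dG j)).
have := is_deriveB (is_derive_dotp p x (delta_mx 0 i)) dS.
rewrite dotp_delta => D; apply: is_derive_eq D _; congr (_ - _); apply: eq_bigr => j _.
by rewrite dotp_delta !mxE /= -/(line_bump j x) /GRing.scale /=; ring.
Qed.

Lemma support_le_stable_norm v : h v <= stable_norm a v.
Proof.
have [am [aM Ha]] := density_coefficient_bounds.
apply: (support_function_le WL) => p Lp.
have [B B0 hB] := bump_primitive_bounded (R := R) N.
pose c j : R := dotp p (perp (u j)) / dotp (u j) (u j).
have bnd x : `|corrector p x - dotp p x| <= \sum_j `|c j| * B.
  rewrite /corrector addrAC subrr sub0r normrN; apply: le_trans (ler_norm_sum _ _ _) _.
  by apply: ler_sum => j _; rewrite normrM ler_wpM2l.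
apply: (le_stable_norm Ha (c := 2 * \sum_j `|c j| * B)) => l l0.
apply: (metric_dist_ge_path Ha) => b pb.
have := path_ge (Ck_continuous (Ck_density_coefficient 0)) density_coefficient_gt0
  (Ck_corrector 1 p) _ pb.
have := bnd 0; have := bnd (l *: v); rewrite dotpZr dotp0r subr0 !ler_norml.
move=> /andP[h1 h2] /andP[h3 h4] h5.
have /h5 : forall x, [set: plane] x -> a x * enorm (gradient (corrector p) x) <= 1.
  move=> x _; rewrite gradient_corrector /density_coefficient mulrC ler_pdivrMr ?slowness_gt0// mul1r.
  exact: corrected_gradient_le.
lra.
Qed.

(** A majorant of [slowness] on the line i with an explicit primitive. There the weights of the
    other directions vanish, and the share of the default is at most the sum of the other bumps:
    this gives [m + 1] of the factor [m + 2], and [line_cost] gives 1. *)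
Definition line_bound i x : R := h (u i) / enorm (u i) + m * s * eta +
  (m + 2) * s * \sum_(j | j != i) line_bump j x.

Definition line_primitive i (t : R) : R := (h (u i) / enorm (u i) + m * s * eta) * t +
  (m + 2) * s * \sum_(j | j != i)
    (bump_primitive N (dotp (perp (u j)) (u i) * t) / dotp (perp (u j)) (u i) + eta * t).

Lemma line_bump_line i (t : R) : line_bump i (t *: u i) = 1.
Proof. by rewrite /line_bump dotpZr dotp_perp_self mulr0 bump0. Qed.

Lemma slowness_line i (t : R) : slowness (t *: u i) <= line_bound i (t *: u i).
Proof.
rewrite /slowness (@convex_fold_single _ _ _ _ _ _ i) ?enum_uniq ?mem_enum//; last first.
  move=> j _ ji; rewrite /line_weight (bigD1 i) 1?eq_sym//= line_bump_line.
  by rewrite subrr mul0r mulr0.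
have /andP[w0 w1] := line_weight01 i (t *: u i).
have hX : line_cost i (t *: u i) =
    h (u i) / enorm (u i) + s * \sum_(j | j != i) line_bump j (t *: u i).
  by rewrite /line_cost line_bump_line subrr add0r.
have hW : 1 - line_weight i (t *: u i) <= \sum_(j | j != i) line_bump j (t *: u i).
  rewrite /line_weight line_bump_line mul1r; apply: subr1_prod_le => j.
  exact: line_bump01.
have X0 : 0 <= line_cost i (t *: u i).
  rewrite hX; apply: addr_ge0; last by rewrite mulr_ge0 ?(ltW s0)// sumr_ge0.
  by have /andP[h1 _] := slope_bounds i; apply: le_trans h1; exact: ltW.
have C0 : 0 <= (m + 1) * s by rewrite mulr_ge0 ?(ltW s0)// addr_ge0.
have := ler_piMl X0 w1; have := ler_wpM2r C0 hW; rewrite hX /line_bound.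
set S := \sum_(_ | _) _; set w := line_weight _ _; set k := h _ / _; lra.
Qed.

(** Along [u i] the bump of direction j oscillates with the determinant of [u j] and [u i] as
    frequency; dividing by it requires that no two directions be parallel. *)
Lemma line_primitive_derive i (t : R) :
  is_derive t 1 (line_primitive i) (line_bound i (t *: u i)).
Proof.
have d1 := is_derive_affine 0 (h (u i) / enorm (u i) + m * s * eta) t.
have d2 j : is_derive t 1 (fun t : R => if j == i then 0 else
    bump_primitive N (dotp (perp (u j)) (u i) * t) / dotp (perp (u j)) (u i) + eta * t)
    (if j == i then 0 else line_bump j (t *: u i)).
  have [ji|ji] := eqVneq j i; first exact: is_derive_cst.
  pose q := dotp (perp (u j)) (u i).
  have q0 : q != 0 by rewrite /q dotp_perp_lattice intr_eq0 Kx.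
  have e1 := is_derive_affine 0 q t; have e2 := is_derive_affine 0 eta t.
  have e3 := @is_derive1_comp R _ _ t _ _ (bump_primitive_derive N (0 + q * t)) e1.
  have := is_deriveD (is_deriveZ q^-1 e3) e2.
  have -> : q^-1 \*: (bump_primitive N \o (fun t : R => 0 + q * t)) + (fun t : R => 0 + eta * t)
     = (fun t : R => bump_primitive N (q * t) / q + eta * t).
    by apply/funext => z; rewrite fctE /= !add0r [in RHS]mulrC.
  move=> D; apply: is_derive_eq D _.
  rewrite add0r /line_bump dotpZr -/q [t * q]mulrC /GRing.scale /=.
  by field.
have d3 := is_derive_bigsum (index_enum J) xpredT d2.
have := is_deriveD d1 (is_deriveZ ((m + 2) * s) d3).
have -> : (fun t : R => 0 + (h (u i) / enorm (u i) + m * s * eta) * t) +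
    (((m + 2) * s) \*: (fun t : R => \sum_j (if j == i then 0 else
    bump_primitive N (dotp (perp (u j)) (u i) * t) / dotp (perp (u j)) (u i) + eta * t)))
    = line_primitive i.
  apply/funext => z; rewrite fctE /= add0r /line_primitive [in RHS]big_mkcond; congr (_ + _ * _).
  by apply: eq_bigr => j _; case: eqP.
move=> D; apply: is_derive_eq D _; rewrite /line_bound [in RHS]big_mkcond; congr (_ + _ * _).
by apply: eq_bigr => j _; case: eqP.
Qed.

(** The frequencies are integers, so the periodic parts of the primitive cancel over [0, 1] and each
    of the other bumps contributes only its mean [eta]. *)
Lemma line_primitive_period i : line_primitive i 1 - line_primitive i 0 <=
  h (u i) / enorm (u i) + (m * s + (m + 2) * s * m) * eta.
Proof.
have E : \sum_(j | j != i)
      (bump_primitive N (dotp (perp (u j)) (u i) * 1) / dotp (perp (u j)) (u i) + eta * 1)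
   - \sum_(j | j != i)
      (bump_primitive N (dotp (perp (u j)) (u i) * 0) / dotp (perp (u j)) (u i) + eta * 0)
   <= m * eta.
  rewrite -sumrB; apply: (@le_trans _ _ (\sum_(j | j != i) eta)).
    apply: ler_sum => j _; rewrite mulr1 !mulr0 addr0 mulr1 dotp_perp_lattice.
    by rewrite -[X in bump_primitive N X]add0r (shift_int (bump_primitive_shift N)) addrAC subrr add0r.
  by rewrite sumr_const -[leLHS]mulr_natl ler_wpM2r// ler_nat max_card.
have C0 : 0 <= (m + 2) * s by rewrite mulr_ge0 ?(ltW s0)// addr_ge0.
have := ler_wpM2l C0 E; rewrite /line_primitive.
move: (\sum_(j | j != i) _) (\sum_(j | j != i) _) => S1 S2; lra.
Qed.

Lemma stable_norm_line i :
  stable_norm a (u i) <= h (u i) + enorm (u i) * ((m * s + (m + 2) * s * m) * eta).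
Proof.
have [am [aM Ha]] := density_coefficient_bounds.
apply: le_trans (stable_norm_lattice Ha (K i)) _.
have cl : continuous (fun t : R => line_bound i (t *: u i)).
  move=> t; apply: (continuous_comp (f := fun t : R => t *: u i) (g := line_bound i)).
    exact: scalel_continuous.
  apply: (@Ck_continuous _ 0); apply: Ck_add; first exact: Ck_cst.
  apply: Ck_mul; first exact: Ck_cst.
  by apply: Ck_sum => j; exact: Ck_bump.
have [|c pc hc] := path_segment_primitive (Ck_continuous (Ck_density_coefficient 0))
    density_coefficient_gt0 (x := 0) (y := u i) cl (line_primitive_derive i).
  by move=> t _; rewrite add0r subr0 invrK; exact: slowness_line.
apply: le_trans (metric_dist_le_path Ha pc) _; apply: le_trans hc _; rewrite subr0.
apply: le_trans (ler_wpM2l (enorm_ge0 _) (line_primitive_period i)) _.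
by rewrite mulrDr mulrCA divff ?mulr1// gt_eqF.
Qed.

(** At the origin all lines meet, every weight vanishes and the slowness takes its default value. On
    the line i0 the majorant attains its mean somewhere, and [etam] makes that mean smaller. *)
Lemma coefficient_density : coefficient a.
Proof.
split; [exact: density_coefficient_periodic|exact: Ck_density_coefficient|
  exact: density_coefficient_gt0|].
have b0 : slowness 0 = (m + 1) * s + m * s * eta.
  rewrite /slowness convex_fold_eq0// => i _; have [j ji] := J2 i.
  rewrite /line_weight (bigD1 j)//= {2}/line_bump dotp0r bump0 subrr mul0r mulr0 //.
have [t _ ht] := mean_value 0 1 (line_primitive_derive i0).
exists 0, (t *: u i0) => /invr_inj; rewrite b0 => E.
have := slowness_line i0 t; rewrite -E; have := line_primitive_period i0.
rewrite ht subr0 mulr1; have /andP[_ h2] := slope_bounds i0.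
have m1 : 1 <= m by rewrite ler1n; apply/card_gt0P; exists i0.
have : s * m * ((m + 2) * eta) < s * m * 1 by rewrite ltr_pM2l// mulr_gt0//; lra.
set k := h _ / _ in h2 *; lra.
Qed.

End Construction.

(** * From finitely many directions to all of them *)

Section Directions.
Context {R : realType}.
Local Notation plane := 'rV[R]_2.
Implicit Types (x y v w p q : plane) (Q : nat).

Lemma plane_norm_homogeneous (N : plane -> R) al be (c : R) v :
  plane_norm N al be -> N (c *: v) = `|c| * N v.
Proof.
move=> [_ _ NZ NN _]; have [c0|c0] := ger0P c; first exact: NZ.
by rewrite -NN -scaleNr NZ// oppr_ge0 ltW.
Qed.

Lemma plane_norm0 (N : plane -> R) al be : plane_norm N al be -> N 0 = 0.
Proof. by move=> /(plane_norm_homogeneous 0 0); rewrite scale0r normr0 mul0r. Qed.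

(** The vector is scaled to [Q v + z w] with z in [-Q, Q], and z is rounded down to an integer.
    Rounding changes h by at most s and N by at most [(1 + e) * s], while h is at least [r * Q]:
    hence the second factor. *)
Lemma sector_approximation (N h : plane -> R) al be (r s e : R) Q v w :
  plane_norm N al be -> plane_norm h r s -> (0 < Q)%N -> 0 <= e ->
  (forall a b : R, `|a| <= enorm (a *: v + b *: w)) -> h w <= s -> N w <= (1 + e) * s ->
  (forall t : int, - Q%:Z <= t <= Q%:Z ->
     N (Q%:R *: v + t%:~R *: w) <= (1 + e) * h (Q%:R *: v + t%:~R *: w)) ->
  forall a b : R, `|b| <= `|a| ->
    N (a *: v + b *: w) <= (1 + e) * (1 + 2 * s / (r * Q%:R)) * h (a *: v + b *: w).
Proof.
move=> HN Hh Q0 e0 hv hw Nw hQ a b ba.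
have [a0|a0] := eqVneq a 0.
  have b0 : b = 0 by apply/eqP; rewrite -normr_le0; move: ba; rewrite a0 normr0.
  by rewrite a0 b0 !scale0r addr0 (plane_norm0 HN) (plane_norm0 Hh) mulr0.
have q0 : 0 < Q%:R :> R by rewrite ltr0n.
pose z := b * Q%:R / a; pose u := Q%:R *: v + z *: w.
have -> : a *: v + b *: w = (a / Q%:R) *: u.
  rewrite scalerDr !scalerA; congr (_ *: _ + _ *: _); first by rewrite divfK ?gt_eqF.
  by rewrite /z; field; rewrite a0 gt_eqF.
rewrite (plane_norm_homogeneous _ _ HN) (plane_norm_homogeneous _ _ Hh) mulrCA ler_wpM2l//.
have [r0 hD hZ hN hb] := Hh; have [_ ND NZ _ _] := HN.
have /andP[z1 z2] : - Q%:R <= z <= Q%:R.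
  rewrite -ler_norml /z normrM normfV normrM (ger0_norm (ltW q0)) ler_pdivrMr ?normr_gt0//.
  by rewrite mulrC ler_wpM2l// ltW.
pose t := Num.floor z.
have t1 : t%:~R <= z by exact: floor_le_tmp.
have t2 : z < t%:~R + 1 by rewrite -[1]/(1%:~R) -intrD floorD1_gt.
have tQ : - Q%:Z <= t <= Q%:Z.
  by rewrite floor_ge_int_tmp mulrNz z1/= -(ler_int R); apply: le_trans t1 _.
pose g := Q%:R *: v + t%:~R *: w; have d0 : 0 <= z - t%:~R by rewrite subr_ge0.
have Eu : u = g + (z - t%:~R) *: w by rewrite /g -addrA -scalerDl [_ + (z - _)]addrC subrK.
have Eg : g = u + (z - t%:~R) *: - w by rewrite Eu scalerN addrK.
have h1 : N u <= N g + (z - t%:~R) * N w by rewrite Eu -NZ//; exact: ND.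
have h2 : h g <= h u + (z - t%:~R) * h w.
  by rewrite Eg -(hN w) -hZ//; exact: hD.
have zt : z - t%:~R <= 1 by rewrite lerBlDr addrC ltW.
have hu : r * Q%:R <= h u.
  have /andP[+ _] := hb u; apply: le_trans; rewrite ler_wpM2l ?(ltW r0)//.
  by have := hv Q%:R z; rewrite ger0_norm// ltW.
have s0 : 0 < s := plane_norm_be Hh.
have e1 : 0 <= 1 + e by rewrite addr_ge0.
have h3 : (z - t%:~R) * h w <= s.
  by apply: le_trans (ler_wpM2l d0 hw) _; rewrite -[leRHS]mul1r ler_wpM2r// ltW.
have h4 : (z - t%:~R) * N w <= (1 + e) * s.
  apply: le_trans (ler_wpM2l d0 Nw) _; rewrite -[leRHS]mul1r ler_wpM2r//.
  by rewrite mulr_ge0// ltW.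
have h5 : s <= s / (r * Q%:R) * h u.
  by rewrite mulrAC ler_pdivlMr ?mulr_gt0// ler_wpM2l// ltW.
apply: le_trans h1 _; apply: le_trans (lerD (hQ t tQ) h4) _.
rewrite -/g -mulrDr -[leRHS]mulrA ler_wpM2l// -[2 * s / _]mulrA.
by move: (s / _) h5 => k; lra.
Qed.

(** Integer points on two adjacent sides of the square of half-side Q, one corner left out on each:
    one from every pair of opposite boundary points, so no two are parallel. *)
Definition direction Q (j : bool * 'I_(2 * Q)) : 'rV[int]_2 :=
  let z := (j.2 : nat)%:Z - Q%:Z in
  \row_i (if j.1 then (if i == 0 then Q%:Z else z) else (if i == 0 then - z else Q%:Z)).

Lemma direction_cross Q (i j : bool * 'I_(2 * Q)) : i != j ->
  direction i 0 0 * direction j 0 1 - direction i 0 1 * direction j 0 0 != 0.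
Proof.
case: i j => [b1 [z1 h1]] [b2 [z2 h2]] ne; rewrite !mxE /=.
have nez : b1 = b2 -> z1 <> z2.
  by move=> e1 e2; move/eqP: ne; apply; rewrite e1; congr pair; apply: val_inj.
have Q0 : (0 < Q)%N by lia.
by case: b1 b2 nez {ne} => [] [] /= nez; apply/eqP; (try have {}nez := nez erefl); nia.
Qed.

Lemma direction_other Q (i : bool * 'I_(2 * Q)) : exists j, j != i.
Proof. by case: i => [[] i]; [exists (false, i)|exists (true, i)]. Qed.

Lemma lattice_direction Q (b : bool) (z : int) (hz : (`|(z + Q%:Z)%R| < 2 * Q)%N) : - Q%:Z <= z ->
  (lattice (direction (b, Ordinal hz)) : plane) =
  if b then Q%:R *: delta_mx 0 0 + z%:~R *: delta_mx 0 1
  else (- z)%:~R *: delta_mx 0 0 + Q%:R *: delta_mx 0 1.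
Proof.
move=> hz'; have E : (`|(z + Q%:Z)%R|%N)%:Z - Q%:Z = z by lia.
by case: b; apply: plane_eq; rewrite !mxE /= ?E ?mulr1 ?mulr0 ?addr0 ?add0r // mulrNz.
Qed.

Lemma stable_norm_plane_norm (a : plane -> R) am aM : periodic_bounds a am aM ->
  plane_norm (stable_norm a) aM^-1 am^-1.
Proof.
move=> Ha; have [_ _ m0 hb] := Ha; split.
- by have /andP[h1 h2] := hb 0; rewrite invr_gt0; lra.
- exact: (stable_normD Ha).
- exact: (stable_normZ Ha).
- exact: (stable_normN Ha).
- by move=> v; rewrite (stable_norm_ge_enorm Ha) (stable_norm_le_enorm Ha).
Qed.

Lemma norm_approximation (N h : plane -> R) al be (r s e : R) Q :
  plane_norm N al be -> plane_norm h r s -> (0 < Q)%N -> 0 <= e ->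
  (forall j : bool * 'I_(2 * Q),
    N (lattice (direction j)) <= (1 + e) * h (lattice (direction j))) ->
  forall v, N v <= (1 + e) * (1 + 2 * s / (r * Q%:R)) * h v.
Proof.
move=> HN Hh Q0 e0 hj v; have [_ _ _ NN _] := HN; have [r0 _ _ hN hb] := Hh.
pose d0 : plane := delta_mx 0 0; pose d1 : plane := delta_mx 0 1.
have q0 : 0 < Q%:R :> R by rewrite ltr0n.
have good b (z : int) : - Q%:Z <= z < Q%:Z ->
    let w := if b then Q%:R *: d0 + z%:~R *: d1 else (- z)%:~R *: d0 + Q%:R *: d1 in
    N w <= (1 + e) * h w.
  move=> /andP[z1 z2] /=; have hz : (`|(z + Q%:Z)%R| < 2 * Q)%N by lia.
  by have := hj (b, Ordinal hz); rewrite lattice_direction.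
have good0 (t : int) : - Q%:Z <= t <= Q%:Z ->
    N (Q%:R *: d0 + t%:~R *: d1) <= (1 + e) * h (Q%:R *: d0 + t%:~R *: d1).
  move=> /andP[t1]; rewrite le_eqVlt => /orP[/eqP ->|t2].
    (* The corner (Q, Q), missing on this side, belongs to the other one. *)
    by have /= := good false (- Q%:Z); rewrite opprK; apply; lia.
  by apply: (good true); rewrite t1.
have good1 (t : int) : - Q%:Z <= t <= Q%:Z ->
    N (Q%:R *: d1 + t%:~R *: d0) <= (1 + e) * h (Q%:R *: d1 + t%:~R *: d0).
  move=> /andP[]; rewrite addrC le_eqVlt => /orP[/eqP <- _|t1 t2].
    (* The corner (-Q, Q) is reached through its opposite (Q, -Q). *)
    rewrite -NN -hN opprD -!scaleNr mulrNz opprK.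
    by have /= := good true (- Q%:Z); rewrite mulrNz; apply; lia.
  by have /= := good false (- t); rewrite opprK; apply; lia.
have basis (d : plane) : enorm d <= 1 -> N (Q%:R *: d) <= (1 + e) * h (Q%:R *: d) ->
    h d <= s /\ N d <= (1 + e) * s.
  move=> ed hd; have hs : h d <= s.
    have /andP[_ h1] := hb d; apply: le_trans h1 _.
    by rewrite -[leRHS]mulr1 ler_wpM2l// ltW// (plane_norm_be Hh).
  split=> //; move: hd.
  rewrite (plane_norm_homogeneous _ _ HN) (plane_norm_homogeneous _ _ Hh) mulrCA.
  rewrite ler_pM2l ?normr_gt0 ?gt_eqF// => hd; apply: le_trans hd _.
  by rewrite ler_wpM2l// addr_ge0.
have ed0 : enorm d0 <= 1 by apply: le_trans (enorm_le_coord _) _; rewrite !mxE /= normr1 normr0 addr0.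
have ed1 : enorm d1 <= 1 by apply: le_trans (enorm_le_coord _) _; rewrite !mxE /= normr1 normr0 add0r.
have g0 := good0 0; have g1 := good1 0.
rewrite !scale0r !addr0 in g0 g1.
have [h0 N0] : h d0 <= s /\ N d0 <= (1 + e) * s by apply: (basis _ ed0); apply: g0; lia.
have [h1 N1] : h d1 <= s /\ N d1 <= (1 + e) * s by apply: (basis _ ed1); apply: g1; lia.
have Ev : v = v 0 0 *: d0 + v 0 1 *: d1.
  by apply: plane_eq; rewrite !mxE /= !(mulr1, mulr0) ?addr0 ?add0r.
have [c|c] := leP (`|v 0 1|) (`|v 0 0|).
  rewrite Ev; apply: (sector_approximation HN Hh) => // x y.
  apply: le_trans (coord_le_enorm _ 0); by rewrite !mxE /= mulr1 mulr0 addr0.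
rewrite Ev addrC; apply: (sector_approximation HN Hh) => //; last exact: ltW.
move=> x y; apply: le_trans (coord_le_enorm _ 1); by rewrite !mxE /= mulr1 mulr0 addr0.
Qed.

Lemma support_function_approximation (L : set plane) (e : R) : Wbodies L -> 0 < e ->
  exists a, [/\ coefficient a, forall v, support_function L v <= stable_norm a v &
    forall v, stable_norm a v <= (1 + e) * support_function L v].
Proof.
move=> WL e0; have [r [s [r0 s0 hr hs]]] := Wbodies_balls WL.
have Hh := support_function_norm WL r0 hr hs; set h := support_function L.
(* Two factors 1 + d occur, one for the listed directions and one for rounding; for d at most 1
   their product is at most 1 + 3d. *)
pose d := Num.min (e / 3) 1.
have d0 : 0 < d by rewrite lt_min ltr01 divr_gt0.
have d1 : d <= 1 by rewrite ge_min lexx orbT.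
have de : d <= e / 3 by rewrite ge_min lexx.
pose Q := (Num.truncn (2 * s / (r * d))).+1.
have hQ : 2 * s / (r * d) < Q%:R by exact: truncnS_gt.
pose J : finType := (bool * 'I_(2 * Q))%type.
pose m : R := #|J|%:R; have m0 : 0 <= m by exact: ler0n.
pose C : R := m * s + (m + 2) * s * m.
have C0 : 0 <= C by rewrite addr_ge0 ?mulr_ge0 ?addr_ge0 ?(ltW s0).
have C1 : 0 < C + 1 by rewrite ltr_wpDl.
have m2 : 0 < m + 2 by rewrite ltr_wpDl.
(* N is chosen last: C grows with the number of directions, which Q has fixed. The first bound
   controls the error on the directions, the second gives [etam]. *)
have [|N hN] := @bump_mean_small R (Num.min (d * r / (C + 1)) (2 * (m + 2))^-1).
  by rewrite lt_min divr_gt0 ?mulr_gt0// invr_gt0 mulr_gt0.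
move: hN; rewrite le_min => /andP[N1 N2]; have n0 := bump_mean_gt0 (R := R) N.
have etam : (m + 2) * bump_mean N < 1.
  have := ler_wpM2l (ltW m2) N2; rewrite invfM mulrCA divff ?gt_eqF// mulr1; lra.
have CN : C * bump_mean N <= d * r.
  have := N1; rewrite ler_pdivlMr// mulrDr mulr1 [_ * C]mulrC; lra.
pose K : J -> 'rV[int]_2 := @direction Q.
have Kx (i j : J) : i != j -> K i 0 0 * K j 0 1 - K i 0 1 * K j 0 0 != 0 by exact: direction_cross.
have J2 (i : J) : exists j : J, j != i by exact: direction_other.
have K0 (i : J) : (lattice (K i) : plane) != 0.
  have [j] := J2 i; rewrite eq_sym => /Kx; apply: contraNneq => E.
  by rewrite -(intr_eq0 R) -dotp_perp_lattice E dotp_perp !mxE !mul0r subrr.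
have i0 : J by split; [exact: true|exact: (@Ordinal (2 * Q) 0 isT)].
pose a := density_coefficient K L s N; exists a.
have [am [aM Ha]] := density_coefficient_bounds N WL r0 hr hs K0 i0.
have HN := stable_norm_plane_norm Ha.
split; first exact: (coefficient_density WL r0 hr hs K0 Kx J2 etam i0).
  by move=> v; exact: (support_le_stable_norm _ WL r0 hr hs K0 i0).
move=> v; have [_ _ _ _ hb] := Hh; have h0 w : 0 <= h w.
  by have /andP[h1 _] := hb w; apply: le_trans h1; rewrite mulr_ge0 ?enorm_ge0 ?(ltW r0).
have hj (j : bool * 'I_(2 * Q)) : stable_norm a (lattice (direction j)) <=
    (1 + d) * h (lattice (direction j)).
  apply: le_trans (stable_norm_line N WL r0 hr hs K0 Kx i0 j) _.
  rewrite [leRHS]mulrDl mul1r lerD2l; apply: le_trans (ler_wpM2l (enorm_ge0 _) CN) _.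
  rewrite mulrC -mulrA ler_wpM2l// ?(ltW d0)//.
  by have /andP[h1 _] := hb (lattice (K j)).
apply: le_trans (norm_approximation HN Hh _ (ltW d0) hj v) _ => //.
rewrite ler_wpM2r//.
have Qd : 2 * s / (r * Q%:R) <= d.
  rewrite ler_pdivrMr ?mulr_gt0 ?ltr0n// mulrCA mulrA.
  by move: hQ; rewrite ltr_pdivrMr ?mulr_gt0// [Q%:R * _]mulrC => /ltW.
have := ler_wpM2l (_ : 0 <= 1 + d) (lerD (lexx 1) Qd); rewrite addr_ge0 ?(ltW d0)// => /(_ isT).
have := ler_wpM2l (ltW d0) d1; lra.
Qed.

End Directions.

(** * From norms to the two families of bodies *)

Section Main.
Context {R : realType}.
Local Notation plane := 'rV[R]_2.
Implicit Types (x y v w p q : plane) (a b : plane -> R).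

Lemma coefficient_bounds a : coefficient a -> Ck 1 a /\ exists m M, periodic_bounds a m M.
Proof.
move=> [pa sa a0 _]; have ca := Ck_continuous (sa 0%N).
have [x0 [x1 hx]] := periodic_bounded ca pa.
by split; [exact: sa|exists (a x0), (a x1); split].
Qed.

Lemma path_scaled a b (c : R) B x y d : continuous a -> continuous b ->
  (forall z, 0 < a z) -> (forall z, 0 < b z) -> (forall z, a z <= c * b z) ->
  path a B x y d -> exists2 d', path b B x y d' & d' <= c * d.
Proof.
move=> ca cb a0 b0 ab; elim=> {x y d} [x|eta x z y d Ce Be e0 e1 _ [d' pd' hd']].
  by exists 0; [exact: path_nil|rewrite mulr0].
exists (arc_cost b eta + d'); first exact: (path_cons Ce Be e0 e1 pd').
rewrite mulrDr; apply: lerD hd'; rewrite /arc_cost.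
have sa := continuous_speed ca a0 Ce; have sb := continuous_speed cb b0 Ce.
have sca : continuous (fun t => c * speed a eta t).
  by move=> t; apply: cvgM; [exact: cvg_cst|exact: sa].
have -> : c * \int[lebesgue_measure]_(t in `[0, 1]) speed a eta t =
    \int[lebesgue_measure]_(t in `[0, 1]) (c * speed a eta t).
  by rewrite RintegralZl//; exact: continuous_integrable.
apply: le_Rintegral => //; try exact: continuous_integrable.
move=> t _; rewrite /speed mulrCA ler_wpM2l ?enorm_ge0//.
by rewrite ler_pdivlMr// mulrC ler_pdivrMr.
Qed.

Lemma stable_norm_scaled a b (c : R) v : coefficient a -> coefficient b -> 0 < c ->
  (forall x, a x <= c * b x) -> stable_norm b v <= c * stable_norm a v.
Proof.
move=> Ca Cb c0 ab; have [_ [m [M Ha]]] := coefficient_bounds Ca.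
have [_ [m' [M' Hb]]] := coefficient_bounds Cb.
have [ca _ _ _] := Ha; have [cb _ _ _] := Hb.
have [_ _ a0 _] := Ca; have [_ _ b0 _] := Cb.
rewrite -ler_pdivrMl//; apply: (le_stable_norm Ha (c := c^-1 * translation_defect m')) => l l0.
apply: (metric_dist_ge_path Ha) => d pd.
have [d' pd' hd'] := path_scaled ca cb a0 b0 ab pd.
have h1 := stable_norm_le_dist Hb (l *: v); have h2 := metric_dist_le_path Hb pd'.
rewrite (stable_normZ Hb) ?(ltW l0)// in h1.
rewrite mulrCA -mulrBr ler_pdivrMl//; lra.
Qed.

(** Duality reverses the monotonicity of the stable norm. *)
Lemma effective_hamiltonian_scaled a b (c : R) p : coefficient a -> coefficient b -> 0 < c ->
  (forall x, b x <= c * a x) -> effective_hamiltonian b p <= c * effective_hamiltonian a p.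
Proof.
move=> Ca Cb c0 ba; have [C1a [m [M Ha]]] := coefficient_bounds Ca.
have [C1b [m' [M' Hb]]] := coefficient_bounds Cb.
rewrite (effective_hamiltonianE Ha C1a) (effective_hamiltonianE Hb C1b).
apply: (dual_norm_le Hb) => v; apply: le_trans (dotp_le_dual_norm Ha p v) _.
rewrite [c * _]mulrC -mulrA ler_wpM2l ?(dual_norm_ge0 Ha)//.
exact: stable_norm_scaled.
Qed.

Lemma effective_hamiltonianZ a (c : R) p : coefficient a -> 0 <= c ->
  effective_hamiltonian a (c *: p) = c * effective_hamiltonian a p.
Proof.
move=> Ca; have [C1a [m [M Ha]]] := coefficient_bounds Ca.
rewrite !(effective_hamiltonianE Ha C1a).
have le d q : 0 <= d -> dual_norm a (d *: q) <= d * dual_norm a q.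
  move=> d0; apply: (dual_norm_le Ha) => v; rewrite dotpZl -mulrA ler_wpM2l//.
  exact: (dotp_le_dual_norm Ha).
rewrite le_eqVlt => /orP[/eqP <-|c0].
  by apply/eqP; rewrite eq_le le// mul0r (dual_norm_ge0 Ha).
apply/eqP; rewrite eq_le le ?(ltW c0)//= -ler_pdivlMl//.
by rewrite -{1}[p](scalerK (lt0r_neq0 c0)) le// invr_ge0 ltW.
Qed.

Lemma stable_ball_Wbodies a : coefficient a -> Wbodies (stable_ball a).
Proof.
move=> /coefficient_bounds[_ [m [M Ha]]].
exact: unit_ball_Wbodies (stable_norm_plane_norm Ha).
Qed.

Lemma Sset_dual_ball a : coefficient a -> Sset a = [set p | forall v, dotp p v <= stable_norm a v].
Proof.
move=> /coefficient_bounds[C1a [m [M Ha]]].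
by apply/seteqP; split=> p /(SsetE Ha C1a p).
Qed.

Lemma Sset_Wbodies a : coefficient a -> Wbodies (Sset a).
Proof.
move=> Ca; rewrite Sset_dual_ball//; have [_ [m [M Ha]]] := coefficient_bounds Ca.
exact: dual_ball_Wbodies (stable_norm_plane_norm Ha).
Qed.

Lemma Wbodies_dense (F : (plane -> R) -> set plane) :
  (forall K e, Wbodies K -> 0 < e -> exists a, [/\ coefficient a,
    forall x, K x -> F a ((1 + e)^-1 *: x) & forall x, F a x -> K ((1 + e)^-1 *: x)]) ->
  hausdorff_dense [set F a | a in @coefficient R] Wbodies.
Proof.
move=> hF K WK eps eps0; have [r [s [r0 s0 _ hs]]] := Wbodies_balls WK.
have e0 : 0 < eps / (2 * s) by rewrite divr_gt0// mulr_gt0.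
have [a [Ca h1 h2]] := hF K _ WK e0; exists (F a); first by exists a.
apply: le_lt_trans (hausdorff_dist_scaled (ltW e0) hs h1 h2) _.
rewrite lte_fin; have -> : eps / (2 * s) * s = eps / 2 by field; rewrite gt_eqF.
lra.
Qed.

(** The approximation is applied to K itself, and inequalities between support functions become
    inclusions by [bipolar]. *)
Lemma Sset_dense : hausdorff_dense [set Sset a | a in @coefficient R] Wbodies.
Proof.
apply: Wbodies_dense => K e WK e0; have e1 : 0 < 1 + e by lra.
have [a [Ca h1 h2]] := support_function_approximation WK e0.
exists a; split=> // x; rewrite Sset_dual_ball//= => hx.
  move=> v; rewrite dotpZl; apply: le_trans (h1 v).
  have [r [t hn]] := support_function_normW WK; have [r0 _ _ _ /(_ v)/andP[hv _]] := hn.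
  have h0 : 0 <= support_function K v by apply: le_trans hv; rewrite mulr_ge0 ?enorm_ge0 ?(ltW r0).
  rewrite ler_pdivrMl//; apply: le_trans (dotp_le_support WK v hx) _.
  by rewrite ler_peMl//; lra.
apply: (bipolar WK) => v; rewrite dotpZl ler_pdivrMl//.
by apply: le_trans (hx v) (h2 v).
Qed.

(** The approximation is applied to the polar of K, whose support function is the gauge of K. *)
Lemma stable_ball_dense : hausdorff_dense [set stable_ball a | a in @coefficient R] Wbodies.
Proof.
apply: Wbodies_dense => K e WK e0; have e1 : 0 < 1 + e by lra.
have WL := polar_Wbodies WK; set L := [set p | _] in WL.
have [a [Ca h1 h2]] := support_function_approximation WL e0.
have [_ [m [M Ha]]] := coefficient_bounds Ca.
have i0 : 0 <= (1 + e)^-1 by rewrite invr_ge0 ltW.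
exists a; split=> // x hx.
  rewrite /stable_ball /= (stable_normZ Ha)// ler_pdivrMl//; apply: le_trans (h2 x) _.
  rewrite ler_wpM2l ?(ltW e1)//; apply: (support_function_le WL) => p Lp.
  by apply: le_trans Lp; rewrite dotpC; exact: dotp_le_support.
apply: (polar_support WK); rewrite -/L.
have [r [t [_ _ hZ _ _]]] := support_function_normW WL.
rewrite hZ// ler_pdivrMl//; apply: le_trans (h1 x) _; apply: le_trans hx _; lra.
Qed.

Lemma stable_ball_proper : [set stable_ball a | a in @coefficient R] <> Wbodies.
Proof.
apply: (@unit_balls_proper _ (@stable_norm R)) => [a b c v Ca Cb c1 hc|a c v Ca c0].
  by apply: stable_norm_scaled => // [|x]; [lra|have [] := hc x].
by have [_ [m [M Ha]]] := coefficient_bounds Ca; exact: (stable_normZ Ha).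
Qed.

Lemma Sset_proper : [set Sset a | a in @coefficient R] <> Wbodies.
Proof.
apply: (@unit_balls_proper _ (@effective_hamiltonian R)) => [a b c v Ca Cb c1 hc|a c v Ca c0].
  by apply: effective_hamiltonian_scaled => // [|x]; [lra|have [] := hc x].
exact: effective_hamiltonianZ.
Qed.

End Main.

Theorem corollary1p2 (R : realType) :
  [/\ [set Sset a | a in @coefficient R] `<=` Wbodies,
      [set Sset a | a in @coefficient R] <> Wbodies &
      hausdorff_dense [set Sset a | a in @coefficient R] Wbodies] /\
  [/\ [set stable_ball a | a in @coefficient R] `<=` Wbodies,
      [set stable_ball a | a in @coefficient R] <> Wbodies &
      hausdorff_dense [set stable_ball a | a in @coefficient R] Wbodies].
Proof.
split; split.
- by move=> _ [a Ca <-]; exact: Sset_Wbodies.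
- exact: Sset_proper.
- exact: Sset_dense.
- by move=> _ [a Ca <-]; exact: stable_ball_Wbodies.
- exact: stable_ball_proper.
- exact: stable_ball_dense.
Qed.
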